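(* (a) Let $\mathbf{V}$ be a matricially normed space and $u\in\mathbf{V}$ with $\|u\|=1$. Then $n_{\mathrm{cb}}(\mathbf{V};u)>0$ if and only if there exist a Hilbert space $H$ and a completely contractive complete topological injection $\Psi:\mathbf{V}\to\mathcal{L}(H)$ such that $\Psi(u)=\mathrm{id}_H$. (b) If $\mathbf{V}$ is an operator space and $u\in\mathbf{V}$ with $\|u\|=1$, then $n_{\mathrm{cb}}(\mathbf{V};u)=n_{\mathrm{cb}}(\mathbf{V}^{**};u)$.
   Context: All vector spaces are complex. $M_{m,n}$ is the space of complex $m\times n$ matrices with the operator norm and $M_n=M_{n,n}$. A matricially normed space $\mathbf{V}$ is a vector space with a norm on each $M_k(\mathbf{V})$ ($k\in\mathbb{N}$) such that $\|\alpha x\beta\|\le\|\alpha\|\|x\|\|\beta\|$ for all $x\in M_m(\mathbf{V})$, $\alpha\in M_{n,m}$, $\beta\in M_{m,n}$. It is an operator space if moreover $\|x\oplus y\|=\max\{\|x\|,\|y\|\}$ for $x\in M_m(\mathbf{V})$, $y\in M_n(\mathbf{V})$. For Hilbert space $H$, $\mathcal{L}(H)$ is the space of bounded operators, with $M_k(\mathcal{L}(H))=\mathcal{L}(H^k)$. For linear $\varphi:\mathbf{V}\to\mathbf{W}$, $\varphi_k:M_k(\mathbf{V})\to M_k(\mathbf{W})$ denotes entrywise application, $\|\varphi\|_{\mathrm{cb}}=\sup_k\|\varphi_k\|$, and $\mathrm{CB}(\mathbf{V},\mathbf{W})$ is the set of $\varphi$ with $\|\varphi\|_{\mathrm{cb}}<\infty$;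 $\varphi$ is completely contractive if $\|\varphi\|_{\mathrm{cb}}\le1$, and a complete topological injection if it is injective, completely bounded, and $\varphi^{-1}:\varphi(\mathbf{V})\to\mathbf{V}$ is completely bounded. $\mathbf{V}^{**}$ is the operator space bidual (using the standard operator space dual, $M_n(\mathbf{V}^* )=\mathrm{CB}(\mathbf{V},M_n)$), and $u$ is identified with its canonical image in $\mathbf{V}^{**}$. For $u\in\mathbf{V}$ with $\|u\|=1$ put $\mathcal{S}_n(\mathbf{V};u)=\{\varphi\in\mathrm{CB}(\mathbf{V},M_n):\|\varphi\|_{\mathrm{cb}}\le1,\ \varphi(u)=I_n\}$, $\gamma^u_k(x)=\sup\{\|\varphi_k(x)\|:\varphi\in\mathcal{S}_n(\mathbf{V};u),\ n\in\mathbb{N}\}$ for $x\in M_k(\mathbf{V})$, and $n_{\mathrm{cb}}(\mathbf{V};u)=\inf\{\gamma^u_k(x):x\in M_k(\mathbf{V}),\ \|x\|=1,\ k\in\mathbb{N}\}$. *)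

(* Defs.v *)
From HB Require Import structures.
From mathcomp Require Import all_boot all_order all_algebra sesquilinear complex.
From mathcomp Require Import all_classical all_reals all_analysis.
From mathcomp Require Import ring.

Set Implicit Arguments.
Unset Strict Implicit.
Unset Printing Implicit Defensive.

Import Order.TTheory GRing.Theory Num.Theory numFieldNormedType.Exports.
Local Open Scope classical_set_scope.
Local Open Scope ring_scope.
Local Open Scope complex_scope.

(* Norms over [R[i]] take values in [R[i]] in the library; suprema and infima
   are taken in [R], hence this real-valued version. *)
Definition rnorm (R : realType) (W : normedZmodType R[i]) (x : W) : R :=
  complex.Re `|x|.

Section rnorm.
Variables (R : realType).

Lemma rnormE (W : normedZmodType R[i]) (x : W) : (rnorm x)%:C = `|x|.
Proof. by rewrite /rnorm RRe_real. Qed.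

Lemma rnorm_ge0 (W : normedZmodType R[i]) (x : W) : 0 <= rnorm x.
Proof. by rewrite -ler0c rnormE. Qed.

Lemma rnorm0 (W : normedZmodType R[i]) : rnorm (0 : W) = 0.
Proof. by rewrite /rnorm normr0. Qed.

Lemma rnormD (W : normedZmodType R[i]) (x y : W) :
  rnorm (x + y) <= rnorm x + rnorm y.
Proof. by rewrite -lecR rmorphD/= !rnormE ler_normD. Qed.

Lemma rnormZ (W : normedModType R[i]) (a : R[i]) (x : W) :
  rnorm (a *: x) = rnorm a * rnorm x.
Proof. by apply: complexI; rewrite rmorphM/= !rnormE normrZ. Qed.

Lemma rnormM (a b : R[i]) : rnorm (a * b) = rnorm a * rnorm b.
Proof. by apply: complexI; rewrite rmorphM/= !rnormE normrM. Qed.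

Lemma rnorm_sum (I : Type) (r : seq I) (F : I -> R[i]) :
  rnorm (\sum_(i <- r) F i) <= \sum_(i <- r) rnorm (F i).
Proof.
elim/big_ind2 : _ => [|x1 x2 y1 y2 h1 h2|//]; first by rewrite rnorm0.
by rewrite (le_trans (rnormD _ _))// lerD.
Qed.

End rnorm.

HB.mixin Record isHilbert (R : realType) H
    of CompleteNormedModule R[i] H := {
  inner : {dot H for Num.conj} ;
  normr_inner : forall x : H, `|x| ^+ 2 = inner x x }.

#[short(type="hilbertType")]
HB.structure Definition Hilbert (R : realType) :=
  {H of isHilbert R H & CompleteNormedModule R[i] H}.

Section operator_norms.
Variable R : realType.
Local Notation C := R[i].

Definition opnorm (E F : Type) (NE : E -> R) (NF : F -> R) (T : E -> F) : R :=
  sup [set NF (T v) | v in [set v | NE v <= 1]].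

Definition l2norm (W : Type) (N : W -> R) (k : nat) (v : 'I_k -> W) : R :=
  Num.sqrt (\sum_(i < k) N (v i) ^+ 2).

Definition euclid (n : nat) (v : 'cV[C]_n) : R :=
  l2norm (@rnorm R C) (fun i => v i 0).

Definition mxopnorm (m n : nat) (A : 'M[C]_(m, n)) : R :=
  opnorm (@euclid n) (@euclid m) (mulmx A).

(* The norm on L(W^k) of the operator with matrix [T], where W^k carries the
   l^2 norm. *)
Definition ampnorm (W : nmodType) (N : W -> R) (k : nat)
    (T : 'I_k -> 'I_k -> W -> W) : R :=
  opnorm (@l2norm W N k) (@l2norm W N k) (fun v i => \sum_(j < k) T i j (v j)).

Lemma opnorm_itv (E F : Type) (NE : E -> R) (NF : F -> R) (T : E -> F)
    (c : R) (v0 : E) : NE v0 <= 1 ->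
  (forall v, NE v <= 1 -> 0 <= NF (T v) <= c) ->
  (forall v, NE v <= 1 -> NF (T v) <= opnorm NE NF T) /\
  0 <= opnorm NE NF T <= c.
Proof.
move=> v01 hc.
have ub v : NE v <= 1 -> NF (T v) <= opnorm NE NF T.
  move=> v1; apply: ub_le_sup; last by exists v.
  by exists c => _ [w w1 <-]; case/andP: (hc _ w1).
split=> //; apply/andP; split.
  by rewrite (le_trans _ (ub _ v01))//; case/andP: (hc _ v01).
apply: ge_sup; first by exists (NF (T v0)); exists v0.
by move=> _ [w w1 <-]; case/andP: (hc _ w1).
Qed.

Lemma sum_mul_le_l2 (k : nat) (x y : 'I_k -> R) (L : R) : 0 <= L ->
  L ^+ 2 = \sum_i x i ^+ 2 -> \sum_i y i ^+ 2 <= 1 ->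
  \sum_i x i * y i <= L.
Proof.
move=> L0 LE y1; have [L00|Lp] := eqVneq L 0.
  have x0 i : x i = 0.
    apply/eqP; rewrite -sqrf_eq0; move: LE; rewrite L00 expr0n/= => /esym/eqP.
    rewrite psumr_eq0 => [/allP/(_ i)|j _]; last exact: sqr_ge0.
    by rewrite mem_index_enum => /(_ isT).
  by rewrite L00 big1// => i _; rewrite x0 mul0r.
have {}Lp : 0 < L by rewrite lt_neqAle eq_sym Lp.
rewrite -(ler_pM2l Lp) -(ler_pMn2r (n := 2))// -expr2.
apply: (@le_trans _ _ (\sum_i (x i ^+ 2 + L ^+ 2 * y i ^+ 2))).
  rewrite mulr_sumr -sumrMnl; apply: ler_sum => i _.
  rewrite -subr_ge0.
  have -> : x i ^+ 2 + L ^+ 2 * y i ^+ 2 - L * (x i * y i) *+ 2 =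
    (x i - L * y i) ^+ 2 by ring.
  exact: sqr_ge0.
rewrite big_split/= -LE -mulr_sumr mulr2n lerD2l.
by rewrite ler_piMr// sqr_ge0.
Qed.

End operator_norms.

Section bounded_linear_maps.
Variables (R : realType) (V : lmodType R[i]) (N : V -> R).
Variable W : normedModType R[i].

Definition blin_pred : {pred V -> W} := fun f =>
  `[< linear f /\ exists M : R, forall x, rnorm (f x) <= M * N x >].

Record blin := Blin { blin_fun :> V -> W ; _ : blin_fun \in blin_pred }.

HB.instance Definition _ := [isSub for blin_fun].
HB.instance Definition _ := [Choice of blin by <:].

Lemma blin_submod_closed : submod_closed blin_pred.
Proof.
split; first rewrite unfold_in; first apply/asboolP.
  split=> [a x y|]; first by rewrite /= scaler0 addr0.
  by exists 0 => x; rewrite rnorm0 mul0r.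
move=> a f g; rewrite !unfold_in => /asboolP[lf [M hM]] /asboolP[lg [K hK]].
apply/asboolP; split=> [b x y|].
  rewrite !fctE lf lg !scalerDr !scalerA [a * b]mulrC.
  by rewrite addrACA.
exists (rnorm a * M + K) => x.
rewrite !fctE (le_trans (rnormD _ _))// mulrDl rnormZ -mulrA.
by rewrite lerD// ler_wpM2l// rnorm_ge0.
Qed.

HB.instance Definition _ := GRing.isSubmodClosed.Build _ _ blin_pred
  blin_submod_closed.
HB.instance Definition _ := [SubChoice_isSubLmodule of blin by <:].

End bounded_linear_maps.

Section matricially_normed_spaces.
Variable R : realType.
Local Notation C := R[i].

(* A norm on each M_k(V); the norm of [v : V] itself is that of the 1 x 1
   matrix [const_mx v]. The size 0 is allowed throughout: M_0(V) = 0 carries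
   only the zero norm and contributes nothing below. *)
Definition matrix_norms (V : lmodType C) := forall k : nat, 'M[V]_k -> R.

Section defs.
Variables (V : lmodType C) (nV : matrix_norms V).

Definition vnorm (v : V) : R := nV (const_mx v : 'M[V]_1).

Definition bimulmx (m n : nat) (a : 'M[C]_(n, m)) (x : 'M[V]_m)
    (b : 'M[C]_(m, n)) : 'M[V]_n :=
  \matrix_(i, j) \sum_(k < m) \sum_(l < m) (a i k * b l j) *: x k l.

Definition matricially_normed :=
  [/\ forall k (x y : 'M[V]_k), nV (x + y) <= nV x + nV y,
      forall k (a : C) (x : 'M[V]_k),
        nV (map_mx ( *:%R a) x) = rnorm a * nV x,
      forall k (x : 'M[V]_k), nV x = 0 -> x = 0 &
      forall m n (a : 'M[C]_(n, m)) (x : 'M[V]_m) (b : 'M[C]_(m, n)),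
        nV (bimulmx a x b) <= mxopnorm a * nV x * mxopnorm b].

Definition operator_space :=
  matricially_normed /\
  forall m n (x : 'M[V]_m) (y : 'M[V]_n),
    nV (block_mx x 0 0 y) = Num.max (nV x) (nV y).

End defs.

(* The cb norm of the restriction of [f] to a linear subspace [D] of [V]. *)
Definition cb_norm_on (V W : lmodType C) (D : set V) (nV : matrix_norms V)
    (nW : matrix_norms W) (f : V -> W) : \bar R :=
  ereal_sup [set ereal_sup [set (nW k (map_mx f x))%:E | x in
    [set x : 'M[V]_k | (forall i j, D (x i j)) /\ nV k x <= 1]] |
    k in [set: nat]].

Definition cb_norm (V W : lmodType C) := @cb_norm_on V W setT.

Definition completely_contractive (V W : lmodType C) (nV : matrix_norms V)
    (nW : matrix_norms W) (f : V -> W) := (cb_norm nV nW f <= 1)%E.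

(* [g] is f^-1 on f(V); its values elsewhere are irrelevant. *)
Definition complete_top_injection (V W : lmodType C) (nV : matrix_norms V)
    (nW : matrix_norms W) (f : V -> W) :=
  [/\ injective f, (cb_norm nV nW f < +oo)%E &
      exists2 g : W -> V, cancel f g & (cb_norm_on (range f) nW nV g < +oo)%E].

(* M_k(M_n) = L((C^n)^k). *)
Definition mx_norms (n : nat) : matrix_norms 'M[C]_n := fun k x =>
  ampnorm (@euclid R n) (fun i j => mulmx (x i j)).

Definition blop (H : hilbertType R) := blin (@rnorm R H) H.

(* M_k(L(H)) = L(H^k). *)
Definition blop_norms (H : hilbertType R) : matrix_norms (blop H) := fun k T =>
  ampnorm (@rnorm R H) (fun i j => T i j).

Section dual.
Variables (V : lmodType C) (nV : matrix_norms V).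

(* The Banach dual of V, normed at level n as CB(V, M_n). *)
Definition dual := blin (vnorm nV) (C^o : normedModType C).

Definition dual_norms : matrix_norms dual := fun n F =>
  fine (cb_norm nV (@mx_norms n) (fun v => \matrix_(i, j) (F i j v : C))).

Hypothesis hV : matricially_normed nV.

Let nVZ k (a : C) (x : 'M[V]_k) :
  nV (map_mx ( *:%R a) x) = rnorm a * nV x.
Proof. by case: hV. Qed.

Let nVM m n (a : 'M[C]_(n, m)) (x : 'M[V]_m) (b : 'M[C]_(m, n)) :
  nV (bimulmx a x b) <= mxopnorm a * nV x * mxopnorm b.
Proof. by case: hV. Qed.

Lemma matrix_norms0 k : nV (0 : 'M[V]_k) = 0.
Proof.
have /= := nVZ 0 (0 : 'M[V]_k); rewrite rnorm0 mul0r => <-; congr nV.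
by apply/matrixP => i j; rewrite !mxE scaler0.
Qed.

Lemma matrix_norms_ge0 k (x : 'M[V]_k) : 0 <= nV x.
Proof.
have [hD _ _ _] := hV.
have := hD _ x (map_mx ( *:%R (-1)) x).
rewrite nVZ.
have -> : rnorm (-1 : C) = 1 by rewrite /rnorm normrN1.
rewrite (_ : x + _ = 0); last first.
  by apply/matrixP => i j; rewrite !mxE scaleN1r subrr.
by rewrite matrix_norms0 mul1r -mulr2n pmulrn_lge0.
Qed.

(* A bounded functional is completely bounded, with the same bound. *)
Lemma mx_norms_functional_le (f : V -> C) (M : R) :
  linear (f : V -> C^o) -> 0 <= M -> (forall v, rnorm (f v) <= M * vnorm nV v) ->
  forall k (x : 'M[V]_k), nV x <= 1 ->
  forall w : 'I_k -> 'cV[C]_1, l2norm (@euclid R 1) w <= 1 ->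
  l2norm (@euclid R 1)
    (fun i => \sum_(j < k) (const_mx (f (x i j)) : 'M[C]_1) *m w j) <= M.
Proof.
move=> lf M0 fM k x x1 w w1.
have euclid1 (t : 'cV[C]_1) : euclid t = rnorm (t 0 0).
  by rewrite /euclid /l2norm big_ord1 sqrtr_sqr ger0_norm// rnorm_ge0.
pose z i := \sum_(j < k) f (x i j) * w j 0 0.
set L := (X in X <= M).
have L0 : 0 <= L by rewrite sqrtr_ge0.
have LE : L ^+ 2 = \sum_i rnorm (z i) ^+ 2.
  rewrite sqr_sqrtr; last by apply: sumr_ge0 => i _; exact: sqr_ge0.
  apply: eq_bigr => i _; congr (_ ^+ 2); rewrite euclid1 summxE; congr rnorm.
  by apply: eq_bigr => j _; rewrite !mxE big_ord1 mxE.
have w1' : \sum_i rnorm (w i 0 0) ^+ 2 <= 1.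
  have h0 : 0 <= \sum_i euclid (w i) ^+ 2.
    by apply: sumr_ge0 => i _; exact: sqr_ge0.
  move: w1; rewrite /l2norm -[leRHS]sqrtr1 ler_sqrt// => h.
  by under eq_bigr do rewrite -euclid1.
pose a : 'M[C]_(1, k) := \matrix_(i, j) conjc (z j).
pose b : 'M[C]_(k, 1) := \matrix_(i, j) w i 0 0.
have rnormJ (c : C) : rnorm (conjc c) = rnorm c by rewrite /rnorm normcJ.
have fab : f (bimulmx a x b 0 0) = (L ^+ 2)%:C.
  have fD v v' : f (v + v') = f v + f v' by rewrite -[v]scale1r lf !scale1r.
  have f0 : f 0 = 0 by apply: (addIr (f 0)); rewrite -fD !add0r.
  have fZ c v : f (c *: v) = c * f v by rewrite -[c *: v]addr0 lf f0 addr0.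
  rewrite mxE (big_morph f fD f0) LE rmorph_sum/=; apply: eq_bigr => i _.
  rewrite (big_morph f fD f0) rmorphXn/= rnormE sqr_normc mulrC mulr_sumr.
  by apply: eq_bigr => j _; rewrite fZ !mxE mulrCA mulrC mulrA.
have e0 m : euclid (0 : 'cV[C]_m) <= 1.
  rewrite /euclid /l2norm big1 ?sqrtr0// => i _.
  by rewrite mxE rnorm0 expr0n.
have aL : 0 <= mxopnorm a <= L.
  apply: (proj2 (opnorm_itv (e0 k) _)) => v v1.
  rewrite euclid1 rnorm_ge0/= mxE (le_trans (rnorm_sum _ _))//.
  under eq_bigr do rewrite rnormM mxE rnormJ.
  apply: sum_mul_le_l2 => //.
  rewrite -ler_sqrt// ?sqrtr1//.
have b1 : 0 <= mxopnorm b <= 1.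
  apply: (proj2 (opnorm_itv (e0 1) _)) => v v1; rewrite sqrtr_ge0/=.
  rewrite /euclid /l2norm -[leRHS]sqrtr1 ler_sqrt//.
  rewrite (le_trans _ w1')//; apply: ler_sum => i _.
  rewrite mxE big_ord1 mxE rnormM exprMn ler_piMr ?sqr_ge0//.
  by rewrite -euclid1 expr_le1// sqrtr_ge0.
case/andP: aL => a0 aL; case/andP: b1 => b0 b1.
have [->//|L0'] := eqVneq L 0.
have Lp : 0 < L by rewrite lt_neqAle eq_sym L0'.
rewrite -(ler_pM2r Lp) -expr2.
have -> : L ^+ 2 = rnorm (f (bimulmx a x b 0 0)).
  rewrite fab /rnorm; apply: complexI.
  by rewrite (RRe_real (normr_real _)) ger0_norm// ler0c sqr_ge0.
rewrite (le_trans (fM _))// ler_wpM2l//.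
have -> : vnorm nV (bimulmx a x b 0 0) = nV (bimulmx a x b).
  by congr nV; apply/matrixP => i j; rewrite mxE !ord1.
rewrite (le_trans (nVM a x b))// -[leRHS]mulr1 ler_pM//.
  by rewrite mulr_ge0// matrix_norms_ge0.
by rewrite -[leRHS]mulr1 ler_pM// matrix_norms_ge0.
Qed.

Lemma dual_norms_ge (f : dual) (v : V) :
  rnorm (f v : C) <= vnorm dual_norms f * vnorm nV v.
Proof.
have /[!unfold_in]/asboolP[lf [M0 hM0]] := valP f.
have {}lf : linear (blin_fun f) := lf.
pose M := Num.max 0 M0.
have M_ge0 : 0 <= M by rewrite le_max lexx.
have hM w : rnorm (f w : C) <= M * vnorm nV w.
  rewrite (le_trans (hM0 w))// ler_wpM2r ?matrix_norms_ge0//.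
  by rewrite le_max lexx orbT.
have [v0|v_neq0] := eqVneq (vnorm nV v) 0.
  by rewrite (le_trans (hM v))// v0 !mulr0.
have v_gt0 : 0 < vnorm nV v by rewrite lt_neqAle eq_sym v_neq0 matrix_norms_ge0.
have e0 k : l2norm (@euclid R 1) (fun _ : 'I_k => 0 : 'cV[C]_1) <= 1.
  rewrite /l2norm big1 ?sqrtr0// => i _; rewrite /euclid /l2norm big1 ?sqrtr0//.
    by rewrite expr0n.
  by move=> j _; rewrite mxE rnorm0 expr0n.
have rnormR (c : R) : 0 <= c -> rnorm (c%:C : C) = c.
  by move=> c0; apply: complexI; rewrite rnormE ger0_norm ?ler0c.
pose y : 'M[V]_1 := map_mx ( *:%R ((vnorm nV v)^-1)%:C) (const_mx v).
have y1 : nV y <= 1.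
  by rewrite nVZ rnormR ?invr_ge0 ?(ltW v_gt0)// -/(vnorm nV v) mulVf.
pose phi w : 'M[C]_1 := const_mx (f w).
have itv k (x : 'M[V]_k) : nV x <= 1 ->
    (forall w, l2norm (@euclid R 1) w <= 1 -> l2norm (@euclid R 1)
      (fun i => \sum_(j < k) map_mx phi x i j *m w j) <= mx_norms (map_mx phi x))
    /\ 0 <= mx_norms (map_mx phi x) <= M.
  move=> x1; apply: (opnorm_itv (e0 k)) => w w1; rewrite sqrtr_ge0/=.
  have := mx_norms_functional_le lf M_ge0 hM x1 w1.
  congr (l2norm _ _ <= _); apply/funext => i.
  by apply: eq_bigr => j _; rewrite mxE.
have [cb [cbE cb_le cb_ge]] : exists cb : \bar R,
    [/\ vnorm dual_norms f = fine cb, (cb <= M%:E)%E &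
      forall k (x : 'M[V]_k), nV x <= 1 ->
        ((mx_norms (map_mx phi x))%:E <= cb)%E].
  exists (cb_norm nV (@mx_norms 1) phi); split.
  - congr (fine (cb_norm _ _ _)); apply/funext => w.
    by apply/matrixP => i j; rewrite !mxE.
  - apply: ge_ereal_sup => _ [k _ <-]; apply: ge_ereal_sup => _ [x [_ x1] <-].
    by rewrite lee_fin; case: (itv _ _ x1) => _ /andP[].
  - move=> k x x1.
    have A1 : [set x : 'M[V]_k | (forall i j, setT (x i j)) /\ nV x <= 1] x :=
      conj (fun i j => I) x1.
    have A2 := imageP (fun x => (mx_norms (map_mx phi x))%:E) A1.
    apply: (le_trans (ereal_sup_ubound A2)).
    have A3 := imageP (fun k => ereal_sup [set (mx_norms (map_mx phi x))%:E |
      x in [set x : 'M[V]_k | (forall i j, setT (x i j)) /\ nV x <= 1]])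
      (I : [set: nat] k).
    exact: (ereal_sup_ubound A3).
have cb_fin : cb \is a fin_num.
  rewrite ge0_fin_numE; first by rewrite (le_lt_trans cb_le)// ltry.
  rewrite (le_trans _ (cb_ge _ _ y1))// lee_fin.
  by case: (itv _ _ y1) => _ /andP[].
rewrite -ler_pdivrMr// cbE -lee_fin fineK//.
apply: le_trans (cb_ge _ _ y1); rewrite lee_fin.
have euclid1 (t : 'cV[C]_1) : euclid t = rnorm (t 0 0).
  by rewrite /euclid /l2norm big_ord1 sqrtr_sqr ger0_norm// rnorm_ge0.
have [+ _] := itv _ _ y1 => /(_ (fun=> const_mx 1)).
rewrite /l2norm !big_ord1 !euclid1 !mxE !big_ord1 !mxE mulr1.
rewrite !sqrtr_sqr !ger0_norm ?rnorm_ge0//.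
have -> : rnorm (1 : C) = 1 by rewrite /rnorm normr1.
move=> /(_ (lexx _)); apply: le_trans.
have fZ c w : f (c *: w) = c * (f w : C).
  have f0 : f 0 = 0.
    by apply: (addIr (f 0)); rewrite -{2}[f 0]scale1r addrC -lf scale1r !add0r.
  by rewrite -[c *: w]addr0 lf f0 addr0.
rewrite fZ rnormM rnormR ?invr_ge0 ?(ltW v_gt0)//.
by rewrite mulrC.
Qed.

Lemma bidual_embed_subproof (u : V) :
  (fun f : dual => f u) \in @blin_pred R dual (vnorm dual_norms) C^o.
Proof.
rewrite unfold_in; apply/asboolP; split; first by [].
by exists (vnorm nV u) => f; rewrite mulrC; exact: dual_norms_ge.
Qed.

End dual.

Arguments dual_norms {V} nV [k] F.

Definition bidual_embed (V : lmodType C) (nV : matrix_norms V)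
    (hV : matricially_normed nV) (u : V) : dual (dual_norms nV) :=
  Blin (bidual_embed_subproof hV u).

Section numerical_index.
Variables (V : lmodType C) (nV : matrix_norms V) (u : V).

Definition mstates (n : nat) : set {linear V -> 'M[C]_n} :=
  [set phi | completely_contractive nV (@mx_norms n) phi /\ phi u = 1%:M].

(* Only positive matrix sizes [n.+1] are used. *)
Definition ugamma (k : nat) (x : 'M[V]_k) : \bar R :=
  ereal_sup [set y | exists n (phi : {linear V -> 'M[C]_n.+1}),
    mstates phi /\ y = (mx_norms (map_mx phi x))%:E].

Definition n_cb : \bar R :=
  ereal_inf [set y | exists k (x : 'M[V]_k), nV x = 1 /\ y = ugamma x].

End numerical_index.
End matricially_normed_spaces.

Arguments dual_norms {R V} nV [k] F.

(* Main.v *)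
(* A scalar-valued functional on [M_k(V)] dominated by the supremum of
   [Re <psi_k(x) xi, eta>] over states [psi] and vectors with
   [|xi|^2 + |eta|^2 <= 2] extends, by Hahn-Banach on [M_2k(V)] applied to its upper
   right corner, to a form [B] with [B(u)] positive which is contractive in the sense
   of [contractive_form]. After adding a small multiple of a fixed state, [B(u)]
   is invertible, and a change of basis turns [B] into a state: this is a
   GNS construction, and it needs neither the Wittstock extension theorem nor
   compactness of the state spaces. The form represents the functional
   exactly, so it can also be evaluated at matrices [X] over the bidual: if
   [t |x| <= gamma(x)] on [M_k(V)], then [t |X| <= gamma(X)].

   The other inequality in (b) holds because states of the bidual restrict to
   states of [V] and the embedding in the bidual is completely isometric. The
   latter is the Effros-Ruan lemma: a functional of norm one on [M_k(V)]
   factors through two states of [M_k], found by Hahn-Banach, and dividing by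
   their square roots turns it into a complete contraction into [M_k].

   In (a), the direct sum of all states is an embedding of the required kind when
   the index is positive. Conversely, the compressions of [Psi] to the spans of
   finitely many vectors are, after the same change of basis, states which
   recover the norm of [Psi_k(x)]. *)

From HB Require Import structures.
From mathcomp Require Import all_boot all_order all_algebra sesquilinear complex.
From mathcomp Require Import finmap.
From mathcomp Require Import all_classical all_reals all_analysis.
From mathcomp Require Import ring lra spectral.
From mathcomp Require summability.
Require Import Defs.

Set Implicit Arguments.
Unset Strict Implicit.
Unset Printing Implicit Defensive.

Import Order.TTheory GRing.Theory Num.Theory numFieldNormedType.Exports.
Local Open Scope classical_set_scope.
Local Open Scope ring_scope.
Local Open Scope complex_scope.
Local Open Scope sesquilinear_scope.

(** * Hahn-Banach theorem *)

(** Norm bounds are stated throughout as bounds on real parts of sums of inner products by averages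
    of squared norms, not by products of norms. Averages are additive in the vectors and in the
    form, and they survive a change of basis, so the two weights of a form can be added to,
    perturbed and normalised. The obstacle behind the bidual inequality is that a functional
    dominated by states is a priori only a limit of combinations of states of unbounded sizes. The
    functional found by Hahn-Banach is therefore read directly as a form on a space of dimension 2k:
    it is monotone for the order defined by all vector states, hence inherits every linear
    inequality that they share, in particular contractivity and hermitian symmetry. For [B u] to be
    positive the same vectors must stand in both slots of the inner product, whereas an operator
    norm needs two independent families. Concatenating these families and putting the matrix into a
    corner reconciles the two demands; this is where 2k comes from. *)

Section hahn_banach.
Variables (R : realType) (E : lmodType R) (P : E -> R).
Hypothesis PD : forall x y, P (x + y) <= P x + P y.
Hypothesis PZ : forall s x, 0 < s -> P (s *: x) = s * P x.

(** Partial functionals are encoded by their graphs, so that the union of a chain is a plain union.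
    Single-valuedness is not demanded: it follows from domination, since two values at one point
    differ by a value at 0. *)
Definition dominated_graph (A : set (E * R)) :=
  (forall s p q, A p -> A q -> A (s *: p.1 + q.1, s * p.2 + q.2)) /\
  (forall p, A p -> p.2 <= P p.1).

Lemma dominated_graph_extend (A : set (E * R)) x0 : A (0, 0) ->
  dominated_graph A ->
  exists B, [/\ dominated_graph B, A `<=` B & exists c, B (x0, c)].
Proof.
move=> A0 [lA dA].
have AD p q : A p -> A q -> A (p.1 + q.1, p.2 + q.2).
  by move=> Ap Aq; have := lA 1 _ _ Ap Aq; rewrite scale1r mul1r.
have AZ s p : A p -> A (s *: p.1, s * p.2).
  by move=> Ap; have := lA s _ _ Ap A0; rewrite !addr0.
(* The value [c] at [x0] must lie above every element of [S] and below every [P (p.1 + x0) - p.2].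
   Only the multiples 1 and -1 of [x0] are tested; positive homogeneity gives the others. *)
pose S := [set p.2 - P (p.1 - x0) | p in A].
have Sub p : A p -> ubound S (P (p.1 + x0) - p.2).
  move=> Ap _ [q Aq <-]; rewrite lerBlDr addrAC lerBrDr.
  apply: le_trans (dA _ (AD _ _ Aq Ap)) _ => /=.
  rewrite [leRHS]addrC (le_trans _ (PD _ _))//.
  by rewrite addrACA [- x0 + _]addrC subrr addr0.
pose c := sup S.
have hc1 p : A p -> p.2 + c <= P (p.1 + x0).
  move=> Ap; rewrite -lerBrDl; apply: ge_sup; last exact: Sub.
  by exists (0 - P (0 - x0)); exists (0, 0).
have hc2 p : A p -> p.2 - c <= P (p.1 - x0).
  move=> Ap; rewrite lerBlDr -lerBlDl; apply: ub_le_sup; last by exists p.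
  by exists (P (0 + x0) - 0); exact: (Sub _ A0).
pose B := [set pq : E * R |
  exists2 p, A p & exists s, pq = (p.1 + s *: x0, p.2 + s * c)].
exists B; split.
- split.
  + move=> s _ _ [p Ap [a ->]] [q Aq [b ->]].
    exists (s *: p.1 + q.1, s * p.2 + q.2); first exact: lA.
    exists (s * a + b) => /=; congr pair; last by ring.
    by rewrite scalerDr scalerA scalerDl addrACA.
  + move=> _ [p Ap [s ->]] /=.
    have [s0|s0|->] := ltrgtP s 0; last by rewrite scale0r mul0r !addr0; exact: dA.
    * have := hc2 _ (AZ (- s)^-1 _ Ap) => /=.
      have s0' : 0 < - s by rewrite oppr_gt0.
      rewrite -(ler_pM2l s0') mulrBr mulrA divff ?gt_eqF// mul1r mulNr opprK.
      by rewrite -PZ// scalerBr scalerA divff ?gt_eqF// scale1r scaleNr opprK.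
    * have := hc1 _ (AZ s^-1 _ Ap) => /=.
      rewrite -(ler_pM2l s0) mulrDr mulrA divff ?gt_eqF// mul1r.
      by rewrite -PZ// scalerDr scalerA divff ?gt_eqF// scale1r.
- by move=> p Ap; exists p => //; exists 0; rewrite scale0r mul0r !addr0 -surjective_pairing.
- by exists c; exists (0, 0) => //; exists 1; rewrite scale1r mul1r !add0r.
Qed.

Theorem hahn_banach (D : set E) (f : E -> R) : D 0 ->
  (forall s x y, D x -> D y -> D (s *: x + y)) ->
  (forall s x y, D x -> D y -> f (s *: x + y) = s * f x + f y) ->
  (forall x, D x -> f x <= P x) ->
  exists g : E -> R, [/\ forall s x y, g (s *: x + y) = s * g x + g y,
    forall x, g x <= P x & forall x, D x -> g x = f x].
Proof.
move=> D0 lD lf fP.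
have f0 : f 0 = 0.
  by have := lf (-1) 0 0 D0 D0; rewrite scaler0 addr0 mulN1r addNr.
have P0 : P 0 = 0.
  by have := PZ 0 (@ltr0n R 2); rewrite scaler0 => h; lra.
pose Gf := [set p : E * R | D p.1 /\ p.2 = f p.1].
(* The graph of [f] is adjoined inside the property: the empty chain is then harmless, and the
   maximal graph extends [f]. *)
have [A [QA maxA]] : exists A, dominated_graph (A `|` Gf) /\
    forall B, A `<` B -> ~ dominated_graph (B `|` Gf).
  apply: Zorn_bigcup => F FQ totF.
  have two p q : ((\bigcup_(X in F) X) `|` Gf) p ->
      ((\bigcup_(X in F) X) `|` Gf) q ->
      (Gf p /\ Gf q) \/ exists2 X, F X & (X `|` Gf) p /\ (X `|` Gf) q.
    move=> [[X FX Xp]|Gp] [[Y FY Yq]|Gq].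
    - right; have [XY|YX] := totF _ _ FX FY.
      + by exists Y => //; split; left => //; exact: XY.
      + by exists X => //; split; left => //; exact: YX.
    - by right; exists X => //; split; [left|right].
    - by right; exists Y => //; split; [right|left].
    - by left.
  split=> [s p q /two/[apply]-[[[Dp ep] [Dq eq]]|[X FX [Xp Xq]]]|p].
  - by right; split=> /=; [exact: lD|rewrite lf// ep eq].
  - have [h|h] := (FQ _ FX).1 s p q Xp Xq; last by right.
    by left; exists X.
  - case=> [[X FX Xp]|[Dp ->]]; last exact: fP.
    by apply: (FQ _ FX).2; left.
have G0 : (A `|` Gf) (0, 0) by right; split.
have tot x : exists r, A (x, r).
  have [B [QB AB [r Br]]] := dominated_graph_extend x G0 QA.
  exists r; apply: contrapT => nA.
  (* A point outside the domain of [A] would make the extension [B] strictly larger. *)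
  apply: (maxA B).
    split; first by move=> p Ap; apply: AB; left.
    by move/(_ _ Br).
  rewrite (_ : B `|` Gf = B)//; apply/seteqP; split=> [p [//|Gp]|p Bp]; last by left.
  by apply: AB; right.
have uniq x r r' : (A `|` Gf) (x, r) -> (A `|` Gf) (x, r') -> r = r'.
  move=> xr xr'.
  have le0 a b : (A `|` Gf) (x, a) -> (A `|` Gf) (x, b) -> b <= a.
    move=> xa xb; have := QA.2 _ (QA.1 (-1) _ _ xa xb) => /=.
    by rewrite scaleN1r addNr P0 mulN1r addrC subr_le0.
  by apply/eqP; rewrite eq_le !le0.
pose g x := sval (cid (tot x)).
have gA x : (A `|` Gf) (x, g x) by left; rewrite /g; case: cid.
exists g; split=> [s x y|x|x Dx].
- by apply: uniq (gA _) _; exact: (QA.1 s _ _ (gA x) (gA y)).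
- exact: (QA.2 _ (gA x)).
- by apply: uniq (gA _) _; right.
Qed.

End hahn_banach.

(** * Real parts and moduli of complex numbers *)

Section complex_parts.
Variable R : realType.
Local Notation C := R[i].
Implicit Types z w : C.

Definition re z : R := complex.Re z.

Lemma reD z w : re (z + w) = re z + re w.
Proof. by case: z w => [a b] [c d]. Qed.

Lemma re0 : re 0 = 0. Proof. by []. Qed.

Lemma reN z : re (- z) = - re z.
Proof. by case: z. Qed.

Lemma reB z w : re (z - w) = re z - re w.
Proof. by rewrite reD reN. Qed.

Lemma re_sum I (r : seq I) (P : pred I) (F : I -> C) :
  re (\sum_(i <- r | P i) F i) = \sum_(i <- r | P i) re (F i).
Proof. exact: (big_morph re reD re0). Qed.

Lemma reR (a : R) : re a%:C = a. Proof. by []. Qed.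

Lemma reZ (a : R) z : re (a%:C * z) = a * re z.
Proof. by case: z => c d /=; rewrite mul0r subr0. Qed.

Lemma reJ z : re (Num.conj z) = re z.
Proof. by case: z. Qed.

Lemma conjR (a : R) : Num.conj (a%:C) = a%:C.
Proof. exact: conjc_real. Qed.

Lemma mul_conj z : z * Num.conj z = (rnorm z ^+ 2)%:C.
Proof. by rewrite rmorphXn/= rnormE sqr_normc. Qed.

Lemma rnormJ z : rnorm (Num.conj z) = rnorm z.
Proof. by rewrite /rnorm normcJ. Qed.

Lemma rnormR (a : R) : rnorm (a%:C) = `|a|.
Proof. by rewrite /rnorm normc_def/= expr0n addr0 sqrtr_sqr. Qed.

Lemma rnorm1 : rnorm (1 : C) = 1.
Proof. by rewrite /rnorm normr1. Qed.

Lemma rnorm_eq0 z : rnorm z = 0 -> z = 0.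
Proof. by move=> h; apply/eqP; rewrite -normr_eq0 -rnormE h. Qed.

(* Rotation by a unimodular number turns bounds on real parts into bounds on
   moduli. *)
Lemma rnorm_rot z : exists2 w : C, rnorm w = 1 & w * z = (rnorm z)%:C.
Proof.
have [->|z0] := eqVneq z 0.
  by exists 1; rewrite ?rnorm1// mulr0 rnorm0.
have rz0 : rnorm z != 0 by apply: contra_neq z0 => /rnorm_eq0.
exists ((rnorm z)^-1%:C * Num.conj z).
  by rewrite rnormM rnormR ger0_norm ?invr_ge0 ?rnorm_ge0// rnormJ mulVf.
by rewrite -mulrA [_ * z]mulrC mul_conj -rmorphM/= expr2 mulKf.
Qed.

End complex_parts.

(** * Inner products and operator norms *)

Section inner_products.
Variable R : realType.
Local Notation C := R[i].

(** A predicate on bare functions, so that it also covers [l2_norm] before [l2] is a normed space;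
    the triangle inequality of [l2] is then [ipD_norm]. Definiteness is not included, hence the
    separate cases [N x = 0] below. *)
Definition inner_product (W : lmodType C) (N : W -> R) (ip : W -> W -> C) :=
  [/\ forall a x y z, ip (a *: x + y) z = a * ip x z + ip y z,
      forall x y, ip y x = Num.conj (ip x y),
      forall x, 0 <= N x & forall x, ip x x = (N x ^+ 2)%:C].

Section one.
Variables (W : lmodType C) (N : W -> R) (ip : W -> W -> C).
Hypothesis h : inner_product N ip.

Lemma ip_ge0 x : 0 <= N x. Proof. by case: h. Qed.

Lemma ipC x y : ip y x = Num.conj (ip x y). Proof. by case: h. Qed.

Lemma ipxx x : ip x x = (N x ^+ 2)%:C. Proof. by case: h. Qed.

Lemma ipDl x y z : ip (x + y) z = ip x z + ip y z.
Proof. by case: h => l _ _ _; rewrite -[x]scale1r l mul1r scale1r. Qed.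

Lemma ip0l x : ip 0 x = 0.
Proof. by apply: (addIr (ip 0 x)); rewrite -ipDl !add0r. Qed.

Lemma ipZl a x y : ip (a *: x) y = a * ip x y.
Proof. by case: h => l _ _ _; rewrite -[a *: x]addr0 l ip0l addr0. Qed.

Lemma ipDr x y z : ip x (y + z) = ip x y + ip x z.
Proof. by rewrite ipC ipDl rmorphD/= -!ipC. Qed.

Lemma ip0r x : ip x 0 = 0.
Proof. by rewrite ipC ip0l rmorph0. Qed.

Lemma ipZr a x y : ip x (a *: y) = Num.conj a * ip x y.
Proof. by rewrite ipC ipZl rmorphM/= -ipC. Qed.

Lemma ip_suml I (r : seq I) (P : pred I) (F : I -> W) y :
  ip (\sum_(i <- r | P i) F i) y = \sum_(i <- r | P i) ip (F i) y.
Proof. by apply: (big_morph (ip^~ y)) => [u v|]; rewrite ?ipDl ?ip0l. Qed.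

Lemma ip_sumr I (r : seq I) (P : pred I) (F : I -> W) y :
  ip y (\sum_(i <- r | P i) F i) = \sum_(i <- r | P i) ip y (F i).
Proof. by apply: (big_morph (ip y)) => [u v|]; rewrite ?ipDr ?ip0r. Qed.

Lemma ip_re_le x y : re (ip x y) <= (N x ^+ 2 + N y ^+ 2) / 2.
Proof.
have : 0 <= re (ip (x + -1 *: y) (x + -1 *: y)) by rewrite ipxx reR sqr_ge0.
have -> : (-1 : C) = (-1 : R)%:C by rewrite rmorphN1.
rewrite ipDl !ipDr !ipZl !ipZr !ipxx.
rewrite conjR !reD !reZ !reR (ipC x y) reJ; lra.
Qed.

Lemma ip0_norm : N 0 = 0.
Proof. by apply/eqP; rewrite -sqrf_eq0; apply/eqP/complexI; rewrite -ipxx ip0l. Qed.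

Lemma ipZ_norm a x : N (a *: x) = rnorm a * N x.
Proof.
apply/eqP; rewrite -(eqrXn2 (n := 2))// ?mulr_ge0 ?ip_ge0 ?rnorm_ge0//.
apply/eqP/complexI; rewrite -ipxx ipZl ipZr mulrA mul_conj ipxx -rmorphM/=.
by rewrite exprMn.
Qed.

(** [ip_re_le] at [s x] and [s^-1 y], whose inner product does not depend on [s], optimised at
    [s^2 = N y / N x]. If one of the norms vanishes, [s] tends to 0 or to infinity instead. *)
Lemma ip_cs x y : re (ip x y) <= N x * N y.
Proof.
have main (s : R) : 0 < s -> re (ip x y) <= (s ^+ 2 * N x ^+ 2 + s ^- 2 * N y ^+ 2) / 2.
  move=> s0; have := ip_re_le (s%:C *: x) (s^-1%:C *: y).
  rewrite ipZl ipZr conjR mulrA -rmorphM/= mulfV ?gt_eqF// mul1r.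
  have s0' := ltW s0; rewrite !ipZ_norm !exprMn !rnormR.
  by rewrite !ger0_norm ?invr_ge0// exprVn.
have lim0 (e b : R) : (forall s, 0 < s -> e <= (s ^- 2 * b ^+ 2) / 2) -> e <= 0.
  move=> hs; rewrite leNgt; apply/negP => e0.
  (* With this [s] the right side is [e b^2 / (2 (b^2 + 1))], which is smaller than [e]. *)
  have := hs (Num.sqrt ((b ^+ 2 + 1) / e)).
  have b0 := sqr_ge0 b.
  have q0 : 0 < (b ^+ 2 + 1) / e by rewrite divr_gt0// ltr_wpDl.
  rewrite sqrtr_gt0 q0 => /(_ isT); rewrite sqr_sqrtr ?(ltW q0)// invf_div.
  rewrite leNgt => /negP; apply.
  rewrite ltr_pdivrMr// mulrAC ltr_pdivrMr ?ltr_wpDl//; nra.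
have [x0|x0] := eqVneq (N x) 0.
  rewrite x0 mul0r; apply: (lim0 _ (N y)) => s s0; have := main _ s0.
  by rewrite x0 expr0n/= mulr0 add0r.
have [y0|y0] := eqVneq (N y) 0.
  rewrite y0 mulr0; apply: (lim0 _ (N x)) => s s0.
  have := main s^-1; rewrite invr_gt0 s0 => /(_ isT).
  by rewrite y0 expr0n/= mulr0 addr0 exprVn.
have xp : 0 < N x by rewrite lt_neqAle eq_sym x0 ip_ge0.
have yp : 0 < N y by rewrite lt_neqAle eq_sym y0 ip_ge0.
have := main (Num.sqrt (N y / N x)); rewrite sqrtr_gt0 divr_gt0// => /(_ isT).
rewrite sqr_sqrtr ?divr_ge0 ?(ltW xp) ?(ltW yp)// => /le_trans; apply.
rewrite le_eqVlt; apply/orP; left; apply/eqP; field.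
by rewrite x0 y0.
Qed.

Lemma ipD_norm x y : N (x + y) <= N x + N y.
Proof.
rewrite -(ler_pXn2r (n := 2))// ?nnegrE ?addr_ge0 ?ip_ge0//.
rewrite -[N (x + y) ^+ 2]reR -ipxx ipDl !ipDr !reD !ipxx !reR.
rewrite (ipC x y) reJ sqrrD; have := ip_cs x y; lra.
Qed.

Lemma ip_norm_sum I (r : seq I) (F : I -> W) :
  N (\sum_(i <- r) F i) <= \sum_(i <- r) N (F i).
Proof.
elim/big_ind2 : _ => [|x1 x2 y1 y2 h1 h2|//]; first by rewrite ip0_norm.
by rewrite (le_trans (ipD_norm _ _))// lerD.
Qed.

Lemma ip_norm0_re x y : N x = 0 -> re (ip x y) = 0.
Proof.
move=> x0; apply/eqP; rewrite eq_le.
have := ip_cs x y; rewrite x0 mul0r => ->/=.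
have := ip_cs (-1 *: x) y; rewrite ipZ_norm x0 mulr0 mul0r ipZl mulN1r reN.
by rewrite oppr_le0.
Qed.

Definition l2ip k (v w : 'I_k -> W) : C := \sum_i ip (v i) (w i).

Lemma l2normE k (v : 'I_k -> W) : l2norm N v ^+ 2 = \sum_i N (v i) ^+ 2.
Proof. by rewrite sqr_sqrtr// sumr_ge0// => i _; exact: sqr_ge0. Qed.

Lemma l2ipP k : inner_product (@l2norm R W N k) (@l2ip k).
Proof.
split=> [a x y z|x y|x|x].
- rewrite mulr_sumr -big_split; apply: eq_bigr => i _ /=.
  by case: h => l _ _ _; exact: l.
- by rewrite rmorph_sum; apply: eq_bigr => i _; exact: ipC.
- exact: sqrtr_ge0.
- by rewrite l2normE rmorph_sum; apply: eq_bigr => i _; exact: ipxx.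
Qed.

Lemma l2norm_le_sum k (v : 'I_k -> W) : l2norm N v <= \sum_i N (v i).
Proof.
have s0 : 0 <= \sum_i N (v i) by apply: sumr_ge0 => i _; exact: ip_ge0.
rewrite -(ler_pXn2r (n := 2))// ?nnegrE ?sqrtr_ge0// l2normE.
rewrite expr2 mulr_suml; apply: ler_sum => i _.
rewrite expr2 ler_wpM2l ?ip_ge0// (bigD1 i)//= lerDl.
by apply: sumr_ge0 => j _; exact: ip_ge0.
Qed.

Lemma norm_le_l2norm k (v : 'I_k -> W) i : N (v i) <= l2norm N v.
Proof.
rewrite -(ler_pXn2r (n := 2))// ?nnegrE ?sqrtr_ge0 ?ip_ge0// l2normE.
by rewrite (bigD1 i)//= lerDl sumr_ge0// => j _; exact: sqr_ge0.
Qed.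

End one.

Section two.
Variables (E F : lmodType C) (NE : E -> R) (NF : F -> R).
Variables (iE : E -> E -> C) (iF : F -> F -> C).
Hypotheses (hE : inner_product NE iE) (hF : inner_product NF iF).

Section opnorm.
Variable T : E -> F.
Hypothesis lT : forall a v, T (a *: v) = a *: T v.
Hypothesis bT : exists M, forall v, NF (T v) <= M * NE v.

Lemma opnorm_ub v : NE v <= 1 -> NF (T v) <= opnorm NE NF T.
Proof.
have [M hM] := bT; move=> v1; apply: ub_le_sup; last by exists v.
exists `|M| => _ [w /= w1 <-]; rewrite (le_trans (hM w))//.
apply: (le_trans (ler_wpM2r (ip_ge0 hE _) (ler_norm M))).
by rewrite ler_piMr.
Qed.

Lemma opnorm_ge0 : 0 <= opnorm NE NF T.
Proof.
by apply: (le_trans (ip_ge0 hF _) (@opnorm_ub 0 _)); rewrite (ip0_norm hE) ler01.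
Qed.

Lemma opnormP v : NF (T v) <= opnorm NE NF T * NE v.
Proof.
have [v0|v0] := eqVneq (NE v) 0.
  by have [M /(_ v)] := bT; rewrite v0 !mulr0.
have vp : 0 < NE v by rewrite lt_neqAle eq_sym v0 (ip_ge0 hE).
have nr : rnorm ((NE v)^-1%:C : C) = (NE v)^-1.
  by rewrite rnormR ger0_norm// invr_ge0 ltW.
have := @opnorm_ub ((NE v)^-1%:C *: v).
rewrite lT (ipZ_norm hE) (ipZ_norm hF) nr mulVf// => /(_ (lexx _)).
by rewrite mulrC ler_pdivrMr.
Qed.

Lemma opnorm_re v w : re (iF (T v) w) <= opnorm NE NF T * ((NE v ^+ 2 + NF w ^+ 2) / 2).
Proof.
apply: le_trans (ip_cs hF _ _) _.
apply: le_trans (ler_wpM2r (ip_ge0 hF _) (opnormP _)) _.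
rewrite -mulrA ler_wpM2l ?opnorm_ge0//.
have := sqr_ge0 (NE v - NF w); rewrite sqrrB; lra.
Qed.

End opnorm.

(** Pairing [T v] with its own normalisation recovers its norm. The constraint on the sum of
    squares, rather than on each vector, lets [v] and [w] be concatenated later into one family of
    total weight at most 2. *)
Lemma opnorm_le (T : E -> F) (c : R) :
  (forall v w, NE v ^+ 2 + NF w ^+ 2 <= 2 -> re (iF (T v) w) <= c) ->
  opnorm NE NF T <= c.
Proof.
move=> hc.
have c0 : 0 <= c.
  have := hc 0 0; rewrite (ip0_norm hE) (ip0_norm hF) expr0n/= addr0 (ip0r hF) re0.
  by apply; rewrite ler0n.
apply: ge_sup; first by exists (NF (T 0)); exists 0; rewrite //= (ip0_norm hE).
move=> _ [v /= v1 <-].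
have [z0|z0] := eqVneq (NF (T v)) 0; first by rewrite z0.
have zp : 0 < NF (T v) by rewrite lt_neqAle eq_sym z0 (ip_ge0 hF).
have := hc v ((NF (T v))^-1%:C *: T v).
rewrite (ipZ_norm hF) (ipZr hF) conjR reZ (ipxx hF) reR.
rewrite rnormR ger0_norm ?invr_ge0 ?(ltW zp)// mulVf// expr2 mulKf//.
by apply; rewrite expr1n; have := ip_ge0 hE v; nra.
Qed.

Lemma l2_bounded m k (T : 'I_m -> 'I_k -> E -> F) :
  (forall i j, exists M, forall v, NF (T i j v) <= M * NE v) ->
  exists M, forall v, l2norm NF (fun i => \sum_j T i j (v j)) <= M * l2norm NE v.
Proof.
move=> hT.
pose M i j := sval (cid (hT i j)).
have hM i j v : NF (T i j v) <= `|M i j| * NE v.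
  apply: le_trans (ler_wpM2r (ip_ge0 hE _) (ler_norm _)).
  by rewrite /M; case: cid => M0 h0 /=; exact: h0.
exists (\sum_i \sum_j `|M i j|) => v.
apply: le_trans (l2norm_le_sum hF _) _; rewrite mulr_suml; apply: ler_sum => i _.
apply: le_trans (ip_norm_sum hF _ _) _; rewrite mulr_suml; apply: ler_sum => j _.
by rewrite (le_trans (hM _ _ _))// ler_wpM2l// (norm_le_l2norm hE).
Qed.

End two.

Section amp.
Variables (W : lmodType C) (N : W -> R) (ip : W -> W -> C).
Hypothesis h : inner_product N ip.

Lemma ampnorm_le k (T : 'I_k -> 'I_k -> W -> W) (c : R) :
  (forall v w : 'I_k -> W,
    \sum_j N (v j) ^+ 2 + \sum_i N (w i) ^+ 2 <= 2 ->
    re (\sum_i \sum_j ip (T i j (v j)) (w i)) <= c) ->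
  ampnorm N T <= c.
Proof.
move=> hc; apply: (opnorm_le (l2ipP h k) (l2ipP h k)) => v w.
rewrite !l2normE => /hc; rewrite /l2ip.
by under eq_bigr do rewrite -(ip_suml h).
Qed.

Section ampre.
Variables (k : nat) (T : 'I_k -> 'I_k -> W -> W).
Hypothesis lT : forall i j a v, T i j (a *: v) = a *: T i j v.
Hypothesis bT : forall i j, exists M, forall v, N (T i j v) <= M * N v.

Let lT' a (v : 'I_k -> W) : (fun i => \sum_(j < k) T i j ((a *: v) j)) =
  a *: (fun i => \sum_(j < k) T i j (v j)).
Proof.
apply/funext => i; rewrite -[RHS]/(a *: \sum_j T i j (v j)) scaler_sumr.
by apply: eq_bigr => j _; rewrite lT.
Qed.

Lemma ampnorm_ge0 : 0 <= ampnorm N T.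
Proof.
exact: (opnorm_ge0 (l2ipP h k) (l2ipP h k) (l2_bounded h h bT)).
Qed.

Lemma ampnormP v : l2norm N (fun i => \sum_j T i j (v j)) <= ampnorm N T * l2norm N v.
Proof. exact: (opnormP (l2ipP h k) (l2ipP h k) lT' (l2_bounded h h bT)). Qed.

Lemma ampnorm_re (v w : 'I_k -> W) :
  re (\sum_i \sum_j ip (T i j (v j)) (w i)) <=
  ampnorm N T * ((\sum_j N (v j) ^+ 2 + \sum_i N (w i) ^+ 2) / 2).
Proof.
have := opnorm_re (l2ipP h k) (l2ipP h k) lT' (l2_bounded h h bT) v w.
rewrite !l2normE /l2ip => /(le_trans _); apply.
by under eq_bigr do rewrite -(ip_suml h).
Qed.

End ampre.

Lemma ampnormZ k (T : 'I_k -> 'I_k -> W -> W) (s : R) : 0 < s ->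
  (forall i j a v, T i j (a *: v) = a *: T i j v) ->
  (forall i j, exists M, forall v, N (T i j v) <= M * N v) ->
  ampnorm N (fun i j v => s%:C *: T i j v) = s * ampnorm N T.
Proof.
have le (t : R) (U : 'I_k -> 'I_k -> W -> W) : 0 < t ->
    (forall i j a v, U i j (a *: v) = a *: U i j v) ->
    (forall i j, exists M, forall v, N (U i j v) <= M * N v) ->
    ampnorm N (fun i j v => t%:C *: U i j v) <= t * ampnorm N U.
  move=> t0 lU bU; apply: ampnorm_le => v w vw.
  have -> : \sum_i \sum_j ip (t%:C *: U i j (v j)) (w i) =
      t%:C * \sum_i \sum_j ip (U i j (v j)) (w i).
    rewrite mulr_sumr; apply: eq_bigr => i _; rewrite mulr_sumr.
    by apply: eq_bigr => j _; rewrite (ipZl h).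
  rewrite reZ ler_pM2l//; apply: le_trans (ampnorm_re lU bU v w) _.
  rewrite ler_piMr ?ampnorm_ge0//; lra.
move=> s0 lT bT; apply/eqP; rewrite eq_le le//= -ler_pdivlMl//.
have sV : 0 < s^-1 by rewrite invr_gt0.
have e : (fun i j v => s^-1%:C *: (s%:C *: T i j v)) = T.
  apply/funext => i; apply/funext => j; apply/funext => v.
  by rewrite scalerA -rmorphM/= mulVf ?gt_eqF// scale1r.
have := le s^-1 (fun i j v => s%:C *: T i j v) sV; rewrite e; apply.
- by move=> i j a v; rewrite lT !scalerA mulrC.
- move=> i j; have [M hM] := bT i j; exists (s * M) => v.
  by rewrite (ipZ_norm h) rnormR gtr0_norm// -mulrA ler_pM2l.
Qed.

End amp.

Definition dotc n (x y : 'cV[C]_n) : C := \sum_i x i 0 * Num.conj (y i 0).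

Lemma dotcP n : inner_product (@euclid R n) (@dotc n).
Proof.
split=> [a x y z|x y|x|x].
- rewrite mulr_sumr -big_split; apply: eq_bigr => i _ /=.
  by rewrite !mxE mulrDl mulrA.
- rewrite rmorph_sum; apply: eq_bigr => i _.
  by rewrite rmorphM/= conjCK mulrC.
- exact: sqrtr_ge0.
- rewrite /euclid /l2norm sqr_sqrtr; last first.
    by apply: sumr_ge0 => i _; exact: sqr_ge0.
  by rewrite rmorph_sum; apply: eq_bigr => i _; rewrite mul_conj.
Qed.

Lemma euclid_gt0 n (x : 'cV[C]_n) : x != 0 -> 0 < euclid x.
Proof.
move=> x0; rewrite lt_neqAle eq_sym sqrtr_ge0 andbT.
apply: contra_neq x0 => x0; apply/matrixP => i j; rewrite ord1 mxE.
apply: rnorm_eq0; apply/eqP; rewrite eq_le rnorm_ge0 andbT -x0.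
rewrite /euclid -(ler_pXn2r (n := 2))// ?nnegrE ?sqrtr_ge0 ?rnorm_ge0//.
rewrite sqr_sqrtr; last by apply: sumr_ge0 => l _; exact: sqr_ge0.
by rewrite (bigD1 i)//= lerDl; apply: sumr_ge0 => l _; exact: sqr_ge0.
Qed.

Lemma dotc_mulmx m n (A : 'M[C]_(m, n)) x y :
  dotc (A *m x) y = \sum_i \sum_j A i j * x j 0 * Num.conj (y i 0).
Proof. by apply: eq_bigr => i _; rewrite mxE mulr_suml. Qed.

Lemma dotc_adj m n (A : 'M[C]_(m, n)) x y :
  dotc (A *m x) y = dotc x (A^t* *m y).
Proof.
rewrite dotc_mulmx exchange_big; apply: eq_bigr => j _ /=.
rewrite mxE rmorph_sum/= mulr_sumr; apply: eq_bigr => i _.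
by rewrite !mxE rmorphM/= conjCK mulrCA mulrA.
Qed.

Lemma euclid_delta n (i : 'I_n) : euclid (delta_mx i 0 : 'cV[C]_n) ^+ 2 = 1.
Proof.
apply: complexI; rewrite -(ipxx (dotcP n)) /dotc (bigD1 i)//= big1 => [|j ji].
  by rewrite addr0 !mxE !eqxx mul1r rmorph1.
by rewrite !mxE (negbTE ji) mul0r.
Qed.

Lemma dotc_delta n (A : 'M[C]_n) i j :
  dotc (A *m delta_mx j 0) (delta_mx i 0) = A i j.
Proof.
rewrite dotc_mulmx (bigD1 i)//= [X in _ + X]big1 ?addr0 => [|i' i'i]; last first.
  by apply: big1 => j' _; rewrite !mxE (negbTE i'i) rmorph0 mulr0.
rewrite (bigD1 j)//= big1 ?addr0 => [|j' j'j].
  by rewrite !mxE !eqxx mulr1 rmorph1 mulr1.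
by rewrite !mxE (negbTE j'j) mulr0 mul0r.
Qed.

Lemma mulmx_bounded m n (A : 'M[C]_(m, n)) :
  exists M, forall v, euclid (A *m v) <= M * euclid v.
Proof.
have hC : inner_product (@rnorm R C : C^o -> R) (fun x y => x * Num.conj y).
  split=> [a x y z|x y|x|x]; rewrite ?rnorm_ge0 ?mul_conj//.
    by rewrite mulrDl mulrA.
  by rewrite rmorphM/= conjCK mulrC.
have [i j|M hM] := @l2_bounded _ _ _ _ _ _ hC hC m n (fun i j x => A i j * x).
  by exists (rnorm (A i j)) => v; rewrite rnormM.
exists M => v; have := hM (fun j => v j 0); congr (_ <= _).
by rewrite /euclid; congr l2norm; apply/funext => i; rewrite mxE.
Qed.

Lemma mxopnorm_ge0 m n (A : 'M[C]_(m, n)) : 0 <= mxopnorm A.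
Proof. exact: (opnorm_ge0 (dotcP n) (dotcP m) (mulmx_bounded A)). Qed.

Lemma mxopnormP m n (A : 'M[C]_(m, n)) v : euclid (A *m v) <= mxopnorm A * euclid v.
Proof.
apply: (opnormP (dotcP n) (dotcP m) _ (mulmx_bounded A)) => a w.
by rewrite -scalemxAr.
Qed.

Section mx_norms.
Variables (n k : nat).
Implicit Type x : 'M['M[C]_n]_k.

Let lT x i j a (v : 'cV[C]_n) : x i j *m (a *: v) = a *: (x i j *m v).
Proof. by rewrite -scalemxAr. Qed.

Let bT x i j : exists M, forall v, euclid (x i j *m v) <= M * euclid v.
Proof. exact: mulmx_bounded. Qed.

Lemma mx_norms_ge0 x : 0 <= mx_norms x.
Proof. exact: (ampnorm_ge0 (dotcP n) (@bT x)). Qed.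

Lemma mx_norms_re x (v w : 'I_k -> 'cV[C]_n) :
  re (\sum_i \sum_j dotc (x i j *m v j) (w i)) <=
  mx_norms x * ((\sum_j euclid (v j) ^+ 2 + \sum_i euclid (w i) ^+ 2) / 2).
Proof. exact: (ampnorm_re (dotcP n) (@lT x) (@bT x)). Qed.

Lemma mx_norms_le x c :
  (forall v w : 'I_k -> 'cV[C]_n,
    \sum_j euclid (v j) ^+ 2 + \sum_i euclid (w i) ^+ 2 <= 2 ->
    re (\sum_i \sum_j dotc (x i j *m v j) (w i)) <= c) ->
  mx_norms x <= c.
Proof. exact: (ampnorm_le (dotcP n)). Qed.

Lemma mx_normsZ x (s : R) : 0 < s ->
  mx_norms (map_mx ( *:%R s%:C) x) = s * mx_norms x.
Proof.
move=> s0; rewrite -(ampnormZ (dotcP n) s0 (@lT x) (@bT x)); congr ampnorm.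
apply/funext => i; apply/funext => j; apply/funext => v.
by rewrite mxE scalemxAl.
Qed.

Lemma mx_norms_vec x (v : 'I_k -> 'cV[C]_n) :
  l2norm (@euclid R n) (fun i => \sum_j x i j *m v j) <=
  mx_norms x * l2norm (@euclid R n) v.
Proof. exact: (ampnormP (dotcP n) (@lT x) (@bT x)). Qed.

End mx_norms.
End inner_products.

(** * Contractive forms and states *)

Section posdef.
Variable R : realType.
Local Notation C := R[i].

Lemma adjM m n p (A : 'M[C]_(m, n)) (B : 'M[C]_(n, p)) :
  (A *m B)^t* = B^t* *m A^t*.
Proof. by rewrite trmx_mul map_mxM. Qed.

Lemma dotc_swap n (G : 'M[C]_n) c :
  dotc (G^t* *m c) c = Num.conj (dotc (G *m c) c).
Proof. by rewrite [LHS]dotc_adj trmxCK (ipC (dotcP _ n)). Qed.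

Lemma dotc_herm n (G : 'M[C]_n) c :
  dotc ((G + G^t*) *m c) c = (2 * re (dotc (G *m c) c))%:C.
Proof.
rewrite mulmxDl (ipDl (dotcP _ n)) dotc_swap.
by case: (dotc _ _) => a b; apply/eqP; rewrite eq_complex/= subrr mulr2n mulrDl mul1r !eqxx.
Qed.

(** The real part of the quadratic form of [G] sees only its hermitian part, which is half of [S].
    The spectral theorem diagonalises [S], and the eigenvectors are then rescaled. *)
Lemma posdef_congr n (G : 'M[C]_n) :
  (forall c, c != 0 -> 0 < re (dotc (G *m c) c)) ->
  exists2 g, g \in unitmx & g^t* *m (G + G^t*) *m g = 2%:R%:M.
Proof.
move=> G_gt0; set S := G + G^t*.
have Sh : S \is hermsymmx.
  apply/is_hermitianmxP; rewrite expr0 scale1r /S linearD map_mxD/=.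
  by rewrite -[in RHS]/(G^t* ^t*) trmxCK addrC.
have /orthomx_spectralP SE := hermitian_normalmx Sh.
set P := spectralmx S in SE; set d := spectral_diag S in SE.
have uP : P \is unitarymx := spectral_unitarymx S.
have PP : P *m P^t* = 1%:M by apply/unitarymxP.
have iP : invmx P = P^t* by exact: invmx_unitary.
have dE : P *m S *m P^t* = diag_mx d.
  by rewrite SE iP -!mulmxA PP mulmx1 mulmxA PP mul1mx.
pose c i : 'cV[C]_n := P^t* *m delta_mx i 0.
pose r i := re (dotc (G *m c i) (c i)).
have r_gt0 i : 0 < r i.
  apply: G_gt0; apply/eqP => c0.
  have := congr1 (mulmx P) c0; rewrite mulmxA PP mul1mx mulmx0.
  by move=> /matrixP/(_ i 0)/eqP; rewrite !mxE !eqxx oner_eq0.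
have di i : d 0 i = (2 * r i)%:C.
  transitivity (diag_mx d i i); first by rewrite mxE eqxx mulr1n.
  by rewrite -dotc_delta -dE -!mulmxA dotc_adj dotc_herm.
(* The eigenvalues of [S] are [2 r_i], so scaling by [r_i^(-1/2)] on both sides leaves 2. *)
pose D : 'M[C]_n := diag_mx (\row_i ((Num.sqrt (r i))^-1)%:C).
have DD : D *m diag_mx d *m D = 2%:R%:M.
  rewrite !mulmx_diag; apply/matrixP => i j; rewrite !mxE; case: eqP => //= _.
  rewrite !mulr1n di -!rmorphM/= -[in RHS](rmorph_nat (real_complex R)).
  congr (_%:C); rewrite -{2}(sqr_sqrtr (ltW (r_gt0 i))).
  by field; rewrite sqrtr_eq0 -ltNge.
have Dh : D^t* = D.
  rewrite tr_diag_mx map_diag_mx; congr diag_mx; apply/rowP => i.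
  by rewrite !mxE [LHS]conjR.
have gE : (P^t* *m D)^t* *m S *m (P^t* *m D) = 2%:R%:M.
  by rewrite adjM trmxCK Dh !mulmxA -(mulmxA D) -(mulmxA D) dE.
exists (P^t* *m D) => //.
have : (2%:R^-1 *: ((P^t* *m D)^t* *m S)) *m (P^t* *m D) = 1%:M.
  by rewrite -scalemxAl gE scale_scalar_mx mulVf// pnatr_eq0.
by move=> /mulmx1_unit[].
Qed.

End posdef.

(** * Complex functionals from their real parts *)

Section linear_functionals.
Variable R : realType.
Local Notation C := R[i].
Variable U : lmodType C.

Definition clinear (f : U -> C) := forall a x y, f (a *: x + y) = a * f x + f y.

Section clinear.
Variables (f : U -> C) (hf : clinear f).

Lemma clinearD x y : f (x + y) = f x + f y.
Proof. by rewrite -[x]scale1r hf mul1r scale1r. Qed.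

Lemma clinear0 : f 0 = 0.
Proof. by apply: (addIr (f 0)); rewrite -clinearD !add0r. Qed.

Lemma clinearZ a x : f (a *: x) = a * f x.
Proof. by rewrite -[a *: x]addr0 hf clinear0 addr0. Qed.

Lemma clinear_sum I (r : seq I) (P : pred I) (F : I -> U) :
  f (\sum_(i <- r | P i) F i) = \sum_(i <- r | P i) f (F i).
Proof. exact: (big_morph f clinearD clinear0). Qed.

Lemma clinear_bimulmx m n (a : 'M[C]_(n, m)) (F : 'M[U]_m) (b : 'M[C]_(m, n)) :
  map_mx f (bimulmx a F b) = a *m map_mx f F *m b.
Proof.
apply/matrixP => i j; rewrite !mxE clinear_sum.
transitivity (\sum_l \sum_k a i k * f (F k l) * b l j).
  rewrite exchange_big; apply: eq_bigr => k _ /=; rewrite clinear_sum.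
  by apply: eq_bigr => l _; rewrite clinearZ mulrAC.
by apply: eq_bigr => l _; rewrite mxE mulr_suml; apply: eq_bigr => k _; rewrite mxE.
Qed.

End clinear.

Definition rlinear (l : U -> R) := forall s x y, l (s%:C *: x + y) = s * l x + l y.

(** The classical [l(x) - i l(i x)], the only complex-linear functional with real part [l]. It
    transfers real Hahn-Banach extensions to complex scalars. *)
Definition complexify (l : U -> R) (x : U) : C := Complex (l x) (- l ('i *: x)).

Lemma complexifyP l : rlinear l ->
  clinear (complexify l) /\ forall x, re (complexify l x) = l x.
Proof.
move=> hl; split=> // -[a b] x y.
have lD v w : l (v + w) = l v + l w.
  by have := hl 1 v w; rewrite rmorph1 scale1r mul1r.
have l0 : l 0 = 0 by apply: (addIr (l 0)); rewrite -lD !add0r.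
have lZ s v : l (s%:C *: v) = s * l v.
  by rewrite -[s%:C *: v]addr0 hl l0 addr0.
have abE : a +i* b = a%:C + b%:C * 'i.
  by apply/eqP; rewrite eq_complex/= !(mul0r, mulr0, mulr1, subr0, addr0, add0r) !eqxx.
have ii : 'i * 'i = (-1 : R)%:C :> C by rewrite -expr2 sqr_i rmorphN1.
have e1 : (a +i* b) *: x = a%:C *: x + b%:C *: ('i *: x).
  by rewrite abE scalerDl scalerA.
have e2 : 'i *: ((a +i* b) *: x) = a%:C *: ('i *: x) + (- b)%:C *: x.
  rewrite e1 scalerDr !scalerA; congr (_ *: _ + _ *: _); first by rewrite mulrC.
  by rewrite mulrAC ii -rmorphM/= mulN1r.
rewrite /complexify scalerDr e2 e1 !lD !lZ.
apply/eqP; rewrite eq_complex/=; apply/andP; split; apply/eqP; ring.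
Qed.

End linear_functionals.

(** * Pairing matrices over V with matrices of functionals *)

Section pairing.
Variable R : realType.
Local Notation C := R[i].
Variables (V : lmodType C) (n : nat).

Definition colmx_conj r (d : 'I_r -> 'cV[C]_n) : 'M[C]_(n, r) :=
  \matrix_(a, i) Num.conj (d i a 0).
Definition rowmx_of r (c : 'I_r -> 'cV[C]_n) : 'M[C]_(r, n) :=
  \matrix_(j, b) c j b 0.

Definition pairing (B : V -> 'M[C]_n) (z : 'M[V]_n) := \sum_a \sum_b B (z a b) a b.

Definition entries_linear (B : V -> 'M[C]_n) :=
  forall a b, clinear (fun v => B v a b).

(** The bridge between forms and functionals: the value of the form at [r] pairs of vectors is one
    functional evaluated at one [n x n] matrix, whatever [r] is. Inequalities between form values
    thus become inequalities between values of a linear functional on [M_n(V)]. *)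
Lemma pairing_bimulmx (B : V -> 'M[C]_n) r (y : 'M[V]_r) (c d : 'I_r -> 'cV[C]_n) :
  entries_linear B ->
  pairing B (bimulmx (colmx_conj d) y (rowmx_of c)) =
  \sum_i \sum_j dotc (B (y i j) *m c j) (d i).
Proof.
move=> lB; rewrite /pairing.
transitivity (\sum_a \sum_b \sum_i \sum_j
    B (y i j) a b * c j b 0 * Num.conj (d i a 0)).
  apply: eq_bigr => a _; apply: eq_bigr => b _; rewrite mxE (clinear_sum (lB a b)).
  apply: eq_bigr => i _; rewrite (clinear_sum (lB a b)); apply: eq_bigr => j _.
  by rewrite (clinearZ (lB a b)) !mxE mulrC [_ * c _ _ _]mulrC mulrA.
under eq_bigr do rewrite exchange_big/=.
rewrite exchange_big; apply: eq_bigr => i _ /=.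
under eq_bigr do rewrite exchange_big/=.
rewrite exchange_big; apply: eq_bigr => j _ /=.
by rewrite dotc_mulmx.
Qed.

Definition emx (a b : 'I_n) (v : V) : 'M[V]_n :=
  \matrix_(i, j) (v *+ ((i == a) && (j == b))).

Lemma emxE (z : 'M[V]_n) : z = \sum_a \sum_b emx a b (z a b).
Proof.
apply/matrixP => i j; rewrite summxE (bigD1 i)//= [X in _ + X]big1 ?addr0 => [|k ki]; last first.
  by rewrite summxE big1// => l _; rewrite mxE eq_sym (negbTE ki).
rewrite summxE (bigD1 j)//= [X in _ + X]big1 ?addr0 => [|l lj]; first by rewrite mxE !eqxx.
by rewrite mxE [j == l]eq_sym (negbTE lj) andbF.
Qed.

Lemma emx_linear a b s x y :
  emx a b (s *: x + y) = map_mx ( *:%R s) (emx a b x) + emx a b y.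
Proof.
apply/matrixP => i j; rewrite !mxE; case: (_ && _); rewrite ?mulr1n//.
by rewrite !mulr0n scaler0 addr0.
Qed.

(* A real-linear functional on [M_n(V)] is the real part of the pairing with a
   matrix of complex functionals. *)
Definition mxfunctional (L : 'M[V]_n -> R) (v : V) : 'M[C]_n :=
  \matrix_(a, b) complexify (L \o emx a b) v.

Lemma mxfunctionalP (L : 'M[V]_n -> R) :
  (forall s x y, L (map_mx ( *:%R s%:C) x + y) = s * L x + L y) ->
  entries_linear (mxfunctional L) /\
  forall z, re (pairing (mxfunctional L) z) = L z.
Proof.
move=> hL.
have hl a b : rlinear (L \o emx a b).
  by move=> s x y; rewrite /= emx_linear hL.
have LD x y : L (x + y) = L x + L y.
  have := hL 1 x y; rewrite mul1r => <-; congr (L (_ + _)).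
  by apply/matrixP => i j; rewrite mxE rmorph1 scale1r.
have L0 : L 0 = 0 by apply: (addIr (L 0)); rewrite -LD !add0r.
split=> [a b s x y|z].
  by rewrite !mxE; have [-> _] := complexifyP (hl a b).
rewrite [in RHS](emxE z) (big_morph L LD L0) re_sum; apply: eq_bigr => a _.
rewrite (big_morph L LD L0) re_sum; apply: eq_bigr => b _.
by rewrite mxE; have [_ ->] := complexifyP (hl a b).
Qed.

End pairing.

Section real_matrices.
Variable R : realType.

(** An alias of [M_k(V)] that carries the real scalar action required by [hahn_banach]. *)
Definition rmx (V : lmodType R[i]) (k : nat) := 'M[V]_k.
HB.instance Definition _ V k := GRing.Zmodule.on (rmx V k).

Let rscale V k (s : R) (x : rmx V k) : rmx V k := map_mx ( *:%R s%:C) x.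

Let rscaleA V k s t (x : rmx V k) : rscale s (rscale t x) = rscale (s * t) x.
Proof. by apply/matrixP => i j; rewrite !mxE scalerA rmorphM. Qed.

Let rscale1 V k : left_id 1 (@rscale V k).
Proof. by move=> x; apply/matrixP => i j; rewrite !mxE rmorph1 scale1r. Qed.

Let rscaleDr V k : right_distributive (@rscale V k) +%R.
Proof. by move=> s x y; apply/matrixP => i j; rewrite !mxE scalerDr. Qed.

Let rscaleDl V k (x : rmx V k) : {morph (@rscale V k)^~ x : s t / s + t}.
Proof. by move=> s t; apply/matrixP => i j; rewrite !mxE rmorphD/= scalerDl. Qed.

HB.instance Definition _ V k := GRing.Zmodule_isLmodule.Build R (rmx V k)
  (@rscaleA V k) (@rscale1 V k) (@rscaleDr V k) (@rscaleDl V k).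

Lemma rmxZ V k s (x : rmx V k) : s *: x = map_mx ( *:%R s%:C) x :> 'M[V]_k.
Proof. by []. Qed.

End real_matrices.

(** * Completely bounded norms, contractive forms and compressions *)

Section cb_norms.
Variable R : realType.
Local Notation C := R[i].

Lemma cb_norm_on_le (V W : lmodType C) (D : set V) (nV : matrix_norms V)
    (nW : matrix_norms W) (f : V -> W) (c : \bar R) :
  (cb_norm_on D nV nW f <= c)%E <->
  forall k (x : 'M[V]_k), (forall i j, D (x i j)) -> nV k x <= 1 ->
    ((nW k (map_mx f x))%:E <= c)%E.
Proof.
split=> [h k x Dx x1|h].
  apply: le_trans h; apply: (@le_trans _ _ (ereal_sup [set (nW k (map_mx f x))%:E |
    x in [set x : 'M[V]_k | (forall i j, D (x i j)) /\ nV k x <= 1]])).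
    by apply: ereal_sup_ubound; exists x.
  by apply: ereal_sup_ubound; exists k.
apply: ge_ereal_sup => _ [k _ <-]; apply: ge_ereal_sup => _ [x [Dx x1] <-].
exact: h.
Qed.

Lemma completely_contractiveP (V W : lmodType C) (nV : matrix_norms V)
    (nW : matrix_norms W) (f : V -> W) :
  completely_contractive nV nW f <->
  forall k (x : 'M[V]_k), nV k x <= 1 -> nW k (map_mx f x) <= 1.
Proof.
rewrite /completely_contractive /cb_norm cb_norm_on_le.
by split=> h k x; [rewrite -lee_fin; exact: h|move=> _ x1; rewrite lee_fin h].
Qed.

Lemma le_mul_of_unit_ball (X : Type) (p q : X -> R) (sc : R -> X -> X) (c : R) :
  0 <= c -> (forall x, 0 <= p x) ->
  (forall s x, 0 < s -> p (sc s x) = s * p x) ->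
  (forall s x, 0 < s -> q (sc s x) = s * q x) ->
  (forall x, p x <= 1 -> q x <= c) -> forall x, q x <= c * p x.
Proof.
move=> c0 p0 pZ qZ h x.
have := p0 x; rewrite le_eqVlt => /predU1P[px0|px0].
  rewrite -px0 mulr0 leNgt; apply/negP => q0.
  (* If [p x = 0], all positive multiples of [x] lie in the ball; this one would have the value
     [c + 1] under [q]. *)
  have s0 : 0 < (c + 1) / q x by rewrite divr_gt0// ltr_wpDl.
  have := h (sc ((c + 1) / q x) x); rewrite pZ// -px0 mulr0 ler01 qZ// => /(_ isT).
  by rewrite divfK ?gt_eqF//; lra.
have s0 : 0 < (p x)^-1 by rewrite invr_gt0.
have := h (sc (p x)^-1 x); rewrite pZ// qZ// mulVf ?gt_eqF// => /(_ (lexx _)).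
by rewrite mulrC ler_pdivrMr.
Qed.

Section contractive_forms.
Variables (V : lmodType C) (nV : matrix_norms V).

(** Complete contractivity of [B] with respect to the quadratic forms of [G] on the source and [H]
    on the target, in arithmetic-mean form. The weights 1 give ordinary complete contractivity. The
    condition is additive in [(B, G, H)] and covariant under separate changes of basis. *)
Definition contractive_form n (B : V -> 'M[C]_n) (G H : 'M[C]_n) :=
  forall r (y : 'M[V]_r), nV y <= 1 -> forall c d : 'I_r -> 'cV[C]_n,
    re (\sum_i \sum_j dotc (B (y i j) *m c j) (d i)) <=
    (\sum_j re (dotc (G *m c j) (c j)) + \sum_i re (dotc (H *m d i) (d i))) / 2.

Let re_dotc1 n (c : 'cV[C]_n) : re (dotc (1%:M *m c) c) = euclid c ^+ 2.
Proof. by rewrite mul1mx (ipxx (dotcP _ n)) reR. Qed.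

Lemma contractive_form_cc n (B : V -> 'M[C]_n) :
  contractive_form B 1%:M 1%:M -> completely_contractive nV (@mx_norms R n) B.
Proof.
move=> hB; apply/completely_contractiveP => r y y1.
apply: mx_norms_le => c d cd; under eq_bigr do under eq_bigr do rewrite mxE.
apply: le_trans (hB _ _ y1 c d) _.
rewrite ler_pdivrMr// mul1r; apply: le_trans cd.
by apply: lerD; apply: ler_sum => i _; rewrite re_dotc1.
Qed.

Lemma cc_contractive_form n (B : V -> 'M[C]_n) :
  completely_contractive nV (@mx_norms R n) B -> contractive_form B 1%:M 1%:M.
Proof.
move=> /completely_contractiveP hB r y y1 c d.
have -> : \sum_i \sum_j dotc (B (y i j) *m c j) (d i) =
    \sum_i \sum_j dotc (map_mx B y i j *m c j) (d i).
  by apply: eq_bigr => i _; apply: eq_bigr => j _; rewrite mxE.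
apply: (le_trans (mx_norms_re _ _ _)).
under [X in _ <= (X + _) / _]eq_bigr do rewrite re_dotc1.
under [X in _ <= (_ + X) / _]eq_bigr do rewrite re_dotc1.
rewrite ler_piMl ?hB// divr_ge0// addr_ge0//; apply: sumr_ge0 => i _; exact: sqr_ge0.
Qed.

Lemma contractive_form_conj n (B : V -> 'M[C]_n) (G H g h : 'M[C]_n) :
  contractive_form B G H ->
  contractive_form (fun v => h^t* *m B v *m g) (g^t* *m G *m g) (h^t* *m H *m h).
Proof.
have dE m (g' h' A : 'M[C]_m) (x y : 'cV[C]_m) :
    dotc (h'^t* *m A *m g' *m x) y = dotc (A *m (g' *m x)) (h' *m y).
  by rewrite -!mulmxA [LHS]dotc_adj trmxCK.
move=> hB r y y1 c d; under eq_bigr do under eq_bigr do rewrite dE.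
under [X in _ <= (X + _) / _]eq_bigr do rewrite dE.
under [X in _ <= (_ + X) / _]eq_bigr do rewrite dE.
exact: hB.
Qed.

Lemma contractive_formD n (B B' : V -> 'M[C]_n) (G H G' H' : 'M[C]_n) :
  contractive_form B G H -> contractive_form B' G' H' ->
  contractive_form (fun v => B v + B' v) (G + G') (H + H').
Proof.
have dE m (A A' : 'M[C]_m) (x y : 'cV[C]_m) :
    dotc ((A + A') *m x) y = dotc (A *m x) y + dotc (A' *m x) y.
  by rewrite mulmxDl (ipDl (dotcP _ m)).
move=> hB hB' r y y1 c d.
under eq_bigr do under eq_bigr do rewrite dE.
under [X in _ <= (X + _) / _]eq_bigr do rewrite dE reD.
under [X in _ <= (_ + X) / _]eq_bigr do rewrite dE reD.
under eq_bigr do rewrite big_split/=.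
rewrite !big_split/= reD addrACA mulrDl lerD//; [exact: hB|exact: hB'].
Qed.

Lemma contractive_form_le n (B : V -> 'M[C]_n) (G H G' H' : 'M[C]_n) :
  (forall c, re (dotc (G *m c) c) <= re (dotc (G' *m c) c)) ->
  (forall c, re (dotc (H *m c) c) <= re (dotc (H' *m c) c)) ->
  contractive_form B G H -> contractive_form B G' H'.
Proof.
move=> GG HH hB r y y1 c d; apply: le_trans (hB _ _ y1 c d) _.
by rewrite ler_pM2r ?invr_gt0// lerD//; apply: ler_sum => i _.
Qed.

(** Only complete contractivity of the functional [p]; the normalisation at [u] is supplied where it
    is needed. *)
Definition scalar_state (p : V -> C) := forall r (y : 'M[V]_r), nV y <= 1 ->
  forall c d : 'I_r -> C,
    re (\sum_i \sum_j p (y i j) * c j * Num.conj (d i)) <=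
    (\sum_j rnorm (c j) ^+ 2 + \sum_i rnorm (d i) ^+ 2) / 2.

(** A multiple of the identity acts on each coordinate separately, and each coordinate is one
    instance of [scalar_state]. This is the perturbation that makes weights invertible. *)
Lemma scalar_state_form n (p : V -> C) (e : R) : 0 <= e -> scalar_state p ->
  contractive_form (fun v => (e%:C * p v)%:M : 'M[C]_n) (e%:C)%:M (e%:C)%:M.
Proof.
move=> e0 hp r y y1 c d.
have dE (s : C) (x z : 'cV[C]_n) : dotc (s%:M *m x) z = s * dotc x z.
  by rewrite mul_scalar_mx (ipZl (dotcP _ n)).
under eq_bigr do under eq_bigr do rewrite dE -mulrA.
under [X in _ <= (X + _) / _]eq_bigr do rewrite dE reZ.
under [X in _ <= (_ + X) / _]eq_bigr do rewrite dE reZ.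
under eq_bigr do rewrite -mulr_sumr.
rewrite -!mulr_sumr reZ -mulrDr -mulrA ler_wpM2l//.
under eq_bigr do under eq_bigr do rewrite mulr_sumr.
under eq_bigr do rewrite exchange_big/=.
rewrite exchange_big/= re_sum.
have nE (x : 'cV[C]_n) : re (dotc x x) = \sum_a rnorm (x a 0) ^+ 2.
  by rewrite re_sum; apply: eq_bigr => a _; rewrite mul_conj reR.
under [X in _ <= (X + _) / _]eq_bigr do rewrite nE.
under [X in _ <= (_ + X) / _]eq_bigr do rewrite nE.
rewrite exchange_big/= [X in (_ + X) / _]exchange_big/= -big_split/= mulr_suml.
apply: ler_sum => a _.
have := hp _ _ y1 (fun j => c j a 0) (fun i => d i a 0).
congr (re _ <= _); apply: eq_bigr => i _; apply: eq_bigr => j _.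
by rewrite mulrA.
Qed.

Lemma cc_scalar_state n (B : V -> 'M[C]_n.+1) :
  completely_contractive nV (@mx_norms R n.+1) B ->
  scalar_state (fun v => B v 0 0).
Proof.
move=> /cc_contractive_form hB r y y1 c d.
have := hB _ y y1 (fun j => c j *: delta_mx 0 0) (fun i => d i *: delta_mx 0 0).
have dE (A : 'M[C]_n.+1) (s t : C) :
    dotc (A *m (s *: delta_mx 0 0)) (t *: delta_mx 0 0) = A 0 0 * s * Num.conj t.
  rewrite -scalemxAr (ipZl (dotcP _ _)) (ipZr (dotcP _ _)) dotc_delta.
  by ring.
under eq_bigr do under eq_bigr do rewrite dE.
under [X in _ <= (X + _) / _ -> _]eq_bigr do rewrite dE mxE eqxx mul1r mul_conj reR.
under [X in _ <= (_ + X) / _ -> _]eq_bigr do rewrite dE mxE eqxx mul1r mul_conj reR.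
by [].
Qed.

End contractive_forms.

Section families.
Variables (V W : lmodType C) (nV : matrix_norms V) (N : W -> R) (ip : W -> W -> C).
Hypothesis h : inner_product N ip.
Variable Phi : V -> W -> W.
Hypothesis Phi_scal : forall v a w, Phi v (a *: w) = a *: Phi v w.
Hypothesis Phi_add : forall v w w', Phi v (w + w') = Phi v w + Phi v w'.
Hypothesis Phi_bd : forall v, exists M, forall w, N (Phi v w) <= M * N w.
Hypothesis Phi_cc : forall r (y : 'M[V]_r), nV y <= 1 ->
  ampnorm N (fun i j => Phi (y i j)) <= 1.
Variables (n : nat) (z : 'I_n -> W).

(** The compression of [Phi v] to the span of the [z a], in the coordinates of this possibly
    dependent family. Its natural weight is the Gram matrix, which is also its value at [u] when
    [Phi u] is the identity. *)
Definition family_form (v : V) : 'M[C]_n := \matrix_(a, b) ip (Phi v (z b)) (z a).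
Definition gram : 'M[C]_n := \matrix_(a, b) ip (z b) (z a).

Let comb (c : 'cV[C]_n) := \sum_a c a 0 *: z a.

Let dotc_comb (T : W -> W) (A : 'M[C]_n) (c d : 'cV[C]_n) :
  (forall a w, T (a *: w) = a *: T w) -> (forall w w', T (w + w') = T w + T w') ->
  (forall a b, A a b = ip (T (z b)) (z a)) ->
  dotc (A *m c) d = ip (T (comb c)) (comb d).
Proof.
move=> TZ TD AE; have T0 : T 0 = 0 by rewrite -(scale0r 0) TZ !scale0r.
rewrite dotc_mulmx (ip_sumr h); apply: eq_bigr => a _.
rewrite (ipZr h) (big_morph T TD T0) (ip_suml h) mulr_sumr; apply: eq_bigr => b _.
by rewrite TZ (ipZl h) AE mulrC [ip _ _ * _]mulrC.
Qed.

Lemma gramP (c : 'cV[C]_n) : re (dotc (gram *m c) c) = N (comb c) ^+ 2.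
Proof.
rewrite (dotc_comb (T := id) c c) ?(ipxx h)// => a b; exact: mxE.
Qed.

Lemma family_form_contractive : contractive_form nV family_form gram gram.
Proof.
move=> r y y1 c d.
have -> : \sum_i \sum_j dotc (family_form (y i j) *m c j) (d i) =
    \sum_i \sum_j ip (Phi (y i j) (comb (c j))) (comb (d i)).
  apply: eq_bigr => i _; apply: eq_bigr => j _.
  by apply: dotc_comb => // a b; rewrite mxE.
under [X in _ <= (X + _) / _]eq_bigr do rewrite gramP.
under [X in _ <= (_ + X) / _]eq_bigr do rewrite gramP.
have := @ampnorm_re _ _ _ _ h r (fun i j => Phi (y i j)) _ _ (comb \o c) (comb \o d).
move=> /(_ (fun i j => Phi_scal (y i j)) (fun i j => Phi_bd (y i j))) /le_trans; apply.
rewrite ler_piMl ?Phi_cc// divr_ge0// addr_ge0//; apply: sumr_ge0 => i _; exact: sqr_ge0.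
Qed.

End families.
End cb_norms.

Lemma le_epsilon_mul (R : realType) (a b K : R) :
  (forall e, 0 < e -> a <= b + e * K) -> a <= b.
Proof.
move=> h; rewrite leNgt; apply/negP => ba.
have K0 : 0 < `|K| + 1 by rewrite ltr_wpDl.
have := h ((a - b) / (2 * (`|K| + 1))).
rewrite divr_gt0 ?subr_gt0// ?mulr_gt0// => /(_ isT).
rewrite -lerBlDl mulrAC ler_pdivlMr ?mulr_gt0// mulrC.
have : (a - b) * K <= (a - b) * `|K| by rewrite ler_wpM2l ?ler_norm// subr_ge0 ltW.
nra.
Qed.

(** * Matrices over the dual as maps into matrices *)

Section dual_matrices.
Variable R : realType.
Local Notation C := R[i].
Variables (V : lmodType C) (nV : matrix_norms V).
Local Notation D := (dual nV).

Definition mxev n (F : 'M[D]_n) (v : V) : 'M[C]_n := \matrix_(i, j) (F i j v : C).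

Lemma dual_clinear (f : D) : clinear (f : V -> C).
Proof. by have := valP f; rewrite unfold_in => /asboolP[lf _] a x y; exact: lf. Qed.

Lemma eval_clinear (v : V) : clinear (fun f : D => f v : C).
Proof. by []. Qed.

Lemma mxev_entries_linear n (F : 'M[D]_n) : entries_linear (mxev F).
Proof. by move=> a b s x y; rewrite !mxE; exact: dual_clinear. Qed.

Lemma mxev_map n (F : 'M[D]_n) v : mxev F v = map_mx (fun f : D => f v : C) F.
Proof. by apply/matrixP => i j; rewrite !mxE. Qed.

Lemma mxev_bimulmx m n (a : 'M[C]_(n, m)) (F : 'M[D]_m) (b : 'M[C]_(m, n)) v :
  mxev (bimulmx a F b) v = a *m mxev F v *m b.
Proof. by rewrite !mxev_map (clinear_bimulmx (eval_clinear v)). Qed.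

Lemma mxev_linear n (F : 'M[D]_n) : linear (mxev F).
Proof.
move=> a x y; apply/matrixP => i j.
by have := mxev_entries_linear F i j a x y; rewrite !mxE.
Qed.

Hypothesis hV : matricially_normed nV.

Lemma matrix_normsD k (x y : 'M[V]_k) : nV (x + y) <= nV x + nV y.
Proof. by case: hV. Qed.

Lemma matrix_normsZ k (a : C) (x : 'M[V]_k) : nV (map_mx ( *:%R a) x) = rnorm a * nV x.
Proof. by case: hV. Qed.

Lemma vnormZ (a : C) (v : V) : vnorm nV (a *: v) = rnorm a * vnorm nV v.
Proof. by rewrite /vnorm -matrix_normsZ; congr nV; apply/matrixP => i j; rewrite !mxE. Qed.

Lemma vnorm_ge0 (v : V) : 0 <= vnorm nV v.
Proof. exact: matrix_norms_ge0. Qed.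

Lemma dual_of_bounded (f : V -> C) K : clinear f ->
  (forall v, vnorm nV v <= 1 -> re (f v) <= K) -> exists F : D, forall v, F v = f v.
Proof.
move=> lf fK.
suff h : (f : V -> C^o) \in @blin_pred R V (vnorm nV) C^o.
  by exists (Blin h).
rewrite unfold_in; apply/asboolP; split; first exact: lf.
exists K.
have K0 : 0 <= K.
  by have := fK 0; rewrite (clinear0 lf) re0; apply; rewrite /vnorm matrix_norms0.
apply: (@le_mul_of_unit_ball _ _ _ _ (fun s v => s%:C *: v)) => // [v|s v s0|s v s0|v v1].
- exact: vnorm_ge0.
- by rewrite vnormZ rnormR gtr0_norm.
- by rewrite (clinearZ lf) rnormM rnormR gtr0_norm.
- have [w w1 wE] := rnorm_rot (f v).
  (* Rotating [v] makes [f v] real and keeps [v] in the unit ball. *)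
  by rewrite -[rnorm _]reR -wE -(clinearZ lf) fK// vnormZ w1 mul1r.
Qed.

(** The contractive estimate at a pair of basis vectors bounds each entry of [B], which therefore
    belongs to the dual. *)
Lemma dual_of_form n (B : V -> 'M[C]_n) G H : entries_linear B ->
  contractive_form nV B G H -> exists F : 'M[D]_n, forall v, mxev F v = B v.
Proof.
move=> lB hB.
have ex a b : exists F : D, forall v, F v = B v a b.
  apply: (@dual_of_bounded _
    ((re (dotc (G *m delta_mx b 0) (delta_mx b 0)) +
      re (dotc (H *m delta_mx a 0) (delta_mx a 0))) / 2)) => // v v1.
  have := hB _ _ v1 (fun=> delta_mx b 0) (fun=> delta_mx a 0).
  by rewrite !big_ord1 mxE dotc_delta.
exists (\matrix_(a, b) sval (cid (ex a b))) => v.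
by apply/matrixP => a b; rewrite !mxE; case: cid.
Qed.

(** A state stored as a matrix over the dual, so that elements of the bidual can be applied to its
    entries. *)
Definition dual_state (u : V) n (F : 'M[D]_n) :=
  completely_contractive nV (@mx_norms R n) (mxev F) /\ mxev F u = 1%:M.

Lemma dual_state_linear u n (F : 'M[D]_n) : dual_state u F ->
  exists2 phi : {linear V -> 'M[C]_n}, mstates nV u phi & forall v, phi v = mxev F v.
Proof.
move=> hF.
pose lphi := GRing.isLinear.Build C V 'M[C]_n _ (mxev F) (mxev_linear F).
pose phi : {linear V -> 'M[C]_n} := HB.pack (mxev F) lphi.
by exists phi.
Qed.

Lemma linear_dual_state u n (phi : {linear V -> 'M[C]_n}) : mstates nV u phi ->
  exists2 F : 'M[D]_n, dual_state u F & forall v, mxev F v = phi v.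
Proof.
move=> [cphi phiu].
have lphi : entries_linear phi.
  by move=> a b s x y; rewrite linearP !mxE.
have [F FE] := dual_of_form lphi (cc_contractive_form cphi).
exists F; last exact: FE.
split; last by rewrite FE.
have -> : mxev F = phi by exact/funext.
exact: cphi.
Qed.

(** At [y = 0] and [d = 0] the estimate reads [0 <= re <G c, c> / 2]. *)
Lemma contractive_form_psd n (B : V -> 'M[C]_n) G H c :
  entries_linear B -> contractive_form nV B G H -> 0 <= re (dotc (G *m c) c).
Proof.
move=> lB hB.
have := hB 1 (0 : 'M[V]_1) _ (fun=> c) (fun=> 0).
rewrite matrix_norms0// ler01 => /(_ isT); rewrite !big_ord1 mxE.
rewrite mulmx0 !(ip0r (dotcP _ _)) re0 addr0.
by rewrite ler_pdivlMr// mul0r.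
Qed.

Variable u : V.

(* The values of [F] at the functionals [X i j] are controlled by those of
   states, because [F + e p] becomes a state after a change of basis. *)
Lemma form_le_states n0 (S0 : 'M[D]_n0.+1) n (F : 'M[D]_n.+1) k
    (X : 'I_k -> 'I_k -> D -> C) (g : R) :
  dual_state u S0 ->
  contractive_form nV (mxev F) (mxev F u) (mxev F u) ->
  (mxev F u)^t* = mxev F u ->
  (forall i j, clinear (X i j)) ->
  (forall S : 'M[D]_n.+1, dual_state u S ->
    mx_norms (\matrix_(i, j) map_mx (X i j) S) <= g) ->
  forall c d : 'I_k -> 'cV[C]_n.+1,
    re (\sum_i \sum_j dotc (map_mx (X i j) F *m c j) (d i)) <=
    g * ((\sum_j re (dotc (mxev F u *m c j) (c j)) +
          \sum_i re (dotc (mxev F u *m d i) (d i))) / 2).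
Proof.
move=> sS0 cF hF lX gX c d; set G := mxev F u.
pose p := S0 0 0.
have pu : p u = 1 :> C.
  have [_ /matrixP/(_ 0 0)] := sS0; by rewrite !mxE.
have hp : scalar_state nV (p : V -> C).
  have [/cc_scalar_state + _] := sS0; congr scalar_state.
  by apply/funext => v; rewrite mxE.
pose K1 := re (\sum_i \sum_j X i j p * dotc (c j) (d i)).
pose K2 := (\sum_j euclid (c j) ^+ 2 + \sum_i euclid (d i) ^+ 2) / 2.
(* The perturbation by [e p] adds [e K1] to the left side and [e g K2] to the right side. *)
apply: (@le_epsilon_mul _ _ _ (g * K2 - K1)) => e e0.
pose E : 'M[D]_n.+1 := \matrix_(a, b) ((e%:C *: p) *+ (a == b)).
have XE (Y : D -> C) : clinear Y -> map_mx Y E = (e%:C * Y p)%:M.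
  move=> lY; apply/matrixP => a b; rewrite !mxE; case: (a == b); rewrite ?mulr1n ?mulr0n.
    by rewrite (clinearZ lY).
  exact: clinear0.
have EE v : mxev E v = (e%:C * (p v : C))%:M by rewrite mxev_map (XE _ (eval_clinear v)).
pose F' := F + E; pose G' := G + (e%:C)%:M.
have F'E v : mxev F' v = mxev F v + mxev E v.
  by rewrite !mxev_map; apply/matrixP => i j; rewrite !mxE.
have cF' : contractive_form nV (mxev F') G' G'.
  rewrite (_ : mxev F' = fun v => mxev F v + (e%:C * (p v : C))%:M).
    exact: (contractive_formD cF (@scalar_state_form _ _ _ n.+1 _ _ (ltW e0) hp)).
  by apply/funext => v; rewrite F'E EE.
have G'E x : re (dotc (G' *m x) x) = re (dotc (G *m x) x) + e * euclid x ^+ 2.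
  rewrite mulmxDl (ipDl (dotcP _ _)) mul_scalar_mx (ipZl (dotcP _ _)).
  by rewrite reD reZ (ipxx (dotcP _ _)).
(* [G] itself may be singular, whereas [G' = G + e] is positive definite. *)
have [x x0|h hu hG] := @posdef_congr _ _ G'.
  rewrite G'E; apply: ltr_wpDl.
    exact: (contractive_form_psd x (@mxev_entries_linear _ F) cF).
  by apply: mulr_gt0 => //; apply: exprn_gt0; exact: euclid_gt0.
have {}hG : h^t* *m G' *m h = 1%:M.
  have G'h : G'^t* = G'.
    rewrite /G' linearD map_mxD/= -/(G^t*) hF tr_scalar_mx map_scalar_mx/=.
    by rewrite [Num.conj _]conjR.
  move: hG; rewrite G'h -mulr2n -scaler_nat -scalemxAr -scalemxAl => hG.
  have := congr1 ( *:%R (2%:R^-1 : C)) hG.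
  by rewrite scalerA mulVf ?pnatr_eq0// scale1r scale_scalar_mx mulVf// pnatr_eq0.
(* Since [p u = 1], the value of [F'] at [u] is exactly [G'], which [h] carries to the identity;
   hence [S] is unital as well as contractive. *)
pose S := bimulmx (h^t*) F' h.
have sS : dual_state u S.
  split; last by rewrite mxev_bimulmx F'E EE pu mulr1.
  apply: contractive_form_cc; rewrite -hG.
  rewrite (_ : mxev S = fun v => h^t* *m mxev F' v *m h); first exact: contractive_form_conj.
  by apply/funext => v; rewrite mxev_bimulmx.
pose hi := invmx h.
have hiG : hi^t* *m hi = G'.
  have hhi : h *m hi = 1%:M by rewrite mulmxV.
  transitivity (hi^t* *m (h^t* *m G' *m h) *m hi); first by rewrite hG mulmx1.
  rewrite !mulmxA -adjM hhi -(mulmxA _ h hi) hhi mulmx1.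
  by rewrite trmx1 map_mx1 mul1mx.
have Xs i j x y : dotc (map_mx (X i j) F' *m x) y =
    dotc (map_mx (X i j) S *m (hi *m x)) (hi *m y).
  have hhi : h *m hi = 1%:M by rewrite mulmxV.
  rewrite (clinear_bimulmx (lX i j)) -!mulmxA [RHS]dotc_adj trmxCK.
  by rewrite !(mulmxA h) hhi !mul1mx.
have hiE x : euclid (hi *m x) ^+ 2 = re (dotc (G' *m x) x).
  rewrite -[LHS]reR -(ipxx (dotcP _ _)) -hiG -mulmxA.
  by rewrite [in RHS]dotc_adj trmxCK.
have := mx_norms_re (\matrix_(i, j) map_mx (X i j) S) (fun j => hi *m c j)
  (fun i => hi *m d i).
have -> : \sum_i \sum_j dotc ((\matrix_(i, j) map_mx (X i j) S) i j *m (hi *m c j))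
      (hi *m d i) =
    \sum_i \sum_j dotc (map_mx (X i j) F *m c j) (d i) +
    e%:C * \sum_i \sum_j X i j p * dotc (c j) (d i).
  rewrite mulr_sumr -big_split/=; apply: eq_bigr => i _.
  rewrite mulr_sumr -big_split/=; apply: eq_bigr => j _.
  rewrite mxE -Xs (_ : map_mx _ F' = map_mx (X i j) F + map_mx (X i j) E).
    rewrite XE// mulmxDl (ipDl (dotcP _ _)) mul_scalar_mx (ipZl (dotcP _ _)).
    by rewrite mulrA.
  by apply/matrixP => a b; rewrite !mxE (clinearD (lX i j)).
rewrite reD reZ -/K1.
under [X in _ <= _ * ((X + _) / _) -> _]eq_bigr do rewrite hiE G'E.
under [X in _ <= _ * ((_ + X) / _) -> _]eq_bigr do rewrite hiE G'E.
rewrite !big_split/= -!mulr_sumr.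
set A1 := \sum_(i < k) re _; set A2 := \sum_(i < k) re _.
set B1 := \sum_(i < k) _ ^+ 2; set B2 := \sum_(i < k) _ ^+ 2.
have psd x : 0 <= re (dotc (G *m x) x).
  exact: (contractive_form_psd x (@mxev_entries_linear _ F) cF).
have A1_ge0 : 0 <= A1 by apply: sumr_ge0.
have A2_ge0 : 0 <= A2 by apply: sumr_ge0.
have B1_ge0 : 0 <= B1 by apply: sumr_ge0 => i _; exact: sqr_ge0.
have B2_ge0 : 0 <= B2 by apply: sumr_ge0 => i _; exact: sqr_ge0.
have T_ge0 : 0 <= (A1 + e * B1 + (A2 + e * B2)) / 2.
  by rewrite divr_ge0// !addr_ge0// mulr_ge0// ltW.
move=> /le_trans/(_ (ler_wpM2r T_ge0 (gX _ sS))).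
rewrite /K2 -/B1 -/B2; lra.
Qed.

End dual_matrices.

(** * Functionals dominated by states *)

Section real_linear.
Variables (R : realType) (E : lmodType R) (L : E -> R).
Hypothesis hL : forall s x y, L (s *: x + y) = s * L x + L y.

Lemma real_linearD x y : L (x + y) = L x + L y.
Proof. by rewrite -[x]scale1r hL mul1r scale1r. Qed.

Lemma real_linear0 : L 0 = 0.
Proof. by apply: (addIr (L 0)); rewrite -real_linearD !add0r. Qed.

Lemma real_linearZ s x : L (s *: x) = s * L x.
Proof. by rewrite -[s *: x]addr0 hL real_linear0 addr0. Qed.

Lemma real_linear_sum I (r : seq I) (P : pred I) (F : I -> E) :
  L (\sum_(i <- r | P i) F i) = \sum_(i <- r | P i) L (F i).
Proof. exact: (big_morph L real_linearD real_linear0). Qed.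

Lemma real_linearN x : L (- x) = - L x.
Proof. by rewrite -scaleN1r real_linearZ mulN1r. Qed.

End real_linear.

Section sup_of_functionals.
Variables (R : realType) (E : lmodType R) (I : Type) (A : set I) (q : I -> E -> R).
Hypothesis hq : forall i s x y, A i -> q i (s *: x + y) = s * q i x + q i y.
Hypothesis bq : forall x, exists M, forall i, A i -> q i x <= M.
Hypothesis A0 : exists i, A i.

Definition sup_functional (x : E) : R := sup [set q i x | i in A].

Lemma sup_functional_ub i x : A i -> q i x <= sup_functional x.
Proof.
move=> Ai; apply: ub_le_sup; last by exists i.
by have [M hM] := bq x; exists M => _ [j Aj <-]; exact: hM.
Qed.

Lemma sup_functional_le x c : (forall i, A i -> q i x <= c) -> sup_functional x <= c.
Proof.
move=> h; apply: ge_sup; last by move=> _ [i Ai <-]; exact: h.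
by have [i Ai] := A0; exists (q i x); exists i.
Qed.

Lemma sup_functionalD x y : sup_functional (x + y) <= sup_functional x + sup_functional y.
Proof.
apply: sup_functional_le => i Ai.
have hL s x0 y0 := hq s x0 y0 Ai.
by rewrite (real_linearD hL) lerD// sup_functional_ub.
Qed.

Lemma sup_functionalZ s x : 0 < s -> sup_functional (s *: x) = s * sup_functional x.
Proof.
have le t y : 0 < t -> sup_functional (t *: y) <= t * sup_functional y.
  move=> t0; apply: sup_functional_le => i Ai; have hL s0 x0 y0 := hq s0 x0 y0 Ai.
  by rewrite (real_linearZ hL) ler_pM2l// sup_functional_ub.
move=> s0; apply/eqP; rewrite eq_le le//= -ler_pdivlMl//.
have := le s^-1 (s *: x); rewrite invr_gt0 scalerA mulVf ?gt_eqF// scale1r.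
by apply.
Qed.

End sup_of_functionals.

(** * The sublinear functional of vector states and the forms below it *)

Section state_hull.
Variable R : realType.
Local Notation C := R[i].
Variables (V : lmodType C) (nV : matrix_norms V) (hV : matricially_normed nV) (u : V).
Local Notation D := (dual nV).

Lemma pairing_emx n (B : V -> 'M[C]_n) a b v : entries_linear B ->
  pairing B (emx a b v) = B v a b.
Proof.
move=> lB; rewrite /pairing (bigD1 a)//= [X in _ + X]big1 ?addr0 => [|i ia].
  rewrite (bigD1 b)//= [X in _ + X]big1 ?addr0 => [|j jb]; first by rewrite mxE !eqxx.
  by rewrite mxE (negbTE jb) andbF mulr0n (clinear0 (lB _ _)).
by apply: big1 => j _; rewrite mxE (negbTE ia) mulr0n (clinear0 (lB _ _)).
Qed.

Lemma pairing_real_linear n (B : V -> 'M[C]_n) : entries_linear B ->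
  forall s (x y : rmx V n), re (pairing B (s *: x + y)) =
    s * re (pairing B x) + re (pairing B y).
Proof.
move=> lB s x y; rewrite -reZ -reD; congr re.
rewrite /pairing mulr_sumr -big_split; apply: eq_bigr => a _ /=.
rewrite mulr_sumr -big_split; apply: eq_bigr => b _ /=.
by rewrite -lB rmxZ !mxE.
Qed.

Lemma map_mx_ball_le n r (S : 'M[D]_n) (M : R) : 0 <= M ->
  (forall y : 'M[V]_r, nV y <= 1 -> mx_norms (map_mx (mxev S) y) <= M) ->
  forall y : 'M[V]_r, mx_norms (map_mx (mxev S) y) <= M * nV y.
Proof.
move=> M0 cS.
apply: (@le_mul_of_unit_ball _ _ _ (fun y => mx_norms (map_mx (mxev S) y))
  (fun s (y : 'M[V]_r) => map_mx ( *:%R s%:C) y)) => // [x|s x s0|s x s0].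
- exact: matrix_norms_ge0.
- by rewrite matrix_normsZ// rnormR gtr0_norm.
- have -> : map_mx (mxev S) (map_mx ( *:%R s%:C) x) =
      map_mx ( *:%R s%:C) (map_mx (mxev S) x).
    apply/matrixP => i j; rewrite [LHS]mxE [X in mxev S X]mxE [RHS]mxE [in RHS]mxE.
    apply/matrixP => a b; rewrite [LHS]mxE [RHS]mxE [in RHS]mxE.
    exact: (clinearZ (dual_clinear _)).
  exact: mx_normsZ.
Qed.

Lemma map_mx_state_le n r (S : 'M[D]_n) (y : 'M[V]_r) :
  completely_contractive nV (@mx_norms R n) (mxev S) ->
  mx_norms (map_mx (mxev S) y) <= nV y.
Proof.
move=> /completely_contractiveP cS; rewrite -[leRHS]mul1r.
by apply: map_mx_ball_le => // {}y; exact: cS.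
Qed.

Section hull.
Variables (n0 : nat) (S0 : 'M[D]_n0.+1).
Hypothesis sS0 : dual_state u S0.
Variable n : nat.

Record vstate := VState {
  vs_dim : nat; vs_state : 'M[D]_vs_dim.+1; vs_vec : 'I_n -> 'cV[C]_vs_dim.+1 }.

(** The family [vs_vec] is used in both slots of the inner product, so [vs_form t u] is a Gram
    matrix. The bound 2 leaves room for two concatenated families whose squared norms add up to at
    most 2. *)
Definition vstates : set vstate := [set t | dual_state u (vs_state t) /\
  \sum_a euclid (vs_vec t a) ^+ 2 <= 2].

Definition vs_form (t : vstate) : V -> 'M[C]_n :=
  family_form (@dotc R _) (fun v w => mxev (vs_state t) v *m w) (vs_vec t).

Definition vs_val (t : vstate) (z : rmx V n) : R := re (pairing (vs_form t) z).

Lemma vs_form_linear t : entries_linear (vs_form t).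
Proof.
move=> a b s x y; rewrite !mxE (mxev_linear (vs_state t)) mulmxDl.
by rewrite (ipDl (dotcP _ _)) -scalemxAl (ipZl (dotcP _ _)).
Qed.

Lemma vs_valE t z : vs_val t z =
  re (\sum_a \sum_b dotc (mxev (vs_state t) (z a b) *m vs_vec t b) (vs_vec t a)).
Proof.
by congr re; apply: eq_bigr => a _; apply: eq_bigr => b _; rewrite mxE.
Qed.

Lemma vs_val_le t z : vstates t -> vs_val t z <= 2 * nV z.
Proof.
move=> [[ct _] nt]; rewrite vs_valE.
have := mx_norms_re (map_mx (mxev (vs_state t)) z) (vs_vec t) (vs_vec t).
under eq_bigr do under eq_bigr do rewrite mxE.
move=> /le_trans; apply.
have s0 : 0 <= \sum_a euclid (vs_vec t a) ^+ 2.
  by apply: sumr_ge0 => i _; exact: sqr_ge0.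
rewrite mulrC; apply: ler_pM; rewrite ?mx_norms_ge0 ?map_mx_state_le//; lra.
Qed.

Lemma vs_form_contractive t : vstates t ->
  contractive_form nV (vs_form t) (vs_form t u) (vs_form t u).
Proof.
move=> [[ct tu] _].
have -> : vs_form t u = gram (@dotc R _) (vs_vec t).
  by apply/matrixP => a b; rewrite !mxE tu mul1mx.
apply: family_form_contractive; first exact: dotcP.
- by move=> v a w; rewrite scalemxAr.
- by move=> v w w'; rewrite mulmxDr.
- by move=> v; exact: mulmx_bounded.
- move=> r y y1; have /completely_contractiveP/(_ _ _ y1) := ct.
  congr (ampnorm _ _ <= _).
  by apply/funext => i; apply/funext => j; rewrite mxE.
Qed.

Lemma vstates_nonempty : exists t, vstates t.
Proof.
exists (VState S0 (fun=> 0)); split=> //=.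
rewrite big1 ?ler0n// => i _; by rewrite (ip0_norm (dotcP _ _)) expr0n.
Qed.

Lemma vs_val_linear t s x y : vstates t ->
  vs_val t (s *: x + y) = s * vs_val t x + vs_val t y.
Proof. by move=> _; exact: (pairing_real_linear (@vs_form_linear t)). Qed.

Lemma vs_val_bounded x : exists M, forall t, vstates t -> vs_val t x <= M.
Proof. by exists (2 * nV (x : 'M[V]_n)) => t; exact: vs_val_le. Qed.

Definition vs_sup := sup_functional vstates vs_val.

(** Domination by [vs_sup] makes [L] monotone for the order given by all vector states.
    Contractivity and symmetry hold for each [vs_form t] and are linear in the form, so [B] inherits
    them. The trace bound is the domination at the diagonal matrix with entries [u]. *)
Lemma vs_sup_form (L : rmx V n -> R) (K : R) : 0 <= K ->
  (forall s x y, L (s *: x + y) = s * L x + L y) ->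
  (forall z, L z <= K * vs_sup z) ->
  let B := mxfunctional (L : 'M[V]_n -> R) in
  [/\ contractive_form nV B (B u) (B u), (B u)^t* = B u &
      \sum_a re (B u a a) <= 2 * K].
Proof.
move=> K0 hL LP B.
have [lB BL] := mxfunctionalP hL.
(* [vs_sup (z - w)] is at most 0 here, and so is [L (z - w)]. *)
have Lmono z w : (forall t, vstates t -> vs_val t z <= vs_val t w) -> L z <= L w.
  move=> zw; rewrite -subr_ge0 -(real_linearN hL) -(real_linearD hL).
  rewrite -oppr_le0 -(real_linearN hL) opprB.
  apply: le_trans (LP _) _; apply: mulr_ge0_le0 => //.
  apply: (sup_functional_le vstates_nonempty) => t ht.
  have hq s x y := @vs_val_linear t s x y ht.
  by rewrite (real_linearD hq) (real_linearN hq) subr_le0 zw.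
have Leq z w : (forall t, vstates t -> vs_val t z = vs_val t w) -> L z = L w.
  move=> zw; apply/eqP; rewrite eq_le !Lmono// => t ht; by rewrite zw.
split.
- move=> r y y1 c d.
  (* The weight on the right is also a value of the functional, at [u] sandwiched by [x]; both sides
     of the estimate can thus be compared through [Lmono]. *)
  pose dd (x : 'cV[C]_n) : rmx V n :=
    bimulmx (colmx_conj (fun _ : 'I_1 => x)) (const_mx u) (rowmx_of (fun _ : 'I_1 => x)).
  have ddE (T : V -> 'M[C]_n) x : entries_linear T ->
      re (dotc (T u *m x) x) = re (pairing T (dd x)).
    by move=> lT; rewrite pairing_bimulmx// !big_ord1 mxE.
  rewrite -pairing_bimulmx// BL.
  under eq_bigr do rewrite ddE// BL.
  under [X in _ <= (_ + X) / _]eq_bigr do rewrite ddE// BL.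
  rewrite -!(real_linear_sum hL) -(real_linearD hL) mulrC -(real_linearZ hL).
  apply: Lmono => t ht; have hq s x z := @vs_val_linear t s x z ht.
  rewrite (real_linearZ hq) (real_linearD hq) !(real_linear_sum hq).
  have := vs_form_contractive ht y1 c d.
  rewrite -pairing_bimulmx; last exact: vs_form_linear.
  under eq_bigr do rewrite (ddE _ _ (@vs_form_linear t)).
  under [X in _ <= (_ + X) / _ -> _]eq_bigr do rewrite (ddE _ _ (@vs_form_linear t)).
  by rewrite [in X in X -> _]mulrC.
- have vsu t a b v : vstates t ->
      vs_val t (emx a b v) = re (dotc (mxev (vs_state t) v *m vs_vec t b) (vs_vec t a)).
    by move=> ht; rewrite /vs_val pairing_emx ?mxE//; exact: vs_form_linear.
  apply/matrixP => a b; rewrite 2!mxE [B u b a]mxE [in RHS]mxE /complexify/=.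
  (* Transposed entries at [u] are conjugate under each vector state. Their real parts agree here;
     the imaginary parts, read at [i u], are opposite. *)
  rewrite (Leq (emx b a u) (emx a b u)); last first.
    move=> t ht; have [[_ tu] _] := ht; rewrite !vsu// tu !mul1mx.
    by rewrite (ipC (dotcP _ _)) reJ.
  apply/eqP; rewrite eq_complex/= eqxx/= opprK; apply/eqP.
  rewrite -(real_linearN hL); apply: Leq => t ht; have [[_ tu] _] := ht.
  have hq s x z := @vs_val_linear t s x z ht.
  have iu : mxev (vs_state t) ('i *: u) = 'i *: 1%:M.
    rewrite -tu; apply/matrixP => i j; rewrite [LHS]mxE [RHS]mxE [in RHS]mxE.
    exact: (clinearZ (dual_clinear _)).
  rewrite (real_linearN hq) !vsu// iu -!scalemxAl !mul1mx !(ipZl (dotcP _ _)).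
  rewrite (ipC (dotcP _ _) (vs_vec t b)).
  by case: (dotc _ _) => x y /=; rewrite !mul0r !mul1r !sub0r opprK.
- under eq_bigr do rewrite -(pairing_emx _ _ _ lB) BL.
  rewrite -(real_linear_sum hL); apply: le_trans (LP _) _.
  rewrite mulrC ler_wpM2r//; apply: (sup_functional_le vstates_nonempty) => t ht.
  have hq s x z := @vs_val_linear t s x z ht.
  rewrite (real_linear_sum hq); have [[_ tu] nt] := ht; apply: le_trans nt.
  apply: ler_sum => a _; rewrite /vs_val pairing_emx; last exact: vs_form_linear.
  by rewrite mxE tu mul1mx (ipxx (dotcP _ _)) reR.
Qed.

End hull.
End state_hull.

(** * Functionals on M_k(V) extended to forms of size 2k *)

Section functional_le_states.
Variable R : realType.
Local Notation C := R[i].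
Variables (V : lmodType C) (nV : matrix_norms V) (hV : matricially_normed nV) (u : V).
Local Notation D := (dual nV).

(** At the concatenated family [(w, v)], a corner matrix sees [v] only on the right and [w] only on
    the left, so two independent families are recovered from one. *)
Definition corner k (x : 'M[V]_k) : rmx V (k + k) := block_mx 0 x 0 0.

Lemma corner_linear k s (x y : 'M[V]_k) :
  s *: corner x + corner y = corner (map_mx ( *:%R s%:C) x + y) :> 'M[V]_(k + k).
Proof.
rewrite rmxZ /corner map_block_mx add_block_mx !addr0; congr block_mx;
  by apply/matrixP => i j; rewrite !mxE scaler0.
Qed.

Lemma emx_corner k (i j : 'I_k) v :
  emx (lshift k i) (rshift k j) v = corner (emx i j v) :> 'M[V]_(k + k).
Proof.
apply/matrixP => a b; rewrite /corner [LHS]mxE.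
rewrite -[a]splitK -[b]splitK; case: (fintype.split a) => a'; case: (fintype.split b) => b' /=.
- by rewrite block_mxEul mxE eq_lrshift andbF.
- by rewrite block_mxEur mxE eq_lshift eq_rshift.
- by rewrite block_mxEdl mxE eq_rlshift.
- by rewrite block_mxEdr mxE eq_rlshift.
Qed.

Variables (n0 : nat) (S0 : 'M[D]_n0.+1).
Hypothesis sS0 : dual_state u S0.

Lemma mx_norms_le_corner k n (S : 'M[D]_n.+1) (x : 'M[V]_k) : dual_state u S ->
  mx_norms (map_mx (mxev S) x) <= vs_sup nV u (corner x).
Proof.
move=> sS; apply: mx_norms_le => v w vw.
have S00 (x1 y1 : 'cV[C]_n.+1) : dotc (mxev S 0 *m x1) y1 = 0.
  have -> : mxev S 0 = 0.
    by apply/matrixP => a b; rewrite !mxE (clinear0 (dual_clinear _)).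
  by rewrite mul0mx (ip0l (dotcP _ _)).
pose z (a : 'I_(k + k)) := match fintype.split a with inl i => w i | inr j => v j end.
have zl i : z (lshift k i) = w i by rewrite /z (unsplitK (inl i)).
have zr j : z (rshift k j) = v j by rewrite /z (unsplitK (inr j)).
have zt : vstates u (VState S z).
  split=> //=; rewrite big_split_ord/= addrC.
  by under eq_bigr do rewrite zr; under [X in _ + X <= _]eq_bigr do rewrite zl.
apply: le_trans (sup_functional_ub (@vs_val_bounded _ _ _ hV u _) (corner x) zt).
rewrite vs_valE/= big_split_ord/= [X in _ <= re (_ + X)]big1 ?addr0; last first.
  move=> i _; rewrite big1// => j _; rewrite -[j]splitK.
  case: (fintype.split j) => j' /=; rewrite /corner ?block_mxEdl ?block_mxEdr [X in mxev S X]mxE;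
  exact: S00.
rewrite le_eqVlt; apply/orP; left; apply/eqP; congr re.
apply: eq_bigr => i _; rewrite big_split_ord/= [X in _ = X + _]big1 ?add0r.
  apply: eq_bigr => j _; rewrite /corner block_mxEur zl zr; by rewrite mxE.
by move=> j _; rewrite /corner block_mxEul [X in mxev S X]mxE S00.
Qed.

(** A domination tested on [M_k(V)] is transferred to arbitrary functionals [X i j] on the dual.
    This works without any continuity of [X], because [f] is exactly a block of a matrix [F] over
    the dual to which [form_le_states] applies. Real upper bounds [c] and [g] replace suprema. *)
Theorem functional_le_states k (f : 'M[D]_k) (X : 'I_k -> 'I_k -> D -> C) (K g : R) :
  0 <= K ->
  (forall (x : 'M[V]_k) c, (forall n (S : 'M[D]_n.+1), dual_state u S ->
      mx_norms (map_mx (mxev S) x) <= c) ->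
    re (\sum_i \sum_j (f i j (x i j) : C)) <= K * c) ->
  (forall i j, clinear (X i j)) ->
  (forall n (S : 'M[D]_n.+1), dual_state u S ->
    mx_norms (\matrix_(i, j) map_mx (X i j) S) <= g) ->
  re (\sum_i \sum_j X i j (f i j)) <= K * g.
Proof.
move=> K0 hf lX hg.
have g0 : 0 <= g := le_trans (mx_norms_ge0 _) (hg _ _ sS0).
(* States have positive size, so 2k must be written as a successor. *)
case: k => [|k] in f X hf lX hg *; first by rewrite big_ord0 re0 mulr_ge0.
pose q (x : 'M[V]_k.+1) := re (\sum_i \sum_j (f i j (x i j) : C)).
have lq s (x y : 'M[V]_k.+1) : q (map_mx ( *:%R s%:C) x + y) = s * q x + q y.
  rewrite /q -reZ -reD; congr re; rewrite mulr_sumr -big_split; apply: eq_bigr => i _ /=.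
  rewrite mulr_sumr -big_split; apply: eq_bigr => j _ /=.
  by rewrite -(dual_clinear (f i j)) !mxE.
pose n := (k.+1 + k.+1)%N.
pose P (z : rmx V n) := K * vs_sup nV u z.
have bd := @vs_val_bounded _ _ _ hV u n.
have lin (t : @vstate R V nV n) s (x y : rmx V n) := @vs_val_linear _ _ _ u n t s x y.
have ne := @vstates_nonempty _ _ _ u _ _ sS0 n.
have [L [lL LP Lq]] : exists L : rmx V n -> R,
    [/\ forall s x y, L (s *: x + y) = s * L x + L y, forall z, L z <= P z &
        forall z, (exists x, z = corner x) -> L z = q (ursubmx (z : 'M[V]_(k.+1 + k.+1)))].
  apply: (@hahn_banach _ _ P _ _ [set z | exists x, z = corner x]).
  - move=> x y; rewrite /P -mulrDr ler_wpM2l//.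
    exact: (sup_functionalD lin bd ne).
  - by move=> s x s0; rewrite /P /vs_sup (sup_functionalZ lin bd ne)// mulrCA.
  - by exists 0; rewrite /corner block_mx0.
  - by move=> s _ _ [x ->] [y ->]; eexists; exact: corner_linear.
  - move=> s _ _ [x ->] [y ->]; rewrite corner_linear /corner !block_mxKur.
    exact: lq.
  - move=> _ [x ->]; rewrite /corner block_mxKur; apply: hf => m S sS.
    exact: mx_norms_le_corner.
have [cB hB trB] := vs_sup_form sS0 K0 lL LP.
set B := mxfunctional _ in cB hB trB.
have [lB _] := mxfunctionalP lL.
have [F FE] := dual_of_form hV lB cB.
(* [L] extends the real part of [f] from the corner; complexifying recovers [f] entirely. *)
have Ff i j : F (lshift _ i) (rshift _ j) = f i j.
  apply: val_inj; apply/funext => v.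
  have := congr1 (fun A : 'M[C]_n => A (lshift _ i) (rshift _ j)) (FE v).
  rewrite !mxE /complexify /= => ->.
  rewrite !emx_corner !Lq; try by eexists.
  have qe w : q (ursubmx (corner (emx i j w) : 'M[V]_(k.+1 + k.+1))) = re (f i j w : C).
    rewrite /corner block_mxKur.
    transitivity (re (pairing (mxev f) (emx i j w))).
      congr re; apply: eq_bigr => a _; apply: eq_bigr => b _; by rewrite [RHS]mxE.
    by rewrite (pairing_emx _ _ _ (@mxev_entries_linear _ _ _ _ f)) mxE.
  rewrite !qe (clinearZ (dual_clinear (f i j))).
  by case: (f i j v : C) => a b /=; rewrite mul0r mul1r sub0r opprK.
have eF : mxev F = B by exact/funext.
have := @form_le_states _ _ _ hV u _ S0 (k + k.+1)%N F _ X g sS0.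
rewrite eF => /(_ cB hB lX (hg _)).
move=> /(_ (fun j => delta_mx (rshift k.+1 j : 'I_n) 0 : 'cV[C]_n)
  (fun i => delta_mx (lshift k.+1 i : 'I_n) 0 : 'cV[C]_n)).
have -> : \sum_i \sum_j X i j (f i j) = \sum_i \sum_j
    dotc (map_mx (X i j) F *m (delta_mx (rshift k.+1 j : 'I_n) 0 : 'cV[C]_n))
      (delta_mx (lshift k.+1 i : 'I_n) 0 : 'cV[C]_n).
  apply: eq_bigr => i _; apply: eq_bigr => j _.
  by rewrite (@dotc_delta R n) mxE Ff.
move=> /le_trans; apply.
under eq_bigr do rewrite dotc_delta.
under [X in (_ + X)]eq_bigr do rewrite dotc_delta.
(* The weights of the basis vectors in the two halves together form the trace of [B u], at most
   [2 K]; the average gives [K]. *)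
move: trB; rewrite big_split_ord/= => trB.
rewrite [leRHS]mulrC ler_wpM2l//; lra.
Qed.

End functional_le_states.

(** * The dual and the bidual *)

Section mx_norms_more.
Variable R : realType.
Local Notation C := R[i].

Lemma mx_normsD n k (x y : 'M['M[C]_n]_k) : mx_norms (x + y) <= mx_norms x + mx_norms y.
Proof.
apply: mx_norms_le => v w vw.
have -> : \sum_i \sum_j dotc ((x + y) i j *m v j) (w i) =
    \sum_i \sum_j dotc (x i j *m v j) (w i) + \sum_i \sum_j dotc (y i j *m v j) (w i).
  rewrite -big_split; apply: eq_bigr => i _ /=; rewrite -big_split.
  by apply: eq_bigr => j _ /=; rewrite mxE mulmxDl (ipDl (dotcP _ _)).
rewrite reD lerD//; apply: le_trans (mx_norms_re _ _ _) _;
  by rewrite ler_piMr ?mx_norms_ge0//; lra.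
Qed.

Lemma mx_norms_vec_le n k (x : 'M['M[C]_n]_k) c :
  (forall v, l2norm (@euclid R n) v <= 1 ->
    l2norm (@euclid R n) (fun i => \sum_j x i j *m v j) <= c) -> mx_norms x <= c.
Proof.
move=> h; apply: ge_sup; last by move=> _ [v v1 <-]; exact: h.
exists (l2norm (@euclid R n) (fun i => \sum_j x i j *m 0)); exists (fun=> 0) => //=.
rewrite /l2norm big1 ?sqrtr0// => i _.
by rewrite (ip0_norm (dotcP _ _)) expr0n.
Qed.

Lemma l2norm_mulmx m n k (A : 'M[C]_(m, n)) (v : 'I_k -> 'cV[C]_n) :
  l2norm (@euclid R m) (fun i => A *m v i) <= mxopnorm A * l2norm (@euclid R n) v.
Proof.
rewrite -(ler_pXn2r (n := 2))// ?nnegrE ?sqrtr_ge0 ?mulr_ge0 ?sqrtr_ge0 ?mxopnorm_ge0//.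
rewrite exprMn !l2normE mulr_sumr; apply: ler_sum => i _.
rewrite -exprMn ler_pXn2r// ?nnegrE ?mulr_ge0 ?mxopnorm_ge0 ?sqrtr_ge0//.
exact: mxopnormP.
Qed.

Lemma mx_norms_bimulmx m n k (A : 'M[C]_(n, m)) (x : 'M['M[C]_m]_k) (B : 'M[C]_(m, n)) :
  mx_norms (map_mx (fun z => A *m z *m B) x) <= mxopnorm A * mx_norms x * mxopnorm B.
Proof.
apply: mx_norms_vec_le => v v1.
have -> : (fun i => \sum_j map_mx (fun z => A *m z *m B) x i j *m v j) =
    (fun i => A *m (\sum_j x i j *m (B *m v j))).
  apply/funext => i; rewrite mulmx_sumr; apply: eq_bigr => j _.
  by rewrite mxE !mulmxA.
apply: le_trans (l2norm_mulmx _ _) _; rewrite -mulrA ler_wpM2l ?mxopnorm_ge0//.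
apply: le_trans (mx_norms_vec _ _) _; rewrite ler_wpM2l ?mx_norms_ge0//.
by apply: le_trans (l2norm_mulmx _ _) _; rewrite ler_piMr ?mxopnorm_ge0.
Qed.

Lemma mxopnorm_scalar n (a : C) : mxopnorm (a%:M : 'M[C]_n) <= rnorm a.
Proof.
apply: ge_sup.
  by exists (euclid ((a%:M : 'M[C]_n) *m 0)); exists 0; rewrite //= (ip0_norm (dotcP _ _)).
move=> _ [v /= v1 <-].
by rewrite mul_scalar_mx (ipZ_norm (dotcP _ _)) ler_piMr ?rnorm_ge0.
Qed.

(** The canonical shuffle between [M_k(M_n)] and [M_n(M_k)]. A matrix over V evaluated at a matrix
    over the dual can be read either way; as [flip_mx] is an involution, [mx_norms_flip] makes both
    readings have the same norm. *)
Definition flip_mx n k (x : 'M['M[C]_n]_k) : 'M['M[C]_k]_n :=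
  \matrix_(p, q) \matrix_(i, j) x i j p q.

Definition flip_vec n k (v : 'I_k -> 'cV[C]_n) : 'I_n -> 'cV[C]_k :=
  fun q => \col_j v j q 0.

Lemma flip_vec_norm n k (v : 'I_k -> 'cV[C]_n) :
  \sum_q euclid (flip_vec v q) ^+ 2 = \sum_j euclid (v j) ^+ 2.
Proof.
have eE m (x : 'cV[C]_m) : euclid x ^+ 2 = \sum_i rnorm (x i 0) ^+ 2.
  by rewrite /euclid sqr_sqrtr// sumr_ge0// => i _; exact: sqr_ge0.
under eq_bigr do rewrite eE; under [RHS]eq_bigr do rewrite eE.
rewrite exchange_big; apply: eq_bigr => j _; apply: eq_bigr => q _.
by rewrite mxE.
Qed.

Lemma mx_norms_flip n k (x : 'M['M[C]_n]_k) : mx_norms (flip_mx x) <= mx_norms x.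
Proof.
apply: mx_norms_le => v w vw.
have -> : \sum_p \sum_q dotc (flip_mx x p q *m v q) (w p) =
    \sum_i \sum_j dotc (x i j *m flip_vec v j) (flip_vec w i).
  transitivity (\sum_p \sum_q \sum_i \sum_j x i j p q * v q j 0 * Num.conj (w p i 0)).
    apply: eq_bigr => p _; apply: eq_bigr => q _; rewrite dotc_mulmx.
    by apply: eq_bigr => i _; apply: eq_bigr => j _; rewrite !mxE.
  transitivity (\sum_i \sum_j \sum_p \sum_q x i j p q * v q j 0 * Num.conj (w p i 0)).
    under eq_bigr do rewrite exchange_big/=; rewrite exchange_big.
    apply: eq_bigr => i _ /=; under eq_bigr do rewrite exchange_big/=.
    by rewrite exchange_big.
  apply: eq_bigr => i _; apply: eq_bigr => j _; rewrite dotc_mulmx.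
  by apply: eq_bigr => p _; apply: eq_bigr => q _; rewrite !mxE.
apply: le_trans (mx_norms_re _ _ _) _; rewrite !flip_vec_norm.
by rewrite ler_piMr ?mx_norms_ge0//; lra.
Qed.

Lemma flip_mxK n k (x : 'M['M[C]_n]_k) : flip_mx (flip_mx x) = x.
Proof.
by apply/matrixP => i j; apply/matrixP => p q; rewrite !mxE.
Qed.

Lemma entry_le_mx_norms n k (x : 'M['M[C]_n]_k) i j p q : re (x i j p q) <= mx_norms x.
Proof.
have := mx_norms_re x (fun j' => if j' == j then delta_mx q 0 else 0)
  (fun i' => if i' == i then delta_mx p 0 else 0).
have sE (l : 'I_k) (r : 'I_n) :
    \sum_j euclid (if j == l then delta_mx r 0 else 0 : 'cV[C]_n) ^+ 2 = 1.
  rewrite (bigD1 l)//= eqxx euclid_delta big1 ?addr0// => m /negbTE ->.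
  by rewrite (ip0_norm (dotcP _ _)) expr0n.
rewrite !sE (bigD1 i)//= [X in _ + X]big1 ?addr0 => [|i' /negbTE i'i]; last first.
  by rewrite i'i big1// => j' _; rewrite (ip0r (dotcP _ _)).
rewrite eqxx (bigD1 j)//= [X in _ + X]big1 ?addr0 => [|j' /negbTE j'j]; last first.
  by rewrite j'j mulmx0 (ip0l (dotcP _ _)).
by rewrite eqxx dotc_delta => /le_trans; apply; lra.
Qed.

End mx_norms_more.

(** * The operator space dual is matricially normed *)

Section dual_norms.
Variable R : realType.
Local Notation C := R[i].
Variables (V : lmodType C) (nV : matrix_norms V) (hV : matricially_normed nV).
Local Notation D := (dual nV).

(** Each entry is a completely bounded functional by [mx_norms_functional_le], and the bounds of the
    entries are summed. This makes the cb norm finite; otherwise [fine] in [dual_norms] would return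
    the default 0. *)
Lemma mxev_bounded n (F : 'M[D]_n) : exists2 M : R, 0 <= M &
  forall r (y : 'M[V]_r), nV y <= 1 -> mx_norms (map_mx (mxev F) y) <= M.
Proof.
have ex a b : exists2 M : R, 0 <= M & forall v, rnorm (F a b v : C) <= M * vnorm nV v.
  have := valP (F a b); rewrite unfold_in => /asboolP[_ [M hM]].
  exists `|M| => // v; apply: le_trans (hM v) _.
  by rewrite ler_wpM2r ?ler_norm// vnorm_ge0.
pose M a b := s2val (cid2 (ex a b)).
have M0 a b : 0 <= M a b by rewrite /M; case: cid2.
have hM a b v : rnorm (F a b v : C) <= M a b * vnorm nV v.
  by rewrite /M; case: cid2.
exists (\sum_a \sum_b M a b); first by apply: sumr_ge0 => a _; exact: sumr_ge0.
move=> r y y1; apply: mx_norms_le => c d cd.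
have -> : \sum_i \sum_j dotc (map_mx (mxev F) y i j *m c j) (d i) =
    \sum_a \sum_b \sum_i \sum_j (F a b (y i j) : C) * c j b 0 * Num.conj (d i a 0).
  transitivity (\sum_i \sum_j \sum_a \sum_b
      (F a b (y i j) : C) * c j b 0 * Num.conj (d i a 0)).
    apply: eq_bigr => i _; apply: eq_bigr => j _; rewrite dotc_mulmx.
    by apply: eq_bigr => a _; apply: eq_bigr => b _; rewrite !mxE.
  under eq_bigr do rewrite exchange_big/=; rewrite exchange_big.
  apply: eq_bigr => i _ /=; under eq_bigr do rewrite exchange_big/=.
  by rewrite exchange_big.
rewrite re_sum; apply: ler_sum => a _; rewrite re_sum; apply: ler_sum => b _.
pose c1 j : 'cV[C]_1 := const_mx (c j b 0); pose d1 i : 'cV[C]_1 := const_mx (d i a 0).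
pose x : 'M['M[C]_1]_r := \matrix_(i, j) const_mx (F a b (y i j) : C).
have lF : linear (F a b : V -> C^o) by exact: (dual_clinear (F a b)).
have xM : mx_norms x <= M a b.
  apply: mx_norms_vec_le => w w1.
  have := mx_norms_functional_le hV lF (M0 a b) (hM a b) y1 w1.
  congr (_ <= _); congr l2norm; apply/funext => i.
  by apply: eq_bigr => j _; rewrite mxE.
have eE (z : C) : euclid (const_mx z : 'cV[C]_1) ^+ 2 = rnorm z ^+ 2.
  by apply: complexI; rewrite -(ipxx (dotcP _ _)) /dotc big_ord1 mxE mul_conj.
have le1 (m : nat) (e : 'I_r -> 'cV[C]_m) (l : 'I_m) :
    \sum_j euclid (const_mx (e j l 0) : 'cV[C]_1) ^+ 2 <= \sum_j euclid (e j) ^+ 2.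
  apply: ler_sum => j _; rewrite eE /euclid sqr_sqrtr; last first.
    by apply: sumr_ge0 => q _; exact: sqr_ge0.
  by rewrite (bigD1 l)//= lerDl; apply: sumr_ge0 => q _; exact: sqr_ge0.
have -> : \sum_i \sum_j (F a b (y i j) : C) * c j b 0 * Num.conj (d i a 0) =
    \sum_i \sum_j dotc (x i j *m c1 j) (d1 i).
  apply: eq_bigr => i _; apply: eq_bigr => j _.
  by rewrite dotc_mulmx !big_ord1 !mxE.
apply: le_trans (mx_norms_re _ _ _) _; rewrite -[leRHS]mulr1.
apply: ler_pM => //; first exact: mx_norms_ge0.
  by rewrite divr_ge0// addr_ge0//; apply: sumr_ge0 => i _; exact: sqr_ge0.
have := le1 _ c b; have := le1 _ d a; rewrite /c1 /d1; lra.
Qed.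

Lemma dual_normsP n (F : 'M[D]_n) :
  [/\ 0 <= dual_norms nV F,
      forall r (y : 'M[V]_r), nV y <= 1 -> mx_norms (map_mx (mxev F) y) <= dual_norms nV F &
      forall c, 0 <= c ->
        (forall r (y : 'M[V]_r), nV y <= 1 -> mx_norms (map_mx (mxev F) y) <= c) ->
        dual_norms nV F <= c].
Proof.
have [M M0 hM] := mxev_bounded F.
pose cb := cb_norm nV (@mx_norms R n) (mxev F).
have cbE : dual_norms nV F = fine cb by [].
have ub (c : R) : (forall r (y : 'M[V]_r), nV y <= 1 -> mx_norms (map_mx (mxev F) y) <= c) ->
    (cb <= c%:E)%E.
  by move=> hc; apply/cb_norm_on_le => k x _ x1; rewrite lee_fin hc.
have lb k (x : 'M[V]_k) : nV x <= 1 -> ((mx_norms (map_mx (mxev F) x))%:E <= cb)%E.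
  by move=> x1; have /cb_norm_on_le := lexx cb; apply.
have fin : cb \is a fin_num.
  rewrite ge0_fin_numE; first by rewrite (le_lt_trans (ub _ hM))// ltry.
  apply: le_trans (lb 0%N 0 _); first by rewrite lee_fin mx_norms_ge0.
  by rewrite matrix_norms0.
have cE : cb = (dual_norms nV F)%:E by rewrite cbE fineK.
have h r (y : 'M[V]_r) : nV y <= 1 -> mx_norms (map_mx (mxev F) y) <= dual_norms nV F.
  by move=> /lb; rewrite cE lee_fin.
split=> // [|c c0 /ub]; last by rewrite cE lee_fin.
apply: le_trans (h 0%N 0 _); first exact: mx_norms_ge0.
by rewrite matrix_norms0.
Qed.

Lemma dual_norms_map_le n (F : 'M[D]_n) r (y : 'M[V]_r) :
  mx_norms (map_mx (mxev F) y) <= dual_norms nV F * nV y.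
Proof.
by have [h0 h1 _] := dual_normsP F; apply: map_mx_ball_le => // {}y; exact: h1.
Qed.

Lemma dual_norms_ball n (F : 'M[D]_n) : dual_norms nV F <= 1 <->
  completely_contractive nV (@mx_norms R n) (mxev F).
Proof.
have [h0 h1 h2] := dual_normsP F; rewrite completely_contractiveP; split.
  by move=> F1 k x x1; apply: le_trans (h1 _ _ x1) _.
exact: h2.
Qed.

Lemma dual_norms_bimulmx m n (a : 'M[C]_(n, m)) (F : 'M[D]_m) (b : 'M[C]_(m, n)) :
  dual_norms nV (bimulmx a F b) <= mxopnorm a * dual_norms nV F * mxopnorm b.
Proof.
have [h0 h1 _] := dual_normsP F; have [_ _] := dual_normsP (bimulmx a F b); apply.
  by rewrite !mulr_ge0 ?mxopnorm_ge0.
move=> r y y1.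
have -> : map_mx (mxev (bimulmx a F b)) y =
    map_mx (fun z => a *m z *m b) (map_mx (mxev F) y).
  by apply/matrixP => i j; rewrite ![in RHS]mxE [LHS]mxE mxev_bimulmx.
apply: le_trans (mx_norms_bimulmx _ _ _) _.
by rewrite ler_wpM2r ?mxopnorm_ge0// ler_wpM2l ?mxopnorm_ge0// h1.
Qed.

Lemma dual_normsD n (F G : 'M[D]_n) :
  dual_norms nV (F + G) <= dual_norms nV F + dual_norms nV G.
Proof.
have [F0 F1 _] := dual_normsP F; have [G0 G1 _] := dual_normsP G.
have [_ _ h] := dual_normsP (F + G).
apply: h; first exact: (addr_ge0 F0 G0).
move=> r y y1.
have -> : map_mx (mxev (F + G)) y = map_mx (mxev F) y + map_mx (mxev G) y.
  apply/matrixP => i j; apply/matrixP => p q.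
  rewrite [LHS](_ : _ = mxev (F + G) (y i j) p q); last by rewrite [in LHS]mxE.
  rewrite [LHS]mxE [(F + G) p q]mxE.
  by rewrite [RHS](_ : _ = mxev F (y i j) p q + mxev G (y i j) p q) ?mxE.
exact: (le_trans (mx_normsD _ _) (lerD (F1 _ _ y1) (G1 _ _ y1))).
Qed.

Lemma dual_norms_matricially_normed : matricially_normed (dual_norms nV).
Proof.
split=> [k F G|k a F|k F F0|m n a F b]; last exact: dual_norms_bimulmx.
- exact: dual_normsD.
(* Scaling is a two-sided multiplication by scalar matrices, which gives one inequality; scaling
   back by [a^-1] gives the other. *)
- have le (b : C) (G : 'M[D]_k) :
      dual_norms nV (map_mx ( *:%R b) G) <= rnorm b * dual_norms nV G.
    have -> : map_mx ( *:%R b) G = bimulmx b%:M G 1%:M.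
      apply/matrixP => i j; rewrite !mxE (bigD1 i)//= [X in _ + X]big1 ?addr0; last first.
        by move=> l li; apply: big1 => l' _; rewrite !mxE eq_sym (negbTE li) mul0r scale0r.
      rewrite (bigD1 j)//= [X in _ + X]big1 ?addr0; last first.
        by move=> l lj; rewrite !mxE (negbTE lj) mulr0 scale0r.
      by rewrite !mxE !eqxx mulr1.
    apply: le_trans (dual_norms_bimulmx _ _ _) _; rewrite -[leRHS]mulr1.
    have [G0 _ _] := dual_normsP G.
    apply: ler_pM; rewrite ?mulr_ge0 ?mxopnorm_ge0//.
      by rewrite ler_wpM2r// mxopnorm_scalar.
    by apply: le_trans (mxopnorm_scalar _ _) _; rewrite rnorm1.
  have [F0 _ _] := dual_normsP F.
  have [G0 _ _] := dual_normsP (map_mx ( *:%R a) F).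
  apply/eqP; rewrite eq_le le/=.
  have [->|a0] := eqVneq a 0; first by rewrite rnorm0 mul0r; have [] := dual_normsP (map_mx ( *:%R (0 : C)) F).
  have ra : 0 < rnorm a.
    rewrite lt_neqAle rnorm_ge0 andbT eq_sym; apply: contra_neq a0; exact: rnorm_eq0.
  have := le a^-1 (map_mx ( *:%R a) F).
  have -> : map_mx ( *:%R a^-1) (map_mx ( *:%R a) F) = F.
    by apply/matrixP => i j; rewrite !mxE scalerA mulVf// scale1r.
  have -> : rnorm a^-1 = (rnorm a)^-1.
    by apply: (mulfI (lt0r_neq0 ra)); rewrite -rnormM !mulfV ?rnorm1// gt_eqF.
  by rewrite ler_pdivlMl.
- apply/matrixP => i j; rewrite mxE; apply: val_inj; apply/funext => v.
  apply: rnorm_eq0; apply/eqP; rewrite eq_le rnorm_ge0 andbT.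
  have [w w1 wE] := rnorm_rot (F i j v : C).
  rewrite -[rnorm _]reR -wE -(clinearZ (dual_clinear _)).
  have := dual_norms_map_le F (const_mx (w *: v) : 'M[V]_1); rewrite F0 mul0r.
  apply: le_trans.
  have := entry_le_mx_norms (map_mx (mxev F) (const_mx (w *: v) : 'M[V]_1)) 0 0 i j.
  by rewrite !mxE.
Qed.

End dual_norms.

(** * States on the bidual and the first inequality between the indices *)

Section bidual.
Variable R : realType.
Local Notation C := R[i].
Variables (V : lmodType C) (nV : matrix_norms V) (hV : matricially_normed nV).
Local Notation D := (dual nV).
Local Notation DD := (dual (dual_norms nV)).

(** The second adjoint of the map [mxev F]; through it states of V extend to states of the
    bidual. *)
Definition bidual_map n (F : 'M[D]_n) (Y : DD) : 'M[C]_n :=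
  \matrix_(p, q) (Y (F p q) : C).

Lemma bidual_map_linear n (F : 'M[D]_n) : linear (bidual_map F).
Proof. by move=> a X Y; apply/matrixP => p q; rewrite !mxE. Qed.

Lemma bidual_map_flip n (F : 'M[D]_n) r (Y : 'M[DD]_r) :
  map_mx (bidual_map F) Y = flip_mx (map_mx (mxev Y) F).
Proof. by apply/matrixP => i j; apply/matrixP => p q; rewrite !mxE. Qed.

Lemma bidual_map_state u n (S : 'M[D]_n) : dual_state u S ->
  exists2 phi : {linear DD -> 'M[C]_n},
    mstates (dual_norms (dual_norms nV)) (bidual_embed hV u) phi &
    forall Y, phi Y = bidual_map S Y.
Proof.
move=> [cS Su].
pose lphi := GRing.isLinear.Build C DD 'M[C]_n _ (bidual_map S) (bidual_map_linear S).
pose phi : {linear DD -> 'M[C]_n} := HB.pack (bidual_map S) lphi.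
exists phi => //; split; last by rewrite -Su; apply/matrixP => p q; rewrite !mxE.
apply/completely_contractiveP => r Y Y1.
have -> : map_mx phi Y = flip_mx (map_mx (mxev Y) S) by exact: bidual_map_flip.
apply: le_trans (mx_norms_flip _) _.
have hD := dual_norms_matricially_normed hV.
apply: le_trans (dual_norms_map_le hD Y S) _.
have S1 := (dual_norms_ball hV S).2 cS.
have [S0 _ _] := dual_normsP hV S.
have [Y0 _ _] := dual_normsP hD Y.
by rewrite -[leRHS]mulr1; exact: (ler_pM Y0 S0 Y1 S1).
Qed.

Lemma embed_map_flip n (F : 'M[D]_n) r (x : 'M[V]_r) :
  map_mx (mxev (map_mx (bidual_embed hV) x)) F = flip_mx (map_mx (mxev F) x).
Proof. by apply/matrixP => i j; apply/matrixP => p q; rewrite !mxE. Qed.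

Lemma dual_norms_embed_le r (x : 'M[V]_r) :
  dual_norms (dual_norms nV) (map_mx (bidual_embed hV) x) <= nV x.
Proof.
have hD := dual_norms_matricially_normed hV.
have [_ _ h] := dual_normsP hD (map_mx (bidual_embed hV) x).
have x0 := matrix_norms_ge0 hV x.
apply: (h _ x0) => n F F1; rewrite embed_map_flip.
apply: le_trans (mx_norms_flip _) _; apply: le_trans (dual_norms_map_le hV F x) _.
by rewrite -[leRHS]mul1r; exact: (ler_wpM2r x0 F1).
Qed.

Variable u : V.

Lemma ugamma_ub k (x : 'M[V]_k) n (S : 'M[D]_n.+1) : dual_state u S ->
  ((mx_norms (map_mx (mxev S) x))%:E <= ugamma nV u x)%E.
Proof.
move=> /dual_state_linear[phi sphi phiE]; apply: ereal_sup_ubound.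
exists n, phi; split; first exact: sphi.
have -> : map_mx (mxev S) x = map_mx phi x; last exact: erefl.
by apply/matrixP => i j; rewrite [LHS]mxE [RHS]mxE phiE.
Qed.

Lemma ugamma_le k (x : 'M[V]_k) (c : \bar R) :
  (forall n (S : 'M[D]_n.+1), dual_state u S ->
    ((mx_norms (map_mx (mxev S) x))%:E <= c)%E) -> (ugamma nV u x <= c)%E.
Proof.
move=> h; apply: ge_ereal_sup => _ [n [phi [sphi ->]]].
have [S sS SE] := linear_dual_state hV sphi.
have -> : map_mx phi x = map_mx (mxev S) x.
  by apply/matrixP => i j; rewrite [LHS]mxE [RHS]mxE SE.
exact: h.
Qed.

(** The infimum over the unit sphere in homogeneous form. The state [S0] makes [c] nonnegative,
    which settles the case of norm 0. *)
Lemma n_cb_le_states n0 (S0 : 'M[D]_n0.+1) (T : R) k (x : 'M[V]_k) c :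
  dual_state u S0 -> T%:E = n_cb nV u -> 0 < T ->
  (forall n (S : 'M[D]_n.+1), dual_state u S -> mx_norms (map_mx (mxev S) x) <= c) ->
  T * nV x <= c.
Proof.
move=> sS0 TE T0 hc.
have [x0|x0] := eqVneq (nV x) 0.
  by rewrite x0 mulr0; exact: (le_trans (mx_norms_ge0 _) (hc _ _ sS0)).
have xp : 0 < nV x by rewrite lt_neqAle eq_sym x0 matrix_norms_ge0.
have xi : 0 < (nV x)^-1 by rewrite invr_gt0.
rewrite -ler_pdivlMr// -lee_fin TE; apply: (@le_trans _ _
  (ugamma nV u (map_mx ( *:%R (nV x)^-1%:C) x))).
  apply: ereal_inf_lbound; exists k, (map_mx ( *:%R (nV x)^-1%:C) x); split=> //.
  by rewrite matrix_normsZ// rnormR gtr0_norm// mulVf.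
apply: ugamma_le => n S sS; rewrite lee_fin.
have -> : map_mx (mxev S) (map_mx ( *:%R (nV x)^-1%:C) x) =
    map_mx ( *:%R (nV x)^-1%:C) (map_mx (mxev S) x).
  apply/matrixP => i j; rewrite [LHS]mxE [X in mxev S X]mxE [RHS]mxE [in RHS]mxE.
  apply/matrixP => a b; rewrite [LHS]mxE [RHS]mxE [in RHS]mxE.
  exact: (clinearZ (dual_clinear _)).
by rewrite mx_normsZ// mulrC ler_pM2r// hc.
Qed.

Hypothesis u1 : vnorm nV u = 1.

Lemma n_cb_le_ugamma_unit : (n_cb nV u <= ugamma nV u (const_mx u : 'M[V]_1))%E.
Proof. by apply: ereal_inf_lbound; exists 1%N, (const_mx u). Qed.

(** Each [ugamma] is then a supremum over the empty set. *)
Lemma n_cb_no_states : ~ (exists n (S : 'M[D]_n.+1), dual_state u S) ->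
  n_cb nV u = -oo%E.
Proof.
move=> nS; apply/eqP; rewrite -leeNy_eq; apply: le_trans n_cb_le_ugamma_unit _.
by apply: ugamma_le => n S sS; exfalso; apply: nS; exists n, S.
Qed.

Lemma n_cb_gt0_real : (0 < n_cb nV u)%E -> exists2 T : R, 0 < T & T%:E = n_cb nV u.
Proof.
move=> t0; have t1 : (n_cb nV u <= 1%:E)%E.
  apply: le_trans n_cb_le_ugamma_unit _; apply: ugamma_le => n S [cS _].
  by rewrite lee_fin -[X in _ <= X]u1; exact: map_mx_state_le.
have TE : (fine (n_cb nV u))%:E = n_cb nV u.
  by rewrite fineK// ge0_fin_numE ?(ltW t0)// (le_lt_trans t1)// ltry.
by exists (fine (n_cb nV u)) => //; rewrite -lte_fin TE.
Qed.

(** The norm of [X] is a supremum of pairings of [X] with functionals on [M_k(V)] of norm at most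
    one. Such a functional is dominated by [T^-1] times the supremum over states, so
    [functional_le_states] applies with [K = T^-1]. *)
Lemma n_cb_le_bidual :
  (n_cb nV u <= n_cb (dual_norms (dual_norms nV)) (bidual_embed hV u))%E.
Proof.
apply: le_ereal_inf_tmp => _ [k [X [X1 ->]]].
have [[n0 [S0 sS0]]|nS] := pselect (exists n (S : 'M[D]_n.+1), dual_state u S); last first.
  by rewrite n_cb_no_states//; exact: leNye.
have gX n (S : 'M[D]_n.+1) : dual_state u S ->
    ((mx_norms (\matrix_(i, j) map_mx (X i j) S))%:E <=
     ugamma (dual_norms (dual_norms nV)) (bidual_embed hV u) X)%E.
  move=> /bidual_map_state[phi sphi phiE]; apply: ereal_sup_ubound.
  exists n, phi; split; first exact: sphi.
  have -> : \matrix_(i, j) map_mx (X i j) S = map_mx phi X; last exact: erefl.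
  apply/matrixP => i j; rewrite [LHS]mxE [RHS]mxE phiE.
  by apply/matrixP => p q; rewrite [LHS]mxE [RHS]mxE.
set G := ugamma _ _ X in gX *.
have G0 : (0 <= G)%E.
  by apply: le_trans (gX _ _ sS0); rewrite lee_fin; exact: mx_norms_ge0.
have [t0|t0] := leP (n_cb nV u) 0%E; first exact: le_trans t0 G0.
have [T T0 TE] := n_cb_gt0_real t0.
rewrite -TE; clearbody G; case: G gX G0 => [g gX G0|_ _|_]; last 2 first.
- exact: leey.
- by rewrite leeNy_eq.
rewrite lee_fin.
have hD := dual_norms_matricially_normed hV.
have [_ _ hX] := dual_normsP hD X.
have g0 : 0 <= g by rewrite -lee_fin.
have Ti : 0 <= T^-1 by rewrite invr_ge0 ltW.
suff : dual_norms (dual_norms nV) X <= T^-1 * g.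
  by rewrite X1 ler_pdivlMl// mulr1.
apply: (hX _ (mulr_ge0 Ti g0)) => n F F1.
apply: mx_norms_le => c d cd.
(* The vectors testing the norm of [X(F)] are absorbed into the functional: its value at [X] is the
   tested sum, and its value at [x] is [F(x)] tested at the flipped vectors. *)
pose f : 'M[D]_k := bimulmx (colmx_conj d) F (rowmx_of c).
have -> : \sum_p \sum_q dotc (map_mx (mxev X) F p q *m c q) (d p) =
    \sum_i \sum_j (X i j (f i j) : C).
  transitivity (\sum_p \sum_q dotc (mxev X (F p q) *m c q) (d p)).
    by apply: eq_bigr => p _; apply: eq_bigr => q _; rewrite mxE.
  rewrite -pairing_bimulmx; last exact: mxev_entries_linear.
  by apply: eq_bigr => i _; apply: eq_bigr => j _; rewrite mxE.
apply: (functional_le_states hV sS0 Ti _ (fun i j => dual_clinear (X i j))).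
- move=> x c0 hc0.
  have fE i j v : f i j v = dotc (mxev F v *m flip_vec c j) (flip_vec d i) :> C.
    transitivity (mxev f v i j); first by rewrite [RHS]mxE.
    rewrite mxev_bimulmx -mulmxA mxE [RHS](_ : _ = \sum_p (mxev F v *m flip_vec c j) p 0 *
      Num.conj (flip_vec d i p 0))//.
    apply: eq_bigr => p _; rewrite [LHS]mulrC; congr (_ * _); last by rewrite !mxE.
    by rewrite mxE [RHS]mxE; apply: eq_bigr => q _; rewrite !mxE.
  have -> : \sum_i \sum_j (f i j (x i j) : C) =
      \sum_i \sum_j dotc (map_mx (mxev F) x i j *m flip_vec c j) (flip_vec d i).
    by apply: eq_bigr => i _; apply: eq_bigr => j _; rewrite fE [in RHS]mxE.
  apply: le_trans (mx_norms_re _ _ _) _.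
  rewrite !flip_vec_norm ler_pdivlMl//.
  have h1 : mx_norms (map_mx (mxev F) x) <= nV x.
    apply: map_mx_state_le => //; exact: (dual_norms_ball hV F).1.
  have h2 := n_cb_le_states sS0 TE T0 hc0.
  apply: le_trans h2; rewrite ler_pM2l//; apply: le_trans h1.
  by rewrite ler_piMr ?mx_norms_ge0//; lra.
- by move=> m S sS; rewrite -lee_fin; exact: gX.
Qed.

End bidual.

(** * The Effros-Ruan lemma *)

Section inf_of_functionals.
Variables (R : realType) (E : lmodType R) (T : Type) (A : set T) (q : T -> E -> R).
Hypothesis A0 : exists t, A t.
Hypothesis bq : forall x, exists M, forall t, A t -> M <= q t x.
Hypothesis qD : forall s t, A s -> A t -> exists2 w, A w &
  forall x y, q w (x + y) <= q s x + q t y.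
Hypothesis qZ : forall s t, 0 < s -> A t -> exists2 w, A w &
  forall x, q w (s *: x) <= s * q t x.

(** An infimum is sublinear here because the family is stable under sums and dilations up to
    domination, as [qD] and [qZ] express. *)
Definition inf_functional (x : E) : R := inf [set q t x | t in A].

Lemma inf_functional_lb t x : A t -> inf_functional x <= q t x.
Proof.
move=> At; apply: ge_inf; last by exists t.
by have [M hM] := bq x; exists M => _ [j Aj <-]; exact: hM.
Qed.

Lemma inf_functional_ge x c : (forall t, A t -> c <= q t x) -> c <= inf_functional x.
Proof.
move=> h; apply: lb_le_inf; last by move=> _ [i Ai <-]; exact: h.
by have [i Ai] := A0; exists (q i x); exists i.
Qed.

Lemma inf_functionalD x y : inf_functional (x + y) <= inf_functional x + inf_functional y.
Proof.
rewrite -lerBlDr; apply: inf_functional_ge => s As.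
rewrite lerBlDr -lerBlDl; apply: inf_functional_ge => t At.
rewrite lerBlDl; have [w Aw hw] := qD As At.
by rewrite (le_trans (inf_functional_lb _ Aw)).
Qed.

Lemma inf_functionalZ s x : 0 < s -> inf_functional (s *: x) = s * inf_functional x.
Proof.
have le t y : 0 < t -> inf_functional (t *: y) <= t * inf_functional y.
  move=> t0; rewrite -ler_pdivrMl//; apply: inf_functional_ge => i Ai.
  rewrite ler_pdivrMl//; have [w Aw hw] := qZ t0 Ai.
  by rewrite (le_trans (inf_functional_lb _ Aw)).
move=> s0; apply/eqP; rewrite eq_le le//= -ler_pdivlMl//.
have := le s^-1 (s *: x); rewrite invr_gt0 scalerA mulVf ?gt_eqF// scale1r.
by apply.
Qed.

End inf_of_functionals.

(** * The support function of the numerical range *)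

Section numerical_radius.
Variables (R : realType) (k : nat).
Local Notation C := R[i].

(* Clipped at [0], since [x = 0] is allowed. *)
Definition numrange_sup (a : rmx (C^o : lmodType C) k) : R :=
  sup_functional [set x : 'cV[C]_k | euclid x <= 1]
    (fun x (a : rmx (C^o : lmodType C) k) => re (dotc ((a : 'M[C]_k) *m x) x)) a.

Let lin (x : 'cV[C]_k) (s : R) (a b : rmx (C^o : lmodType C) k) :
  [set x : 'cV[C]_k | euclid x <= 1] x ->
  re (dotc (((s *: a + b : rmx _ _) : 'M[C]_k) *m x) x) =
  s * re (dotc ((a : 'M[C]_k) *m x) x) + re (dotc ((b : 'M[C]_k) *m x) x).
Proof.
move=> _; rewrite mulmxDl (ipDl (dotcP _ _)) reD rmxZ.
have -> : map_mx ( *:%R s%:C) a = s%:C *: (a : 'M[C]_k).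
  by apply/matrixP => i j; rewrite !mxE.
by rewrite -scalemxAl (ipZl (dotcP _ _)) reZ.
Qed.

Let bd (a : rmx (C^o : lmodType C) k) : exists M, forall x : 'cV[C]_k,
  [set x : 'cV[C]_k | euclid x <= 1] x -> re (dotc ((a : 'M[C]_k) *m x) x) <= M.
Proof.
exists (mxopnorm (a : 'M[C]_k)) => x /= x1.
apply: le_trans (ip_cs (dotcP _ _) _ _) _.
have h := mxopnormP (a : 'M[C]_k) x.
have x0 := ip_ge0 (dotcP R k) x; have a0 := mxopnorm_ge0 (a : 'M[C]_k).
apply: (@le_trans _ _ (euclid ((a : 'M[C]_k) *m x))).
  by rewrite ler_piMr// (ip_ge0 (dotcP _ _)).
by apply: le_trans h _; rewrite ler_piMr.
Qed.

Let ne : exists x : 'cV[C]_k, [set x : 'cV[C]_k | euclid x <= 1] x.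
Proof. by exists 0; rewrite /= (ip0_norm (dotcP _ _)). Qed.

Lemma numrange_supD a b : numrange_sup (a + b) <= numrange_sup a + numrange_sup b.
Proof. exact: (sup_functionalD lin bd ne). Qed.

Lemma numrange_supZ s a : 0 < s -> numrange_sup (s *: a) = s * numrange_sup a.
Proof. exact: (sup_functionalZ lin bd ne). Qed.

Lemma numrange_sup_le a c : (forall x, euclid x <= 1 ->
  re (dotc ((a : 'M[C]_k) *m x) x) <= c) -> numrange_sup a <= c.
Proof. by move=> h; exact: (sup_functional_le ne h). Qed.

Lemma numrange_sup_ge0 a : 0 <= numrange_sup a.
Proof.
have z0 : [set x : 'cV[C]_k | euclid x <= 1] 0 by rewrite /= (ip0_norm (dotcP _ _)).
apply: le_trans (sup_functional_ub bd a z0).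
by rewrite (ip0r (dotcP _ _)).
Qed.

Lemma numrange_supP (a : 'M[C]_k) x :
  re (dotc (a *m x) x) <= numrange_sup a * euclid x ^+ 2.
Proof.
have [x0|x0] := eqVneq (euclid x) 0.
  by rewrite x0 expr0n mulr0 -reJ -(ipC (dotcP _ _)) (ip_norm0_re (dotcP _ _) _ x0).
have xp : 0 < euclid x by rewrite lt_neqAle eq_sym x0 (ip_ge0 (dotcP _ _)).
have xi : 0 < (euclid x)^-1 by rewrite invr_gt0.
have := @sup_functional_ub _ _ _ _ _ bd ((euclid x)^-1%:C *: x) a.
rewrite /= (ipZ_norm (dotcP _ _)) rnormR gtr0_norm// mulVf// => /(_ (lexx _)).
rewrite -scalemxAr (ipZl (dotcP _ _)) (ipZr (dotcP _ _)) conjR !reZ mulrA -invfM.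
by rewrite -expr2 mulrC ler_pdivrMr// exprn_gt0.
Qed.

(** [|A x|^2] is the quadratic form of the product of the adjoint with [A]. The adjoint obeys the
    same bound, since moving it across the inner product gives [A] back. *)
Lemma mxopnorm_le_numrange m (A : 'M[C]_(m, k)) :
  mxopnorm A <= Num.sqrt (numrange_sup (A^t* *m A)) /\
  mxopnorm (A^t*) <= Num.sqrt (numrange_sup (A^t* *m A)).
Proof.
set s := Num.sqrt _; have s0 : 0 <= s by exact: sqrtr_ge0.
have As x : euclid (A *m x) <= s * euclid x.
  rewrite -(ler_pXn2r (n := 2))// ?nnegrE ?mulr_ge0 ?(ip_ge0 (dotcP _ _))//.
  rewrite exprMn (sqr_sqrtr (numrange_sup_ge0 (A^t* *m A))) -[X in X <= _]reR -(ipxx (dotcP _ _)).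
  rewrite dotc_adj -[X in re X]conjCK reJ -(ipC (dotcP _ _)) mulmxA.
  exact: numrange_supP.
have half (v : 'cV[C]_k) (w : 'cV[C]_m) : euclid v ^+ 2 + euclid w ^+ 2 <= 2 ->
    euclid (A *m v) * euclid w <= s.
  move=> vw; apply: (@le_trans _ _ (s * euclid v * euclid w)).
    by rewrite ler_wpM2r ?(ip_ge0 (dotcP _ _)).
  rewrite -mulrA ler_piMr//.
  have := sqr_ge0 (euclid v - euclid w); rewrite sqrrB; lra.
split; apply: (opnorm_le (dotcP _ _) (dotcP _ _)) => v w vw.
  by apply: le_trans (ip_cs (dotcP _ _) _ _) _; exact: half.
rewrite dotc_adj trmxCK; apply: le_trans (ip_cs (dotcP _ _) _ _) _.
by rewrite mulrC; apply: half; rewrite addrC.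
Qed.

End numerical_radius.

Section norming_functional.
Variable R : realType.
Local Notation C := R[i].
Variables (V : lmodType C) (nV : matrix_norms V) (hV : matricially_normed nV).

Lemma norming_functional k (x0 : 'M[V]_k) : nV x0 = 1 ->
  exists L : rmx V k -> R, [/\ forall s x y, L (s *: x + y) = s * L x + L y,
    forall x, L x <= nV x & L x0 = 1].
Proof.
move=> x01.
have nZ s (x : rmx V k) : nV (s *: x : rmx V k) = `|s| * nV x.
  by rewrite rmxZ matrix_normsZ// rnormR.
have inj s t : s *: (x0 : rmx V k) = t *: (x0 : rmx V k) -> s = t.
  move=> st; apply/eqP; rewrite -subr_eq0 -normr_eq0.
  have := nZ (s - t) x0; rewrite x01 mulr1 => <-.
  by rewrite scalerBl st subrr matrix_norms0.
pose f (x : rmx V k) : R := xget 0 [set s | x = s *: (x0 : rmx V k)].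
have fE s : f (s *: (x0 : rmx V k)) = s.
  by apply: inj; rewrite -[LHS](@xgetPex _ 0 [set t | _ = t *: (x0 : rmx V k)])//; exists s.
have [|s x s0|||||L [lL LP Lf]] := @hahn_banach _ (rmx V k) (fun x => nV x) _ _
    [set x | exists s, x = s *: (x0 : rmx V k)] f.
- exact: matrix_normsD.
- by rewrite nZ gtr0_norm.
- by exists 0; rewrite scale0r.
- by move=> s _ _ [a ->] [b ->]; exists (s * a + b); rewrite scalerA scalerDl.
- by move=> s _ _ [a ->] [b ->]; rewrite scalerA -scalerDl !fE.
- by move=> _ [a ->]; rewrite fE nZ x01 mulr1 ler_norm.
exists L; split=> //.
have -> : x0 = 1 *: (x0 : rmx V k) by rewrite scale1r.
by rewrite Lf ?fE//; exists 1.
Qed.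

End norming_functional.

Opaque numrange_sup.

(** * Sandwiches and the direct sum axiom *)

Section sandwiches.
Variable R : realType.
Local Notation C := R[i].
Variables (V : lmodType C) (nV : matrix_norms V) (hO : operator_space nV).
Let hV : matricially_normed nV := proj1 hO.
Variable k : nat.

Record sandwich := Sandwich { sw_dim : nat; sw_l : 'M[C]_(k, sw_dim);
  sw_x : 'M[V]_sw_dim; sw_r : 'M[C]_(sw_dim, k) }.

Definition sw_val (t : sandwich) : rmx V k := bimulmx (sw_l t) (sw_x t) (sw_r t).

Definition sw_ball : set sandwich := [set t | nV (sw_x t) <= 1].

Variable L : rmx V k -> R.
Hypothesis lL : forall s x y, L (s *: x + y) = s * L x + L y.
Hypothesis L_le : forall x, L x <= nV x.

Local Notation rM := (rmx (C^o : lmodType C) k).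

(** Chosen so that the first two terms vanish when [ab] consists of the negatives of the two Gram
    matrices of the sandwich. A linear [(p, q)] below the infimum, evaluated there, bounds [2 L] at
    the sandwich by [p] and [q] of these matrices. *)
Definition sw_fun (t : sandwich) (ab : (rM * rM)%type) : R :=
  numrange_sup (ab.1 + (sw_l t *m (sw_l t)^t* : 'M[C]_k)) +
  numrange_sup (ab.2 + ((sw_r t)^t* *m sw_r t : 'M[C]_k)) - 2 * L (sw_val t).

(** Contractivity of [L] gives the product of the norms of the two outer factors, and the
    arithmetic-geometric mean gives the sum. This makes the infimum of the [sw_fun] nonnegative at
    0. *)
Lemma sw_val_le t : sw_ball t ->
  2 * L (sw_val t) <= numrange_sup (sw_l t *m (sw_l t)^t* : 'M[C]_k) +
    numrange_sup ((sw_r t)^t* *m sw_r t : 'M[C]_k).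
Proof.
move=> t1; have hx0 := matrix_norms_ge0 hV (sw_x t).
have [hr _] := mxopnorm_le_numrange (sw_r t).
have [_ hl] := mxopnorm_le_numrange ((sw_l t)^t*).
rewrite trmxCK in hl.
have r0 := mxopnorm_ge0 (sw_r t); have l0 := mxopnorm_ge0 (sw_l t).
have h : L (sw_val t) <= mxopnorm (sw_l t) * mxopnorm (sw_r t).
  apply: le_trans (L_le _) _; have [_ _ _ hM] := hV.
  apply: le_trans (hM _ _ _ _ _) _; rewrite ler_wpM2r// ler_piMr//.
set a := numrange_sup _ in hl *; set b := numrange_sup _ in hr *.
have a0 : 0 <= a by exact: numrange_sup_ge0.
have b0 : 0 <= b by exact: numrange_sup_ge0.
clearbody a b.
have := sqr_ge0 (Num.sqrt a - Num.sqrt b); rewrite sqrrB (sqr_sqrtr a0) (sqr_sqrtr b0).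
have hlr := ler_pM l0 r0 hl hr.
lra.
Qed.

Lemma sw_fun_bounded ab : exists M, forall t, sw_ball t -> M <= sw_fun t ab.
Proof.
have arith (a b c d e f m : R) : c <= e + a -> d <= f + b -> m <= c + d ->
  - a - b <= e + f - m by lra.
exists (- numrange_sup (- ab.1) - numrange_sup (- ab.2)) => t t1.
have split_le (a b : rM) : numrange_sup b <= numrange_sup (a + b) + numrange_sup (- a).
  by rewrite (le_trans _ (numrange_supD _ _))// addrAC subrr add0r.
have h1 := split_le ab.1 (sw_l t *m (sw_l t)^t* : 'M[C]_k).
have h2 := split_le ab.2 ((sw_r t)^t* *m sw_r t : 'M[C]_k).
have h3 := sw_val_le t1; rewrite /sw_fun.
exact: (arith _ _ _ _ _ _ _ h1 h2 h3).
Qed.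

Lemma bimulmx_block m1 m2 (l1 : 'M[C]_(k, m1)) (l2 : 'M[C]_(k, m2)) (x : 'M[V]_m1)
    (y : 'M[V]_m2) (r1 : 'M[C]_(m1, k)) (r2 : 'M[C]_(m2, k)) :
  bimulmx (row_mx l1 l2) (block_mx x 0 0 y) (col_mx r1 r2) =
  bimulmx l1 x r1 + bimulmx l2 y r2.
Proof.
apply/matrixP => i j; rewrite !mxE big_split_ord/=; congr (_ + _).
- apply: eq_bigr => a _; rewrite big_split_ord/= [X in _ + X]big1 ?addr0.
    by apply: eq_bigr => b _; rewrite row_mxEl col_mxEu block_mxEul.
  by move=> b _; rewrite block_mxEur [X in _ *: X]mxE scaler0.
- apply: eq_bigr => a _; rewrite big_split_ord/= [X in X + _]big1 ?add0r.
    by apply: eq_bigr => b _; rewrite row_mxEr col_mxEd block_mxEdr.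
  by move=> b _; rewrite block_mxEdl [X in _ *: X]mxE scaler0.
Qed.

(** Placing the outer factors side by side adds both the sandwiches and their Gram matrices, and the
    direct sum axiom keeps the middle factor in the unit ball. *)
Lemma sw_funD s t : sw_ball s -> sw_ball t -> exists2 w, sw_ball w &
  forall x y, sw_fun w (x + y) <= sw_fun s x + sw_fun t y.
Proof.
move=> s1 t1.
have arith (a b c a' b' c' a2 b2 : R) : a <= a' + a2 -> b <= b' + b2 ->
  a + b - 2 * (c + c') <= (a' + b' - 2 * c) + (a2 + b2 - 2 * c') by lra.
exists (Sandwich (row_mx (sw_l s) (sw_l t)) (block_mx (sw_x s) 0 0 (sw_x t))
  (col_mx (sw_r s) (sw_r t))).
  by rewrite /sw_ball/= (proj2 hO) ge_max; apply/andP.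
move=> x y; rewrite /sw_fun /sw_val/= bimulmx_block (real_linearD lL).
rewrite tr_row_mx map_col_mx mul_row_col tr_col_mx map_row_mx mul_row_col.
have h1 := numrange_supD (x.1 + (sw_l s *m (sw_l s)^t* : 'M[C]_k))
  (y.1 + (sw_l t *m (sw_l t)^t* : 'M[C]_k)).
have h2 := numrange_supD (x.2 + ((sw_r s)^t* *m sw_r s : 'M[C]_k))
  (y.2 + ((sw_r t)^t* *m sw_r t : 'M[C]_k)).
rewrite addrACA in h1; rewrite addrACA in h2.
exact: (arith _ _ _ _ _ _ _ _ h1 h2).
Qed.

Lemma sw_funZ s t : 0 < s -> sw_ball t -> exists2 w, sw_ball w &
  forall x, sw_fun w (s *: x) <= s * sw_fun t x.
Proof.
(* The value and both Gram matrices are quadratic in the outer factors, hence the square root. *)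
move=> s0 t1; pose c : C := (Num.sqrt s)%:C.
have cc : c * c = s%:C by rewrite -rmorphM/= -expr2 sqr_sqrtr ?ltW.
have cJ : Num.conj c = c by exact: conjR.
exists (Sandwich (c *: sw_l t) (sw_x t) (c *: sw_r t)); first exact: t1.
have adjZ m n (A : 'M[C]_(m, n)) : (c *: A)^t* = c *: A^t*.
  by apply/matrixP => i j; rewrite !mxE rmorphM/= cJ.
have sE (A : 'M[C]_k) : s%:C *: A = s *: (A : rM) :> 'M[C]_k.
  by apply/matrixP => i j; rewrite !mxE.
have lE (A : 'M[C]_k) : c *: (c *: A) = s *: (A : rM) :> 'M[C]_k.
  by rewrite scalerA cc sE.
have e1 (a : rM) (A : 'M[C]_k) :
    numrange_sup (s *: a + (c *: (c *: A) : 'M[C]_k)) = s * numrange_sup (a + (A : rM)).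
  by rewrite lE -scalerDr numrange_supZ.
case=> a b; rewrite le_eqVlt; apply/orP; left; apply/eqP.
rewrite [RHS]mulrBr mulrDr; congr (_ + _ - _).
- rewrite -e1; congr (numrange_sup (_ + _)).
  by rewrite adjZ -scalemxAl -scalemxAr.
- rewrite -e1; congr (numrange_sup (_ + _)).
  by rewrite adjZ -scalemxAl -scalemxAr.
- rewrite [RHS]mulrCA; congr (_ * _); rewrite -(real_linearZ lL); congr L.
  apply/matrixP => i j; rewrite rmxZ !mxE scaler_sumr; apply: eq_bigr => l _.
  rewrite scaler_sumr; apply: eq_bigr => r _.
  by rewrite scalerA !mxE mulrACA cc mulrA.
Qed.

Lemma numrange_sup0 : numrange_sup (0 : rM) = 0.
Proof.
have := numrange_supZ (0 : rM) (@ltr0n R 2); rewrite scaler0 => h.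
have : (2 : R) != 1 by rewrite (eqr_nat _ 2 1).
move: h; lra.
Qed.

(* The direct sum axiom makes [sw_fun] stable under sums, so that its infimum is
   sublinear; [p] and [q] come from a linear functional below that infimum. *)
Lemma factorizing_states : exists p q : rM -> R,
  [/\ forall s x y, p (s *: x + y) = s * p x + p y,
      forall s x y, q (s *: x + y) = s * q x + q y,
      forall t, sw_ball t -> 2 * L (sw_val t) <=
        p (sw_l t *m (sw_l t)^t* : 'M[C]_k) + q ((sw_r t)^t* *m sw_r t : 'M[C]_k) &
      p (1%:M : 'M[C]_k) + q (1%:M : 'M[C]_k) <= 2].
Proof.
(* The sandwich of inner size 0 leaves only the two support functions; at [(1, 1)] it gives the
   bound 2. *)
pose t0 := Sandwich (0 : 'M[C]_(k, 0)) (0 : 'M[V]_0) (0 : 'M[C]_(0, k)).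
have t01 : sw_ball t0 by rewrite /sw_ball/= matrix_norms0.
have ne : exists t, sw_ball t by exists t0.
have [|s x s0|||||f [lf fP _]] := @hahn_banach _ (rM * rM)%type
    (inf_functional sw_ball sw_fun) _ _ [set 0] (fun=> 0).
- exact: (inf_functionalD ne sw_fun_bounded sw_funD).
- exact: (inf_functionalZ ne sw_fun_bounded sw_funZ).
- by [].
- by move=> s _ _ -> ->; rewrite scaler0 addr0.
- by move=> s x y _ _; rewrite mulr0 addr0.
- move=> _ ->; apply: (inf_functional_ge ne) => t t1.
  by rewrite /sw_fun/= !add0r subr_ge0 sw_val_le.
have fle t ab : sw_ball t -> f ab <= sw_fun t ab.
  by move=> t1; apply: le_trans (fP _) _; exact: (inf_functional_lb sw_fun_bounded).
exists (fun a => f (a, 0)), (fun b => f (0, b)); split.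
- by move=> s x y; rewrite -lf; congr f; congr pair; rewrite /= scaler0 addr0.
- by move=> s x y; rewrite -lf; congr f; congr pair; rewrite /= scaler0 addr0.
- move=> t t1; rewrite -(real_linearD lf) -lerN2 -(real_linearN lf).
  apply: le_trans (fle _ _ t1) _.
  by rewrite /sw_fun/= addr0 add0r !addNr numrange_sup0 !add0r.
- rewrite -(real_linearD lf); apply: le_trans (fle t0 _ t01) _.
  rewrite /sw_fun /sw_val /t0/= mul0mx mulmx0 !addr0 add0r.
  have -> : bimulmx (0 : 'M[C]_(k, 0)) (0 : 'M[V]_0) (0 : 'M[C]_(0, k)) = 0.
    by apply/matrixP => i j; rewrite !mxE big_ord0.
  rewrite (real_linear0 lL) mulr0 subr0.
  have n1 : numrange_sup (1%:M : 'M[C]_k) <= 1.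
    apply: numrange_sup_le => x x1; rewrite mul1mx (ipxx (dotcP _ _)) reR.
    by rewrite expr_le1// (ip_ge0 (dotcP _ _)).
  lra.
Qed.

End sandwiches.

(** * Norming functionals as complete contractions *)

Section effros_ruan.
Variable R : realType.
Local Notation C := R[i].

Lemma colmx_conj_adj n r (d : 'I_r -> 'cV[C]_n) : (colmx_conj d)^t* = rowmx_of d.
Proof. by apply/matrixP => i j; rewrite !mxE conjCK. Qed.

Lemma rowmx_of_adj n r (d : 'I_r -> 'cV[C]_n) : (rowmx_of d)^t* = colmx_conj d.
Proof. by apply/matrixP => i j; rewrite !mxE. Qed.

(** [p] is the real part of a pairing with a matrix of functionals on the scalars; such functionals
    are given by their values at 1, which form [G]. A Gram matrix is the identity sandwiched between
    its factors. *)
Lemma real_functional_gram k (p : rmx (C^o : lmodType C) k -> R) :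
  (forall s x y, p (s *: x + y) = s * p x + p y) ->
  exists G : 'M[C]_k, forall r (d : 'I_r -> 'cV[C]_k),
    p (colmx_conj d *m rowmx_of d : 'M[C]_k) = \sum_i re (dotc (G *m d i) (d i)).
Proof.
move=> lp; have [lB BE] := mxfunctionalP lp.
set B := mxfunctional _ in lB BE.
have B0 : B 0 = 0 by apply/matrixP => a b; rewrite (clinear0 (lB a b)) mxE.
exists (B (1 : C)) => r d; rewrite -re_sum.
pose y : 'M[C^o]_r := (1%:M : 'M[C]_r).
have -> : (colmx_conj d *m rowmx_of d : 'M[C]_k) =
    bimulmx (colmx_conj d) y (rowmx_of d) :> 'M[C^o]_k.
  apply/matrixP => a b; rewrite [LHS]mxE [RHS]mxE; apply: eq_bigr => i _.
  rewrite (bigD1 i)//= [X in _ + X]big1 ?addr0 => [|j ji].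
    by rewrite [y i i]mxE eqxx; exact: esym (mulr1 _).
  by rewrite [y i j]mxE eq_sym (negbTE ji) scaler0.
rewrite -BE pairing_bimulmx//; congr re; apply: eq_bigr => i _.
rewrite (bigD1 i)//= [X in _ + X]big1 ?addr0 => [|j ji].
  by rewrite [y i i]mxE eqxx.
by rewrite [y i j]mxE eq_sym (negbTE ji) B0 mul0mx (ip0l (dotcP _ _)).
Qed.

Lemma colmx_conj_delta k :
  colmx_conj (fun i : 'I_k => delta_mx i 0 : 'cV[C]_k) *m
    rowmx_of (fun i : 'I_k => delta_mx i 0 : 'cV[C]_k) = 1%:M.
Proof.
have e1 : colmx_conj (fun i : 'I_k => delta_mx i 0 : 'cV[C]_k) = 1%:M.
  by apply/matrixP => i j; rewrite !mxE eqxx andbT; case: eqP => _; rewrite ?rmorph1 ?rmorph0.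
have e2 : rowmx_of (fun i : 'I_k => delta_mx i 0 : 'cV[C]_k) = 1%:M.
  by apply/matrixP => i j; rewrite !mxE eqxx andbT eq_sym.
by rewrite e1 e2 mulmx1.
Qed.

(** The hermitian part of [G] carries the real part of the quadratic form, so the factors 2 of
    [posdef_congr] and [dotc_herm] cancel. *)
Lemma posdef_normalize n (G : 'M[C]_n) :
  (forall c, c != 0 -> 0 < re (dotc (G *m c) c)) ->
  exists2 g, g \in unitmx &
    forall c, re (dotc (G *m (g *m c)) (g *m c)) = euclid c ^+ 2.
Proof.
move=> /posdef_congr[g gu gE]; exists g => // c.
have e1 : dotc ((G + G^t*) *m (g *m c)) (g *m c) = dotc (g^t* *m (G + G^t*) *m g *m c) c.
  by rewrite -!mulmxA [RHS]dotc_adj trmxCK.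
have := dotc_herm G (g *m c); rewrite e1 gE mul_scalar_mx (ipZl (dotcP _ _)) (ipxx (dotcP _ _)) => /(congr1 (@re R)).
rewrite reR -(rmorph_nat (real_complex R)) reZ reR => /mulfI.
by move=> h; rewrite h// pnatr_eq0.
Qed.

Variables (V : lmodType C) (nV : matrix_norms V) (hO : operator_space nV).
Let hV : matricially_normed nV := proj1 hO.
Local Notation D := (dual nV).

(* The factor [1 + k e] is the price of making the two positive functionals
   invertible by adding [e] times the trace. *)
Theorem effros_ruan k (x0 : 'M[V]_k) (e : R) : nV x0 = 1 -> 0 < e ->
  exists2 F : 'M[D]_k, dual_norms nV F <= 1 &
    1 <= mx_norms (map_mx (mxev F) x0) * (1 + k%:R * e).
Proof.
move=> x01 e0.
have arith (a b m : R) : a + b <= 2 -> (b + m + (a + m)) / 2 <= 1 + m by lra.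
have [L [lL LP Lx0]] := norming_functional hV x01.
have [p [q [lp lq pqL pq1]]] := factorizing_states hO lL LP.
have [lB BL] := mxfunctionalP lL.
set B := mxfunctional _ in lB BL.
have [H HE] := real_functional_gram lp.
have [G GE] := real_functional_gram lq.
have cB : contractive_form nV B G H.
  move=> r y y1 c d; rewrite -pairing_bimulmx// BL -HE -GE.
  have := pqL (Sandwich (colmx_conj d) y (rowmx_of c)) y1.
  rewrite /= colmx_conj_adj rowmx_of_adj /sw_val/= => h.
  by rewrite ler_pdivlMr// mulrC [X in _ <= X]addrC.
have B00 (c d : 'cV[C]_k) : re (dotc (B 0 *m c) d) = 0.
  have -> : B 0 = 0 by apply/matrixP => a b; rewrite (clinear0 (lB a b)) mxE.
  by rewrite mul0mx (ip0l (dotcP _ _)).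
have psd (c d : 'cV[C]_k) : 0 <= re (dotc (G *m c) c) + re (dotc (H *m d) d).
  have := cB 1%N 0; rewrite matrix_norms0// ler01 => /(_ isT (fun=> c) (fun=> d)).
  by rewrite !big_ord1 mxE B00 pmulr_lge0.
have psdG c : 0 <= re (dotc (G *m c) c).
  by have := psd c 0; rewrite (ip0r (dotcP _ _)) addr0.
have psdH c : 0 <= re (dotc (H *m c) c).
  by have := psd 0 c; rewrite (ip0r (dotcP _ _)) add0r.
pose pert (A : 'M[C]_k) := A + (e%:C)%:M.
have pertE (A : 'M[C]_k) c : re (dotc (pert A *m c) c) =
    re (dotc (A *m c) c) + e * euclid c ^+ 2.
  rewrite mulmxDl (ipDl (dotcP _ _)) mul_scalar_mx (ipZl (dotcP _ _)).
  by rewrite reD reZ (ipxx (dotcP _ _)).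
have pert_gt0 (A : 'M[C]_k) : (forall c, 0 <= re (dotc (A *m c) c)) ->
    forall c, c != 0 -> 0 < re (dotc (pert A *m c) c).
  move=> A0 c c0; rewrite pertE; apply: ltr_wpDl; first exact: A0.
  by apply: mulr_gt0 => //; apply: exprn_gt0; exact: euclid_gt0.
have [g gu gE] := posdef_normalize (pert_gt0 _ psdG).
have [h hu hE] := posdef_normalize (pert_gt0 _ psdH).
(* Separate changes of basis on source and target bring both perturbed weights to the identity. *)
pose B' v := h^t* *m B v *m g.
have cB' : contractive_form nV B' 1%:M 1%:M.
  have nE (A f : 'M[C]_k) c : dotc ((f^t* *m A *m f) *m c) c = dotc (A *m (f *m c)) (f *m c).
    by rewrite -!mulmxA [LHS]dotc_adj trmxCK.
  have pert_le (A : 'M[C]_k) c : re (dotc (A *m c) c) <= re (dotc (pert A *m c) c).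
    by rewrite pertE lerDl mulr_ge0 ?sqr_ge0// ltW.
  have := contractive_form_conj g h (contractive_form_le (pert_le G) (pert_le H) cB).
  apply: contractive_form_le => c; rewrite nE ?gE ?hE mul1mx (ipxx (dotcP _ _)) reR;
    exact: lexx.
have lB' : entries_linear B'.
  move=> a b s x y; rewrite /B'.
  have -> : B (s *: x + y) = s *: B x + B y by apply/matrixP => i j; rewrite lB !mxE.
  by rewrite mulmxDr mulmxDl -scalemxAr -scalemxAl !mxE.
have [F FE] := dual_of_form hV lB' cB'.
have FB : mxev F = B' by exact/funext.
exists F; first by apply/(dual_norms_ball hV); rewrite FB; exact: contractive_form_cc.
pose ei (i : 'I_k) : 'cV[C]_k := delta_mx i 0.
(* Undoing the changes of basis on the test vectors recovers [L x0]. The squared norms of these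
   vectors add up to the perturbed traces. *)
have key : 1 = re (\sum_i \sum_j dotc (map_mx (mxev F) x0 i j *m (invmx g *m ei j))
    (invmx h *m ei i)).
  rewrite -Lx0 -BL /pairing; congr re; apply: eq_bigr => i _; apply: eq_bigr => j _.
  rewrite [in RHS]mxE FB /B' -!mulmxA mulKVmx// [RHS]dotc_adj trmxCK mulKVmx//.
  by rewrite dotc_delta.
rewrite [X in X <= _]key; apply: le_trans (mx_norms_re _ _ _) _.
rewrite ler_wpM2l ?mx_norms_ge0//.
have nE (A f : 'M[C]_k) (fu : f \in unitmx) :
    (forall c, re (dotc (pert A *m (f *m c)) (f *m c)) = euclid c ^+ 2) ->
    \sum_j euclid (invmx f *m ei j) ^+ 2 = \sum_j re (dotc (A *m ei j) (ei j)) + k%:R * e.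
  move=> fE; have -> : k%:R * e = \sum_(j < k) e by rewrite sumr_const card_ord mulr_natl.
  rewrite -big_split; apply: eq_bigr => j _ /=.
  by rewrite -fE mulKVmx// pertE euclid_delta mulr1.
have GS : \sum_j re (dotc (G *m ei j) (ei j)) = q (1%:M : 'M[C]_k).
  by rewrite -[LHS]GE; congr q; exact: colmx_conj_delta.
have HS : \sum_j re (dotc (H *m ei j) (ei j)) = p (1%:M : 'M[C]_k).
  by rewrite -[LHS]HE; congr p; exact: colmx_conj_delta.
apply: le_trans (arith _ _ (k%:R * e) pq1); rewrite le_eqVlt; apply/orP; left.
apply/eqP; rewrite -GS -HS; congr ((_ + _) / 2); [exact: (nE _ _ gu gE)|exact: (nE _ _ hu hE)].
Qed.

End effros_ruan.

(** * Invariance of the index under passage to the bidual *)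

Section bidual_index.
Variable R : realType.
Variables (V : lmodType R[i]) (nV : matrix_norms V) (u : V) (hO : operator_space nV).
Let hV : matricially_normed nV := proj1 hO.

Lemma dual_norms_embed k (x : 'M[V]_k) : nV x = 1 ->
  dual_norms (dual_norms nV) (map_mx (bidual_embed hV) x) = 1.
Proof.
move=> x1; apply/eqP; rewrite eq_le; apply/andP; split.
  by rewrite -x1; exact: dual_norms_embed_le.
have hD := dual_norms_matricially_normed hV.
have [X0 hX _] := dual_normsP hD (map_mx (bidual_embed hV) x).
set N := dual_norms _ _ in X0 hX *; clearbody N.
apply: (@le_epsilon_mul _ _ _ (N * k%:R)) => e e0.
have [F F1 hF] := effros_ruan hO x1 e0.
have ke : 0 <= 1 + k%:R * e by rewrite addr_ge0// mulr_ge0// ltW.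
have h : mx_norms (map_mx (mxev F) x) <= N.
  (* [F(x)] is the flip of the embedded [x] evaluated at [F], which the bidual norm controls. *)
  rewrite -[X in mx_norms X]flip_mxK; apply: le_trans (mx_norms_flip _) _.
  by rewrite -(embed_map_flip hV); exact: hX.
apply: le_trans hF _; apply: le_trans (ler_wpM2r ke h) _.
by rewrite mulrDr mulr1 mulrA [e * _]mulrC.
Qed.

Theorem n_cb_bidual : vnorm nV u = 1 ->
  n_cb nV u = n_cb (dual_norms (dual_norms nV)) (bidual_embed hV u).
Proof.
move=> u1; apply/eqP; rewrite eq_le; apply/andP; split; first exact: n_cb_le_bidual.
apply: le_ereal_inf_tmp => _ [k [x [x1 ->]]].
apply: (@le_trans _ _ (ugamma (dual_norms (dual_norms nV)) (bidual_embed hV u)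
    (map_mx (bidual_embed hV) x))).
  apply: ereal_inf_lbound; exists k, (map_mx (bidual_embed hV) x).
  by split; first exact: dual_norms_embed.
apply: ge_ereal_sup => _ [n [phi [[cphi phiu] ->]]].
have lE : linear (bidual_embed hV).
  move=> a v w; apply: val_inj; apply/funext => f /=.
  exact: (dual_clinear f).
have lphi : linear (fun v => phi (bidual_embed hV v)).
  by move=> a v w; rewrite lE linearP.
pose lpsi := GRing.isLinear.Build _ V 'M[R[i]]_n.+1 _ _ lphi.
pose psi : {linear V -> 'M[R[i]]_n.+1} := HB.pack (fun v => phi (bidual_embed hV v)) lpsi.
apply: ereal_sup_ubound; exists n, psi; split.
  split; last exact: phiu.
  apply/completely_contractiveP => r y y1.
  have -> : map_mx psi y = map_mx phi (map_mx (bidual_embed hV) y).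
    by apply/matrixP => i j; rewrite [LHS]mxE [RHS]mxE [in RHS]mxE.
  move/completely_contractiveP : cphi; apply.
  exact: le_trans (dual_norms_embed_le hV y) y1.
have -> : map_mx psi x = map_mx phi (map_mx (bidual_embed hV) x); last exact: erefl.
by apply/matrixP => i j; rewrite [LHS]mxE [RHS]mxE [in RHS]mxE.
Qed.

End bidual_index.

(** * Compressions of a Hilbert space embedding *)

Section hilbert_embedding.
Variable R : realType.
Local Notation C := R[i].

Lemma hilbert_inner_product (H : hilbertType R) :
  inner_product (@rnorm R H) (@inner R H : H -> H -> C).
Proof.
split=> [a x y z|x y|x|x].
- by rewrite linearPl.
- by rewrite hermC/= expr0 mul1r.
- exact: rnorm_ge0.
- by rewrite rmorphXn/= rnormE normr_inner.
Qed.

Variables (V : lmodType C) (nV : matrix_norms V) (hV : matricially_normed nV) (u : V).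
Local Notation D := (dual nV).
Variables (H : hilbertType R) (Psi : {linear V -> blop H}).
Hypothesis cPsi : completely_contractive nV (@blop_norms R H) Psi.
Hypothesis Psiu : forall h : H, Psi u h = h.

Let ip : H -> H -> C := @inner R H.
Let hip : inner_product (@rnorm R H) ip := hilbert_inner_product H.

Lemma blop_linear (T : blop H) a x y : T (a *: x + y) = a *: T x + T y.
Proof. by have := valP T; rewrite unfold_in => /asboolP[lT _]; exact: lT. Qed.

Lemma blopD (T : blop H) x y : T (x + y) = T x + T y.
Proof. by rewrite -[x]scale1r blop_linear !scale1r. Qed.

Lemma blop0 (T : blop H) : T 0 = 0.
Proof. by apply: (addIr (T 0)); rewrite -blopD !add0r. Qed.

Lemma blopZ (T : blop H) a x : T (a *: x) = a *: T x.
Proof. by rewrite -[a *: x]addr0 blop_linear blop0 addr0. Qed.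

Lemma blop_bounded (T : blop H) : exists M, forall x, rnorm (T x) <= M * rnorm x.
Proof. by have := valP T; rewrite unfold_in => /asboolP[_]. Qed.

Definition compression n (z : 'I_n -> H) : V -> 'M[C]_n :=
  family_form ip (fun v => Psi v : H -> H) z.

Lemma compression_linear n (z : 'I_n -> H) : entries_linear (compression z).
Proof.
move=> a b s x y; rewrite !mxE linearP.
have -> : (s *: Psi x + Psi y) (z b) = s *: Psi x (z b) + Psi y (z b) by [].
by rewrite (ipDl hip) (ipZl hip).
Qed.

Lemma compression_unit n (z : 'I_n -> H) : compression z u = gram ip z.
Proof. by apply/matrixP => a b; rewrite !mxE Psiu. Qed.

Lemma compression_contractive n (z : 'I_n -> H) :
  contractive_form nV (compression z) (compression z u) (compression z u).
Proof.
rewrite compression_unit; apply: (family_form_contractive hip).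
- by move=> v a w; exact: blopZ.
- by move=> v w w'; exact: blopD.
- by move=> v; exact: blop_bounded.
- move=> r y y1; have /completely_contractiveP/(_ _ _ y1) := cPsi.
  congr (ampnorm _ _ <= _).
  by apply/funext => i; apply/funext => j; rewrite mxE.
Qed.

Lemma compression_herm n (z : 'I_n -> H) : (compression z u)^t* = compression z u.
Proof.
by rewrite compression_unit; apply/matrixP => a b; rewrite !mxE [RHS](ipC hip).
Qed.

(** Supplies the state with which [form_le_states] perturbs singular Gram matrices. *)
Lemma compression_state (h : H) : rnorm h = 1 ->
  exists S : 'M[D]_1, dual_state u S.
Proof.
move=> h1; pose z (_ : 'I_1) := h.
have G1 : compression z u = 1%:M.
  rewrite compression_unit; apply/matrixP => i j; rewrite !mxE !ord1 eqxx (ipxx hip) h1.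
  by rewrite expr1n rmorph1.
have cz := compression_contractive z.
have [S SE] := dual_of_form hV (compression_linear z) cz.
exists S; have eS : mxev S = compression z by exact/funext.
split; last by rewrite SE.
by rewrite eS; apply: contractive_form_cc; rewrite -G1.
Qed.

(** Both test families are concatenated into one family of 2k vectors. The compression to it has the
    Gram matrix as its value at [u], so [form_le_states], with evaluations at the entries of [x],
    bounds the tested sum. *)
Lemma blop_norms_le_states n0 (S0 : 'M[D]_n0.+1) k (x : 'M[V]_k) (g : R) :
  dual_state u S0 ->
  (forall n (S : 'M[D]_n.+1), dual_state u S -> mx_norms (map_mx (mxev S) x) <= g) ->
  blop_norms (map_mx Psi x) <= g.
Proof.
move=> sS0 hg; have g0 : 0 <= g := le_trans (mx_norms_ge0 _) (hg _ _ sS0).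
apply: (ampnorm_le hip) => v w vw.
case: k => [|k] in x hg v w vw *; first by rewrite big_ord0.
pose n := (k.+1 + k.+1)%N.
pose z (a : 'I_n) := match fintype.split a with inl i => w i | inr j => v j end.
have zl i : z (lshift k.+1 i) = w i by rewrite /z (unsplitK (inl i)).
have zr j : z (rshift k.+1 j) = v j by rewrite /z (unsplitK (inr j)).
have cz := compression_contractive z.
have [F FE] := dual_of_form hV (compression_linear z) cz.
have eF : mxev F = compression z by exact/funext.
have lX i j : clinear (fun f : D => f (x i j) : C) by exact: eval_clinear.
have := @form_le_states _ _ _ hV u _ S0 (k + k.+1)%N F _
  (fun i j (f : D) => f (x i j) : C) g sS0.
rewrite eF => /(_ cz (compression_herm z) lX).
have gX (S : 'M[D]_((k + k.+1).+1)) : dual_state u S ->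
    mx_norms (\matrix_(i, j) map_mx (fun f : D => f (x i j) : C) S) <= g.
  move=> sS; have -> : \matrix_(i, j) map_mx (fun f : D => f (x i j) : C) S =
      map_mx (mxev S) x by apply/matrixP => i j; rewrite [LHS]mxE [RHS]mxE mxev_map.
  exact: hg.
move=> /(_ gX (fun j => delta_mx (rshift k.+1 j : 'I_n) 0 : 'cV[C]_n)
  (fun i => delta_mx (lshift k.+1 i : 'I_n) 0 : 'cV[C]_n)).
have FX i j : map_mx (fun f : D => f (x i j) : C) F = compression z (x i j).
  by rewrite -eF mxev_map.
have -> : \sum_i \sum_j ip (map_mx Psi x i j (v j)) (w i) = \sum_i \sum_j
    dotc (map_mx (fun f : D => f (x i j) : C) F *m
      (delta_mx (rshift k.+1 j : 'I_n) 0 : 'cV[C]_n))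
      (delta_mx (lshift k.+1 i : 'I_n) 0 : 'cV[C]_n).
  apply: eq_bigr => i _; apply: eq_bigr => j _.
  by rewrite FX (@dotc_delta R n) !mxE zl zr.
move=> /le_trans; apply.
have dE (a : 'I_n) : re (dotc (compression z u *m (delta_mx a 0 : 'cV[C]_n))
    (delta_mx a 0 : 'cV[C]_n)) = rnorm (z a) ^+ 2.
  by rewrite (@dotc_delta R n) compression_unit mxE (ipxx hip) reR.
under eq_bigr do rewrite dE zr.
under [X in (_ + X)]eq_bigr do rewrite dE zl.
by rewrite ler_piMr//; lra.
Qed.

Lemma n_cb_gt0_of_embedding : vnorm nV u = 1 ->
  complete_top_injection nV (@blop_norms R H) Psi -> (0 < n_cb nV u)%E.
Proof.
move=> u1 [injPsi _ [g Psig gcb]].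
(* [K] exceeds the cb norm of the inverse strictly. If [ugamma] were below [K^-1] at some [x] of
   norm 1, the image of [K x] would lie in the unit ball although [K x] has norm [K]. *)
have [K K1 hK] : exists2 K : R, 0 < K & forall k (x : 'M[V]_k),
    blop_norms (map_mx Psi x) <= 1 -> nV x < K.
  have [c hc] : exists c : R, (cb_norm_on (range Psi) (@blop_norms R H) nV g <= c%:E)%E.
    move: gcb; case: cb_norm_on => [c _| //|_]; first by exists c.
    by exists 0; exact: leNye.
  exists (`|c| + 1) => [|k x x1]; first by rewrite ltr_wpDl.
  have /cb_norm_on_le := hc => /(_ k (map_mx Psi x)).
  have -> : map_mx g (map_mx Psi x) = x.
    by apply/matrixP => i j; rewrite !mxE Psig.
  rewrite lee_fin => /(_ _ x1) h.
  apply: (@le_lt_trans _ _ c); last first.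
    by apply: (le_lt_trans (ler_norm c)); rewrite ltrDl.
  by apply: h => i j; rewrite mxE; exists (x i j).
(* On a zero Hilbert space [Psi u = Psi 0], which injectivity excludes because [u] is not 0. *)
have [h h1] : exists h : H, rnorm h = 1.
  have [h hn] : exists h : H, rnorm h != 0.
    apply: contrapT => hn.
    have : Psi u = Psi 0.
      apply: val_inj; apply/funext => h /=.
      have h0 : h = 0.
        apply/eqP; rewrite -normr_eq0 -rnormE; apply/eqP; congr (_%:C).
        by apply: contrapT => h0; apply: hn; exists h; apply/eqP.
      by rewrite h0 !blop0.
    move=> /injPsi u0; move: u1; rewrite u0 /vnorm => /eqP.
    have -> : const_mx (0 : V) = 0 :> 'M[V]_1 by apply/matrixP => i j; rewrite !mxE.
    by rewrite matrix_norms0// eq_sym oner_eq0.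
  exists ((rnorm h)^-1%:C *: h).
  by rewrite rnormZ rnormR ger0_norm ?invr_ge0 ?rnorm_ge0// mulVf.
have [S0 sS0] := compression_state h1.
have Ki : 0 < K^-1 by rewrite invr_gt0.
apply: (@lt_le_trans _ _ (K^-1)%:E); first by rewrite lte_fin.
apply: le_ereal_inf_tmp => _ [k [x [x1 ->]]].
case E : (ugamma nV u x) => [r| |]; last 2 first.
- exact: leey.
- by have := ugamma_ub x sS0; rewrite E.
rewrite lee_fin leNgt; apply/negP => rK.
have Tx : blop_norms (map_mx Psi x) <= r.
  apply: blop_norms_le_states sS0 _ => n S sS.
  by rewrite -lee_fin -E; exact: ugamma_ub.
have := hK _ (map_mx ( *:%R K%:C) x).
rewrite matrix_normsZ// x1 mulr1 rnormR gtr0_norm// ltxx => h2.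
suff : false by [].
apply: h2.
have -> : map_mx Psi (map_mx ( *:%R K%:C) x) = map_mx ( *:%R K%:C) (map_mx Psi x).
  by apply/matrixP => i j; rewrite !mxE linearZ.
have e := @ampnormZ _ _ _ _ hip k (fun i j => map_mx Psi x i j : H -> H) K K1.
have -> : blop_norms (map_mx ( *:%R K%:C) (map_mx Psi x)) = K * blop_norms (map_mx Psi x).
  rewrite /blop_norms -e.
  - congr ampnorm; apply/funext => i; apply/funext => j; apply/funext => w.
    by rewrite mxE.
  - by move=> i j a w; exact: blopZ.
  - by move=> i j; exact: blop_bounded.
rewrite -(ler_pM2l Ki) mulrA mulVf ?gt_eqF// mul1r mulr1.
exact: le_trans Tx (ltW rK).
Qed.

End hilbert_embedding.

(** * Square-summable families *)

#[local] Existing Instance summability.totally_filter.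

Lemma cvg_sum_seq (R : realType) (T : Type) (F : set_system T) (FF : Filter F)
    (I : Type) (r : seq I) (f : I -> T -> R) (l : I -> R) :
  (forall i, f i t @[t --> F] --> l i) ->
  \sum_(i <- r) f i t @[t --> F] --> \sum_(i <- r) l i.
Proof.
move=> fl; elim: r => [|i r IH].
  by under eq_fun do rewrite big_nil; rewrite big_nil; exact: cvg_cst.
by under eq_fun do rewrite big_cons; rewrite big_cons; exact: cvgD.
Qed.

Section nonneg_families.
Variables (R : realType) (J : choiceType).
Local Notation totally := (@summability.totally J).

Lemma ler_sum_fsubset (x : J -> R) (A B : {fset J}) : (forall j, 0 <= x j) ->
  (A `<=` B)%fset -> \sum_(j <- A) x j <= \sum_(j <- B) x j.
Proof.
move=> x0 AB; rewrite [leRHS](bigID (mem A))/= -[X in _ <= X + _]big_filter.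
rewrite [X in _ <= X + _](perm_big A)/=; last first.
  apply: uniq_perm; rewrite ?filter_uniq ?fset_uniq// => j.
  by rewrite mem_filter; apply/andP/idP => [[]//|jA]; split=> //; exact: (fsubsetP AB).
by rewrite lerDl sumr_ge0.
Qed.

Lemma cvg_sum_totally (x : J -> R) (M : R) : (forall j, 0 <= x j) ->
  (forall A : {fset J}, \sum_(j <- A) x j <= M) ->
  (fun A : {fset J} => \sum_(j <- A) x j) @ totally -->
  sup (range (fun A : {fset J} => \sum_(j <- A) x j)).
Proof.
move=> x0 xM; set S := range _.
have hS : has_sup S.
  split; first by exists (\sum_(j <- (fset0 : {fset J})) x j), fset0.
  by exists M => _ [A _ <-]; exact: xM.
apply/cvgrPdist_le => e e0.
have [_ [A _ <-] hA] := sup_adherent e0 hS.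
exists A => // B AB /=.
have BS : \sum_(j <- B) x j <= sup S by apply: ub_le_sup; [case: hS|exists B].
rewrite ger0_norm ?subr_ge0// lerBlDr -lerBlDl.
by apply: le_trans (ltW hA) _; exact: ler_sum_fsubset.
Qed.

End nonneg_families.

(** * The inner product space of square-summable families *)

Section l2_space.
Variables (R : realType) (J : choiceType).
Local Notation C := R[i].
Local Notation totally := (@summability.totally J).

Definition sqsum (f : J -> C) (A : {fset J}) : R := \sum_(j <- A) rnorm (f j) ^+ 2.

Definition l2_pred : {pred J -> C^o} := fun f => `[< exists M, forall A, sqsum f A <= M >].

Record l2 := L2 { l2_fun :> J -> C^o; _ : l2_fun \in l2_pred }.

HB.instance Definition _ := [isSub for l2_fun].
HB.instance Definition _ := [Choice of l2 by <:].

Lemma l2_submod_closed : submod_closed l2_pred.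
Proof.
split=> [|a f g].
  rewrite unfold_in; apply/asboolP; exists 0 => A; rewrite /sqsum big1// => j _.
  by rewrite rnorm0 expr0n.
rewrite !unfold_in => /asboolP[M hM] /asboolP[K hK]; apply/asboolP.
exists (2 * rnorm a ^+ 2 * M + 2 * K) => A.
have := lerD (ler_wpM2l (mulr_ge0 (ler0n R 2) (sqr_ge0 (rnorm a))) (hM A))
  (ler_wpM2l (ler0n R 2) (hK A)).
apply: le_trans; rewrite /sqsum !mulr_sumr -big_split/=; apply: ler_sum => j _.
have := rnormD (a * f j : C) (g j : C); rewrite rnormM.
have := rnorm_ge0 (a * f j + g j : C); have := rnorm_ge0 a.
have := rnorm_ge0 (f j : C); have := rnorm_ge0 (g j : C).
rewrite -[X in rnorm X ^+ 2]/(a * f j + g j : C).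
move: (rnorm (g j : C)) (rnorm (f j : C)) (rnorm a) (rnorm (a * f j + g j : C)).
move=> gj fj ra s g0 f0 a0 s0 h.
apply: (@le_trans _ _ ((ra * fj + gj) ^+ 2)).
  by rewrite ler_pXn2r// ?nnegrE ?addr_ge0// mulr_ge0.
rewrite -subr_ge0 (_ : _ - _ = (ra * fj - gj) ^+ 2) ?sqr_ge0//; ring.
Qed.

HB.instance Definition _ := GRing.isSubmodClosed.Build _ _ l2_pred l2_submod_closed.
HB.instance Definition _ := [SubChoice_isSubLmodule of l2 by <:].

Implicit Types f g h : l2.

Definition l2_sq f : R := sup (range (sqsum f)).

Lemma sqsum_bounded f : exists M, forall A, sqsum f A <= M.
Proof. by have := valP f; rewrite unfold_in => /asboolP. Qed.

Lemma sqsum_cvg f : sqsum f @ totally --> l2_sq f.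
Proof.
have [M hM] := sqsum_bounded f.
by apply: (@cvg_sum_totally _ _ _ M) => // j; exact: sqr_ge0.
Qed.

Lemma sqsum_le f A : sqsum f A <= l2_sq f.
Proof.
have [M hM] := sqsum_bounded f.
by apply: ub_le_sup; [exists M => _ [B _ <-]|exists A].
Qed.

Lemma l2_sq_le f M : (forall A, sqsum f A <= M) -> l2_sq f <= M.
Proof.
move=> hM; apply: ge_sup; last by move=> _ [A _ <-].
by exists (sqsum f fset0), fset0.
Qed.

Lemma l2_sq_ge0 f : 0 <= l2_sq f.
Proof. by apply: le_trans (sqsum_le f fset0); rewrite /sqsum big_seq_fset0. Qed.

Definition l2_pre f g (A : {fset J}) : C := \sum_(j <- A) f j * Num.conj (g j).

(** Polarisation reduces the inner product to sums of squares, which converge by monotonicity; no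
    separate summability of the products is required. The imaginary part is the real part against
    [i g]. *)
Definition l2_re f g : R := (l2_sq (f + g) - l2_sq f - l2_sq g) / 2.

Definition l2_ip f g : C := Complex (l2_re f g) (l2_re f ('i *: g)).

Lemma l2_pre_re_cvg f g : (fun A => re (l2_pre f g A)) @ totally --> l2_re f g.
Proof.
have -> : (fun A => re (l2_pre f g A)) =
    (fun A => (sqsum (f + g) A - sqsum f A - sqsum g A) / 2).
  apply/funext => A; rewrite /l2_pre re_sum /sqsum -!sumrB mulr_suml.
  apply: eq_bigr => j _; rewrite -[(f + g) j]/(f j + g j).
  case: (f j : C) (g j : C) => [a b] [c d].
  have sq (z : C) : rnorm z ^+ 2 = re (z * Num.conj z) by rewrite mul_conj.
  by rewrite !sq /=; field.
by apply: cvgMl; apply: cvgB; [apply: cvgB|]; exact: sqsum_cvg.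
Qed.

Lemma l2_pre_i f g A : complex.Im (l2_pre f g A) = re (l2_pre f ('i *: g) A).
Proof.
rewrite /l2_pre (big_morph (@complex.Im R) (id1 := 0) (op1 := +%R))//; last first.
  by case=> [a b] [c d].
rewrite re_sum; apply: eq_bigr => j _; rewrite -[('i *: g) j]/('i * g j).
by case: (f j : C) (g j : C) => [a b] [c d] /=; ring.
Qed.

Lemma l2_pre_im_cvg f g :
  (fun A => complex.Im (l2_pre f g A)) @ totally --> complex.Im (l2_ip f g).
Proof. by under eq_fun do rewrite l2_pre_i; exact: l2_pre_re_cvg. Qed.

Lemma totally_cvg_unique (x y : {fset J} -> R) (a b : R) : x =1 y ->
  x @ totally --> a -> y @ totally --> b -> a = b.
Proof. by move=> /funext -> xa yb; exact: cvg_unique xa yb. Qed.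

(** The identity holds for finite partial sums and passes to the limit along finite sets, separately
    for real and imaginary parts. *)
Lemma l2_ip_linear a f g h : l2_ip (a *: f + g) h = a * l2_ip f h + l2_ip g h.
Proof.
have e A : l2_pre (a *: f + g) h A = a * l2_pre f h A + l2_pre g h A.
  rewrite /l2_pre mulr_sumr -big_split; apply: eq_bigr => j _ /=.
  transitivity ((a * f j + g j) * Num.conj (h j : C)); first by [].
  by rewrite mulrDl mulrA.
have re1 f' : (fun A => re (l2_pre f' h A)) @ totally --> re (l2_ip f' h).
  exact: l2_pre_re_cvg.
have im1 f' : (fun A => complex.Im (l2_pre f' h A)) @ totally --> complex.Im (l2_ip f' h).
  exact: l2_pre_im_cvg.
case: a e => a b e; apply/eqP; rewrite eq_complex; apply/andP; split; apply/eqP.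
- apply: (totally_cvg_unique _ (re1 _)) => [A|]; first by rewrite e.
  rewrite (_ : complex.Re _ = a * re (l2_ip f h) - b * complex.Im (l2_ip f h) +
    re (l2_ip g h)); last by case: (l2_ip f h) (l2_ip g h) => [? ?] [? ?].
  rewrite (_ : (fun A => _) = fun A => a * re (l2_pre f h A) -
    b * complex.Im (l2_pre f h A) + re (l2_pre g h A)); last first.
    by apply/funext => A; case: (l2_pre f h A) (l2_pre g h A) => [? ?] [? ?].
  by apply: cvgD; [apply: cvgB; apply: cvgMr|].
- apply: (totally_cvg_unique _ (im1 _)) => [A|]; first by rewrite e.
  rewrite (_ : complex.Im _ = a * complex.Im (l2_ip f h) + b * re (l2_ip f h) +
    complex.Im (l2_ip g h)); last by case: (l2_ip f h) (l2_ip g h) => [? ?] [? ?].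
  rewrite (_ : (fun A => _) = fun A => a * complex.Im (l2_pre f h A) +
    b * re (l2_pre f h A) + complex.Im (l2_pre g h A)); last first.
    by apply/funext => A; case: (l2_pre f h A) (l2_pre g h A) => [? ?] [? ?].
  by apply: cvgD; [apply: cvgD; apply: cvgMr|].
Qed.

Lemma l2_ipC f g : l2_ip g f = Num.conj (l2_ip f g).
Proof.
have e A : l2_pre g f A = Num.conj (l2_pre f g A).
  by rewrite rmorph_sum; apply: eq_bigr => j _; rewrite rmorphM/= conjCK mulrC.
apply/eqP; rewrite eq_complex; apply/andP; split; apply/eqP.
- rewrite -[LHS]/(l2_re g f) -[RHS]/(l2_re f g).
  apply: (totally_cvg_unique _ (@l2_pre_re_cvg g f) (@l2_pre_re_cvg f g)) => A.
  by rewrite e reJ.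
- rewrite -[LHS]/(complex.Im (l2_ip g f)) -[RHS]/(- complex.Im (l2_ip f g)).
  apply: (totally_cvg_unique _ (@l2_pre_im_cvg g f) (cvgN (@l2_pre_im_cvg f g))) => A.
  by rewrite e -[RHS]/(- complex.Im (l2_pre f g A)); case: (l2_pre f g A).
Qed.

Lemma l2_ipxx f : l2_ip f f = (l2_sq f)%:C.
Proof.
have e A : l2_pre f f A = (sqsum f A)%:C.
  by rewrite rmorph_sum; apply: eq_bigr => j _; exact: mul_conj.
apply/eqP; rewrite eq_complex; apply/andP; split; apply/eqP.
- rewrite -[LHS]/(l2_re f f) -[RHS]/(l2_sq f).
  by apply: (totally_cvg_unique _ (@l2_pre_re_cvg f f) (@sqsum_cvg f)) => A; rewrite e.
- rewrite -[LHS]/(complex.Im (l2_ip f f)) -[RHS]/(0 : R).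
  by apply: (totally_cvg_unique _ (@l2_pre_im_cvg f f) (cvg_cst 0)) => A; rewrite e.
Qed.

Definition l2_norm f : R := Num.sqrt (l2_sq f).

Lemma l2_inner_product : inner_product l2_norm l2_ip.
Proof.
split=> [a x y z|x y|x|x]; [exact: l2_ip_linear|exact: l2_ipC|exact: sqrtr_ge0|].
by rewrite l2_ipxx sqr_sqrtr// l2_sq_ge0.
Qed.

Lemma l2_coord_le f j : rnorm (f j : C) <= l2_norm f.
Proof.
rewrite -(ler_pXn2r (n := 2))// ?nnegrE ?sqrtr_ge0 ?rnorm_ge0//.
rewrite sqr_sqrtr ?l2_sq_ge0//; apply: le_trans (sqsum_le f [fset j]%fset).
by rewrite /sqsum big_seq_fset1.
Qed.

Lemma l2_normD f g : (l2_norm (f + g))%:C <= (l2_norm f)%:C + (l2_norm g)%:C.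
Proof. by rewrite -rmorphD/= lecR; exact: (ipD_norm l2_inner_product). Qed.

Lemma l2_normZ (a : C) f : (l2_norm (a *: f))%:C = `|a| * (l2_norm f)%:C.
Proof. by rewrite (ipZ_norm l2_inner_product) rmorphM/= rnormE. Qed.

Lemma l2_norm_eq0 f : (l2_norm f)%:C = 0 :> C -> f = 0.
Proof.
move=> /complexI f0; apply: val_inj; apply/funext => j.
by apply: rnorm_eq0; apply/eqP; rewrite eq_le rnorm_ge0 andbT -f0; exact: l2_coord_le.
Qed.

HB.instance Definition _ := Lmodule_isNormed.Build C l2 l2_normD l2_normZ l2_norm_eq0.

End l2_space.

(** * Completeness and the Hilbert structure *)

Section l2_hilbert.
Variables (R : realType) (J : choiceType).
Local Notation C := R[i].
Local Notation l2 := (l2 R J).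

Section cauchy.
Variables (F : set_system l2) (FF : ProperFilter F) (cF : cauchy F).

Lemma l2_cauchy (e : R) : 0 < e -> exists g : l2, F [set f | l2_norm (g - f) <= e].
Proof.
move=> e0; have := cF => /cauchyP /(_ e%:C); rewrite ltcR => /(_ e0)[g Fg].
exists g; apply: filterS Fg => f; rewrite -ball_normE /= => h.
by rewrite -lecR ltW.
Qed.

Lemma l2_cauchy_coord (phi : l2 -> R) :
  (forall f g : l2, `|phi f - phi g| <= l2_norm (f - g)) -> cvg (phi f @[f --> F]).
Proof.
move=> hphi; apply: R_complete; apply: cauchy_exP => e e0.
have e2 : 0 < e / 2 by rewrite divr_gt0.
have [g Fg] := l2_cauchy e2; exists (phi g).
suff : F [set f | ball (phi g) e (phi f)] by [].
apply: filterS Fg => f /= gf; rewrite -ball_normE /=.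
by apply: (le_lt_trans (hphi _ _)); apply: (le_lt_trans gf); rewrite ltr_pdivrMr// ltr_pMr// ltr1n.
Qed.

Lemma l2_cvg : cvg F.
Proof.
pose rj j (f : l2) : R := re (f j); pose ij j (f : l2) : R := complex.Im (f j : C).
have sqE (z : C) : rnorm z ^+ 2 = re z ^+ 2 + complex.Im z ^+ 2.
  apply: complexI; rewrite rmorphXn/= rnormE -add_Re2_Im2.
  by [].
have diffE (f g : l2) j : (f - g) j = (f j : C) - (g j : C) by [].
have cr j : cvg (rj j f @[f --> F]).
  apply: l2_cauchy_coord => f g; apply: le_trans (l2_coord_le _ j).
  rewrite /rj -reB -diffE -(ler_pXn2r (n := 2))// ?nnegrE ?rnorm_ge0//.
  by rewrite sqE real_normK ?num_real// lerDl sqr_ge0.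
have ci j : cvg (ij j f @[f --> F]).
  apply: l2_cauchy_coord => f g; apply: le_trans (l2_coord_le _ j).
  have -> : ij j f - ij j g = complex.Im ((f - g) j : C).
    by rewrite diffE /ij; case: (f j : C) (g j : C) => [? ?] [? ?].
  rewrite -(ler_pXn2r (n := 2))// ?nnegrE ?rnorm_ge0//.
  by rewrite sqE real_normK ?num_real// lerDr sqr_ge0.
pose L j : C := Complex (lim (rj j f @[f --> F])) (lim (ij j f @[f --> F])).
(* The coordinatewise limit [L] is not yet known to be square-summable, so closeness is stated for
   finite partial sums, where limits pass through. *)
have Lclose (e : R) (g : l2) : F [set f | l2_norm (g - f) <= e] ->
    forall A, sqsum (fun j => L j - (g j : C)) A <= e ^+ 2.
  move=> Fg A.
  have cv : (fun f : l2 => \sum_(j <- A) ((rj j f - rj j g) ^+ 2 + (ij j f - ij j g) ^+ 2))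
      @ F --> sqsum (fun j => L j - (g j : C)) A.
    have -> : sqsum (fun j => L j - (g j : C)) A =
        \sum_(j <- A) ((complex.Re (L j) - rj j g) ^+ 2 + (complex.Im (L j) - ij j g) ^+ 2).
      apply: eq_bigr => j _; rewrite sqE reB /rj /ij.
      by case: (L j) (g j : C) => [? ?] [? ?].
    have sq_cvg (q : l2 -> R) (s t : R) : q f @[f --> F] --> s ->
        (q f - t) ^+ 2 @[f --> F] --> (s - t) ^+ 2.
      by move=> qs; rewrite expr2; apply: cvgM; apply: cvgB => //; exact: cvg_cst.
    by apply: cvg_sum_seq => j; apply: cvgD; apply: sq_cvg; [exact: cr|exact: ci].
  rewrite -(cvg_lim _ cv)//; apply: limr_le; first by apply/cvg_ex; eexists; exact: cv.
  apply: filterS Fg => f /= gf.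
  have e0 : 0 <= e := le_trans (ip_ge0 (l2_inner_product R J) _) gf.
  apply: (@le_trans _ _ (sqsum (g - f) A)); last first.
    apply: le_trans (sqsum_le _ _) _.
    by rewrite -(sqr_sqrtr (l2_sq_ge0 (g - f))) ler_pXn2r// nnegrE ?sqrtr_ge0.
  rewrite le_eqVlt; apply/orP; left; apply/eqP; apply: eq_bigr => j _.
  rewrite diffE sqE reB /rj /ij.
  by case: (f j : C) (g j : C) => [? ?] [? ?] /=; ring.
have [g1 Fg1] := l2_cauchy ltr01.
have Lin : (fun j => L j - (g1 j : C) : C^o) \in @l2_pred R J.
  rewrite unfold_in; apply/asboolP; exists (1 ^+ 2) => A; exact: Lclose.
(* Membership is known only for [L - g1]; adding [g1] back gives [L]. *)
pose l : l2 := L2 Lin + g1.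
have lE j : l j = L j :> C by rewrite -[LHS]/(L j - (g1 j : C) + (g1 j : C)) subrK.
apply/cvg_ex; exists l; apply/cvgrPdist_le => e e0.
have eR : e = (re e)%:C by rewrite RRe_real// gtr0_real.
have re0 : 0 < re e by rewrite -ltcR -eR.
have re2 : 0 < re e / 2 by rewrite divr_gt0.
have [g Fg] := l2_cauchy re2.
have lg : l2_norm (l - g) <= re e / 2.
  have e20 := ltW re2.
  rewrite -(ler_pXn2r (n := 2))// ?nnegrE ?sqrtr_ge0// sqr_sqrtr ?l2_sq_ge0//.
  apply: l2_sq_le => A; apply: le_trans (Lclose _ _ Fg A).
  rewrite le_eqVlt; apply/orP; left; apply/eqP; apply: eq_bigr => j _.
  by rewrite diffE lE.
apply: filterS Fg => f /= gf; rewrite eR -[X in X <= _]/((l2_norm (l - f))%:C) lecR.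
have -> : l - f = (l - g) + (g - f) by rewrite addrA subrK.
apply: le_trans (ipD_norm (l2_inner_product R J) _ _) _.
by have := lerD lg gf; rewrite -splitr.
Qed.

End cauchy.

HB.instance Definition _ := Uniform_isComplete.Build l2 l2_cvg.

Lemma l2_ip_bilinear : bilinear_for (GRing.Scale.Law.clone _ _ *%R _)
  (GRing.Scale.Law.clone _ _ (Num.conj \; *%R) _) (@l2_ip R J).
Proof.
split=> [g a x y|f a x y]; first exact: l2_ip_linear.
by rewrite /= (ipDr (l2_inner_product R J)) (ipZr (l2_inner_product R J)).
Qed.

HB.instance Definition _ := bilinear_isBilinear.Build C l2 l2 C *%R
  (Num.conj \; *%R) (@l2_ip R J) l2_ip_bilinear.

Lemma l2_ip_hermitian (x y : l2) : l2_ip x y = (-1) ^+ false * Num.conj (l2_ip y x).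
Proof. by rewrite expr0 mul1r l2_ipC. Qed.

HB.instance Definition _ := isHermitianSesquilinear.Build C l2 false Num.conj
  (@l2_ip R J) l2_ip_hermitian.

Lemma l2_ip_gt0 (f : l2) : f != 0 -> 0 < l2_ip f f.
Proof.
move=> f0; have -> : l2_ip f f = (l2_norm f ^+ 2)%:C.
  exact: (ipxx (l2_inner_product R J)).
rewrite ltcR exprn_gt0//.
rewrite lt_neqAle eq_sym sqrtr_ge0 andbT; apply: contra_neq f0 => f0.
by apply: l2_norm_eq0; rewrite f0.
Qed.

HB.instance Definition _ := isDotProduct.Build C l2 (@l2_ip R J) l2_ip_gt0.

Lemma l2_normr_inner (f : l2) : `|f| ^+ 2 = (@l2_ip R J : {dot l2 for Num.conj}) f f.
Proof.
have -> : (@l2_ip R J : {dot l2 for Num.conj}) f f = (l2_norm f ^+ 2)%:C.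
  exact: (ipxx (l2_inner_product R J)).
by rewrite rmorphXn.
Qed.

HB.instance Definition _ := isHilbert.Build R l2 l2_normr_inner.

End l2_hilbert.

(** * The direct sum of all states *)

Section direct_sum.
Variable R : realType.
Local Notation C := R[i].
Variables (V : lmodType C) (nV : matrix_norms V) (hV : matricially_normed nV) (u : V).
Local Notation D := (dual nV).

Record state_of := StateOf {
  st_dim : nat; st_mx : 'M[D]_st_dim.+1; st_ok : dual_state u st_mx }.

(** The Hilbert sum of the spaces on which the states act is realised as one [l2] over pairs of a
    state and a coordinate. *)
Definition state_index : choiceType := {s : {classic state_of} & 'I_(st_dim s).+1}.

Definition at_state (s : state_of) (p : 'I_(st_dim s).+1) : state_index :=
  existT _ (s : {classic state_of}) p.

Local Notation H := (l2 R state_index).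

Lemma at_state_inj s : injective (@at_state s).
Proof.
move=> p q; apply: Eqdep_dec.inj_pair2_eq_dec => a b.
by have [] := pselect (a = b); [left|right].
Qed.

Definition block_seq (T : {fset {classic state_of}}) : seq state_index :=
  [seq @at_state s p | s <- enum_fset T, p <- enum 'I_(st_dim s).+1].

Lemma block_seq_uniq T : uniq (block_seq T).
Proof.
apply: (@allpairs_uniq_dep {classic state_of} (fun s => 'I_(st_dim s).+1) state_index
  (fun s p => @at_state s p) (enum_fset T) (fun s => enum 'I_(st_dim s).+1)) => [|s _|].
- exact: fset_uniq.
- exact: enum_uniq.
- by move=> [s p] [s' p'] _ _ /= e; exact: e.
Qed.

Lemma sum_block_seq (x : state_index -> R) T :
  \sum_(j <- block_seq T) x j = \sum_(s <- T) \sum_p x (@at_state s p).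
Proof.
rewrite /block_seq big_allpairs_dep; apply: eq_bigr => s _.
by rewrite big_enum.
Qed.

Definition fset_states (A : {fset state_index}) : {fset {classic state_of}} :=
  [fset tag j | j in A]%fset.

Lemma mem_block_seq A j : j \in A -> j \in block_seq (fset_states A).
Proof.
move=> jA; case: j jA => s p jA.
apply: (@allpairs_f_dep {classic state_of} (fun s => 'I_(st_dim s).+1) state_index
  (fun s p => @at_state s p)); last by rewrite mem_enum.
by apply/imfsetP; exists (existT _ s p).
Qed.

(** A finite index set is enlarged to a union of whole blocks, on which the direct sum acts block by
    block. *)
Lemma sum_le_blocks (x : state_index -> R) (A : {fset state_index}) :
  (forall j, 0 <= x j) ->
  \sum_(j <- A) x j <= \sum_(s <- fset_states A) \sum_p x (@at_state s p).
Proof.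
move=> x0; rewrite -sum_block_seq.
pose B := [fset j in block_seq (fset_states A)]%fset.
have -> : \sum_(j <- block_seq (fset_states A)) x j = \sum_(j <- B) x j.
  apply: perm_big; apply: uniq_perm; rewrite ?fset_uniq ?block_seq_uniq// => j.
  by rewrite [RHS]in_fset.
apply: ler_sum_fsubset => //; apply/fsubsetP => j jA.
by rewrite in_fset; exact: mem_block_seq.
Qed.

Definition vec_at (f : state_index -> C) (s : state_of) : 'cV[C]_(st_dim s).+1 :=
  \col_p f (@at_state s p).

Lemma euclid_vec_at f s : euclid (vec_at f s) ^+ 2 = \sum_p rnorm (f (@at_state s p)) ^+ 2.
Proof.
rewrite /euclid sqr_sqrtr; last by apply: sumr_ge0 => p _; exact: sqr_ge0.
by apply: eq_bigr => p _; rewrite mxE.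
Qed.

Lemma sum_euclid_vec_at (f : H) (T : {fset {classic state_of}}) :
  \sum_(s <- T) euclid (vec_at f s) ^+ 2 <= l2_sq f.
Proof.
under eq_bigr do rewrite euclid_vec_at.
have <- := sum_block_seq (fun j => rnorm (f j : C) ^+ 2) T.
apply: le_trans (sqsum_le f [fset j in block_seq T]%fset).
rewrite le_eqVlt; apply/orP; left; apply/eqP.
apply: perm_big; apply: uniq_perm; rewrite ?fset_uniq ?block_seq_uniq// => j.
by rewrite [RHS]in_fset.
Qed.

Lemma euclid_vec_at_le (f : H) s : euclid (vec_at f s) <= l2_norm f.
Proof.
rewrite -(ler_pXn2r (n := 2))// ?nnegrE ?sqrtr_ge0// (sqr_sqrtr (l2_sq_ge0 f)).
have := sum_euclid_vec_at f [fset (s : {classic state_of})]%fset.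
by rewrite big_seq_fset1.
Qed.

Definition direct_sum_fun (v : V) (f : state_index -> C) : state_index -> C^o :=
  fun j => let: existT s p := j in (mxev (st_mx s) v *m vec_at f s) p 0.

Lemma vec_at_direct_sum v f s :
  vec_at (direct_sum_fun v f) s = mxev (st_mx s) v *m vec_at f s.
Proof. by apply/matrixP => p q; rewrite ord1 mxE. Qed.

(** The [h i] are plain functions because their square-summability is itself deduced from this
    estimate, in the case [r = 1]. *)
Lemma direct_sum_sqsum r (y : 'M[V]_r) (f : 'I_r -> H) (h : 'I_r -> state_index -> C) c :
  0 <= c -> (forall s : state_of, mx_norms (map_mx (mxev (st_mx s)) y) <= c) ->
  (forall i s, vec_at (h i) s = \sum_j mxev (st_mx s) (y i j) *m vec_at (f j) s) ->
  forall A, \sum_i sqsum (h i) A <= c ^+ 2 * \sum_j l2_sq (f j).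
Proof.
move=> c0 hc hE A.
apply: (@le_trans _ _ (\sum_i \sum_(s <- fset_states A) euclid (vec_at (h i) s) ^+ 2)).
  apply: ler_sum => i _; under eq_bigr do rewrite euclid_vec_at.
  by apply: (sum_le_blocks (x := fun j => rnorm (h i j) ^+ 2)) => j; exact: sqr_ge0.
rewrite exchange_big/=.
apply: (@le_trans _ _ (\sum_(s <- fset_states A) c ^+ 2 * \sum_j euclid (vec_at (f j) s) ^+ 2)).
  apply: ler_sum => s _; under eq_bigr do rewrite hE.
  have := mx_norms_vec (map_mx (mxev (st_mx s)) y) (fun j => vec_at (f j) s).
  under eq_fun do under eq_bigr do rewrite mxE.
  set a := l2norm _ _; set b := l2norm _ _ => ab.
  have ab' : a <= c * b by apply: le_trans ab _; rewrite ler_wpM2r ?sqrtr_ge0.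
  have a2 : a ^+ 2 <= (c * b) ^+ 2.
    by rewrite ler_pXn2r// nnegrE ?mulr_ge0 ?sqrtr_ge0.
  by move: a2; rewrite exprMn /a /b !l2normE.
rewrite -mulr_sumr ler_wpM2l ?sqr_ge0// exchange_big/=.
by apply: ler_sum => j _; exact: sum_euclid_vec_at.
Qed.

Lemma state_of_le r (y : 'M[V]_r) (s : state_of) :
  mx_norms (map_mx (mxev (st_mx s)) y) <= nV y.
Proof. by case: (st_ok s) => cS _; exact: map_mx_state_le. Qed.

Lemma direct_sum_sqsum1 v (f : H) A :
  sqsum (direct_sum_fun v f) A <= vnorm nV v ^+ 2 * l2_sq f.
Proof.
have h i s : vec_at ((fun _ : 'I_1 => direct_sum_fun v f) i) s =
    \sum_(j < 1) mxev (st_mx s) ((const_mx v : 'M[V]_1) i j) *m vec_at f s.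
  by rewrite big_ord1 mxE vec_at_direct_sum.
have := @direct_sum_sqsum 1 (const_mx v) (fun=> f) _ (vnorm nV v) _ _ h A.
rewrite !big_ord1; apply; first exact: vnorm_ge0.
by move=> s; exact: state_of_le.
Qed.

Lemma direct_sum_in_l2 v (f : H) : direct_sum_fun v f \in @l2_pred R state_index.
Proof.
rewrite unfold_in; apply/asboolP; exists (vnorm nV v ^+ 2 * l2_sq f).
exact: direct_sum_sqsum1.
Qed.

Definition direct_sum_op v (f : H) : H := L2 (direct_sum_in_l2 v f).

Lemma direct_sum_op_blin v : direct_sum_op v \in @blin_pred R H (@rnorm R H) H.
Proof.
rewrite unfold_in; apply/asboolP; split=> [a f g|].
  apply: val_inj; apply/funext => -[s p] /=.
  have -> : vec_at (a *: f + g : H) s = a *: vec_at f s + vec_at g s.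
    by apply/matrixP => i j; rewrite !mxE.
  by rewrite mulmxDr -scalemxAr mxE [X in X + _]mxE.
exists (vnorm nV v) => f; rewrite -[rnorm _]/(l2_norm (direct_sum_op v f)).
rewrite -[rnorm f]/(l2_norm f).
have v0 := vnorm_ge0 hV v.
rewrite -(ler_pXn2r (n := 2))// ?nnegrE ?mulr_ge0 ?sqrtr_ge0//.
rewrite exprMn !sqr_sqrtr ?l2_sq_ge0//.
by apply: l2_sq_le => A; exact: direct_sum_sqsum1.
Qed.

Definition direct_sum_blop v : blop H := Blin (direct_sum_op_blin v).

Lemma direct_sum_linear : linear direct_sum_blop.
Proof.
move=> a v w; apply: val_inj; apply/funext => f; apply: val_inj; apply/funext => -[s p].
rewrite -[LHS]/((mxev (st_mx s) (a *: v + w) *m vec_at f s) p 0).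
rewrite -[RHS]/(a * (mxev (st_mx s) v *m vec_at f s) p 0 + (mxev (st_mx s) w *m vec_at f s) p 0).
by rewrite mxev_linear mulmxDl -scalemxAl mxE [X in X + _]mxE.
Qed.

Lemma direct_sum_norm_le k (y : 'M[V]_k) c : 0 <= c ->
  (forall s : state_of, mx_norms (map_mx (mxev (st_mx s)) y) <= c) ->
  blop_norms (map_mx direct_sum_blop y) <= c.
Proof.
move=> c0 hc; apply: ge_sup.
  eexists; exists (fun=> 0); last by [].
  by rewrite /= /l2norm big1 ?sqrtr0// => i _; rewrite rnorm0 expr0n.
move=> _ [f /= f1 <-].
set h := fun i => \sum_j _.
have hE i s : vec_at (h i) s = \sum_j mxev (st_mx s) (y i j) *m vec_at (f j) s.
  have vD (g g' : H) : vec_at (g + g' : H) s = vec_at g s + vec_at g' s.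
    by apply/matrixP => a b; rewrite !mxE.
  have v0 : vec_at (0 : H) s = 0 by apply/matrixP => a b; rewrite !mxE.
  rewrite (big_morph (fun g : H => vec_at g s) vD v0); apply: eq_bigr => j _.
  by rewrite mxE vec_at_direct_sum.
have sq : \sum_i l2_sq (h i) <= c ^+ 2 * \sum_j l2_sq (f j).
  have cv : \sum_i sqsum (h i) A @[A --> summability.totally] --> \sum_i l2_sq (h i).
    by apply: cvg_sum_seq => i; exact: sqsum_cvg.
  rewrite -(cvg_lim _ cv)//; apply: limr_le; first by apply/cvg_ex; eexists; exact: cv.
  apply: nearW => A.
  exact: (@direct_sum_sqsum _ y f (fun i => h i : state_index -> C) c c0 hc hE A).
have n2 (g : 'I_k -> H) : l2norm (@rnorm R H) g ^+ 2 = \sum_i l2_sq (g i).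
  rewrite l2normE.
  by apply: eq_bigr => i _; rewrite sqr_sqrtr ?l2_sq_ge0.
have fs0 : 0 <= l2norm (@rnorm R H) f by exact: sqrtr_ge0.
rewrite -(ler_pXn2r (n := 2))// ?nnegrE ?sqrtr_ge0// n2.
apply: le_trans sq _; rewrite -n2 ler_piMr ?sqr_ge0//.
by rewrite expr_le1.
Qed.

(** The extension of [v] by zero outside the block of [s]. Searching for [p] avoids transporting
    coordinates along equalities of states. *)
Definition at_block (s : state_of) (v : 'cV[C]_(st_dim s).+1) : state_index -> C^o :=
  fun j => if [pick p | j == @at_state s p] is Some p then v p 0 else 0.

Lemma at_blockE s v p : at_block v (@at_state s p) = v p 0.
Proof.
rewrite /at_block; case: pickP => [q /eqP/at_state_inj <-//|/(_ p)].
by rewrite eqxx.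
Qed.

Lemma at_block_other s v t p : t != s :> {classic state_of} ->
  at_block (v : 'cV[C]_(st_dim s).+1) (@at_state t p) = 0.
Proof.
move=> ts; rewrite /at_block; case: pickP => // q /eqP e.
by have /= e1 := congr1 tag e; rewrite e1 eqxx in ts.
Qed.

Lemma at_block_sqsum s (v : 'cV[C]_(st_dim s).+1) A :
  sqsum (at_block v) A <= euclid v ^+ 2.
Proof.
apply: (le_trans (sum_le_blocks (x := fun j => rnorm (at_block v j : C) ^+ 2) _ _)) => [j|].
  exact: sqr_ge0.
have E (t : {classic state_of}) : \sum_p rnorm (at_block v (@at_state t p) : C) ^+ 2 =
    if t == s then euclid v ^+ 2 else 0.
  case: eqP => [->|/eqP ts].
    rewrite /euclid sqr_sqrtr; last by apply: sumr_ge0 => p _; exact: sqr_ge0.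
    by apply: eq_bigr => p _; rewrite at_blockE.
  by rewrite big1// => p _; rewrite at_block_other// rnorm0 expr0n.
under eq_bigr do rewrite E.
have [sA|sA] := boolP ((s : {classic state_of}) \in fset_states A).
  rewrite (bigD1_seq _ sA (fset_uniq _))/= eqxx big1 ?addr0// => t /negbTE ts.
  by rewrite ts.
rewrite big_seq big1 ?sqr_ge0// => t tA; case: eqP => // ts.
by rewrite ts (negbTE sA) in tA.
Qed.

Lemma at_block_in_l2 s (v : 'cV[C]_(st_dim s).+1) : at_block v \in @l2_pred R state_index.
Proof.
by rewrite unfold_in; apply/asboolP; exists (euclid v ^+ 2); exact: at_block_sqsum.
Qed.

(** Test vectors are extended by zero from the block of [s], and the image is read on the same
    block; neither operation increases norms. *)
Lemma state_le_direct_sum k (y : 'M[V]_k) (s : state_of) :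
  mx_norms (map_mx (mxev (st_mx s)) y) <= blop_norms (map_mx direct_sum_blop y).
Proof.
apply: mx_norms_vec_le => v v1.
pose f j : H := L2 (at_block_in_l2 (v j)).
have f_le : l2norm (@rnorm R H) f <= l2norm (@euclid R _) v.
  rewrite /l2norm ler_wsqrtr//; apply: ler_sum => j _.
  rewrite -[rnorm (f j)]/(l2_norm (f j)) sqr_sqrtr ?l2_sq_ge0//.
  by apply: l2_sq_le => A; exact: at_block_sqsum.
have vf j : vec_at (f j) s = v j.
  by apply/matrixP => p q; rewrite ord1 mxE [LHS]at_blockE.
have hH := hilbert_inner_product H.
have := @ampnormP _ _ _ _ hH k (fun i j => map_mx direct_sum_blop y i j : H -> H)
  (fun i j => blopZ _) (fun i j => blop_bounded _) f.
rewrite -/(blop_norms (map_mx direct_sum_blop y)) => h.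
have b0 : 0 <= blop_norms (map_mx direct_sum_blop y).
  exact: (ampnorm_ge0 hH (fun i j => blop_bounded _)).
apply: (@le_trans _ _ (blop_norms (map_mx direct_sum_blop y) * l2norm (@rnorm R H) f)).
  apply: le_trans h; rewrite /l2norm ler_wsqrtr//; apply: ler_sum => i _.
  rewrite ler_pXn2r// ?nnegrE ?sqrtr_ge0 ?rnorm_ge0//.
  pose g : H := \sum_j map_mx direct_sum_blop y i j (f j).
  have -> : \sum_j map_mx (mxev (st_mx s)) y i j *m v j = vec_at g s.
    have vD (g1 g2 : H) : vec_at (g1 + g2 : H) s = vec_at g1 s + vec_at g2 s.
      by apply/matrixP => a b; rewrite !mxE.
    have v0 : vec_at (0 : H) s = 0 by apply/matrixP => a b; rewrite !mxE.
    rewrite (big_morph (fun g : H => vec_at g s) vD v0); apply: eq_bigr => j _.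
    by rewrite [in LHS]mxE [in RHS]mxE vec_at_direct_sum vf.
  exact: (euclid_vec_at_le g s).
rewrite ler_piMr//; exact: le_trans f_le v1.
Qed.

Lemma direct_sum_unit (h : H) : direct_sum_blop u h = h.
Proof.
apply: val_inj; apply/funext => -[s p].
rewrite -[LHS]/((mxev (st_mx s) u *m vec_at h s) p 0).
by case: (st_ok s) => _ ->; rewrite mul1mx mxE.
Qed.

Lemma embedding_of_n_cb_gt0 : vnorm nV u = 1 -> (0 < n_cb nV u)%E ->
  exists (K : hilbertType R) (Psi : {linear V -> blop K}),
    [/\ completely_contractive nV (@blop_norms R K) Psi,
        complete_top_injection nV (@blop_norms R K) Psi &
        forall h : K, Psi u h = h].
Proof.
move=> u1 t0.
pose lPsi := GRing.isLinear.Build C V (blop H) _ direct_sum_blop direct_sum_linear.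
pose Psi : {linear V -> blop H} := HB.pack direct_sum_blop lPsi.
have cPsi : completely_contractive nV (@blop_norms R H) Psi.
  apply/completely_contractiveP => k y y1; apply: direct_sum_norm_le => // s.
  exact: le_trans (state_of_le _ _) y1.
have [n0 [S0 sS0]] : exists n (S : 'M[D]_n.+1), dual_state u S.
  by apply: contrapT => /(n_cb_no_states hV u1) tE; rewrite tE in t0.
have [T T0 TE] := n_cb_gt0_real hV u1 t0.
(* The positive index [T] gives injectivity here and bounds the inverse by [T^-1] below. *)
have lower k (x : 'M[V]_k) : T * nV x <= blop_norms (map_mx Psi x).
  apply: (n_cb_le_states hV sS0 TE T0) => n S sS.
  exact: (state_le_direct_sum x (StateOf sS)).
have injPsi : injective Psi.
  move=> v w vw; apply/eqP; rewrite -subr_eq0; apply/eqP.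
  have x0 : nV (const_mx (v - w) : 'M[V]_1) = 0.
    apply/eqP; rewrite eq_le (matrix_norms_ge0 hV) andbT.
    rewrite -(ler_pM2l T0) mulr0; apply: le_trans (lower _ _) _.
    have -> : map_mx Psi (const_mx (v - w) : 'M[V]_1) = map_mx Psi 0.
      by apply/matrixP => i j; rewrite !mxE linearB linear0 vw subrr.
    apply: direct_sum_norm_le => // s.
    by apply: le_trans (state_of_le _ _) _; rewrite (matrix_norms0 hV).
  have [_ _ def _] := hV; have := def _ _ x0 => /matrixP/(_ 0 0).
  by rewrite !mxE.
exists H, Psi; split=> //; last exact: direct_sum_unit.
split=> //; first by apply: (le_lt_trans cPsi); exact: ltry.
(* A chosen preimage, with default 0 outside the range. *)
exists (fun B => xget 0 [set v | Psi v = B]).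
  by move=> v; apply: injPsi; exact: (@xgetPex _ 0 [set w | Psi w = Psi v] (ex_intro _ v erefl)).
apply: (@le_lt_trans _ _ (T^-1)%:E); last exact: ltry.
apply/cb_norm_on_le => k B rB B1; rewrite lee_fin.
set x := map_mx _ B.
have BE : map_mx Psi x = B.
  apply/matrixP => i j; rewrite !mxE; have [v _ vB] := rB i j.
  exact: (@xgetPex _ 0 [set w | Psi w = B i j] (ex_intro _ v vB)).
have := lower _ x; rewrite BE => h; have := le_trans h B1.
by rewrite -ler_pdivlMl// mulr1.
Qed.

End direct_sum.

Theorem corollary2p10 (R : realType) :
  (forall (V : lmodType R[i]) (nV : matrix_norms V) (u : V),
     matricially_normed nV -> vnorm nV u = 1%R ->
     ((0 < n_cb nV u)%E <->
      exists (H : hilbertType R) (Psi : {linear V -> blop H}),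
        [/\ completely_contractive nV (@blop_norms R H) Psi,
            complete_top_injection nV (@blop_norms R H) Psi &
            forall h : H, Psi u h = h])) /\
  (forall (V : lmodType R[i]) (nV : matrix_norms V) (u : V)
     (hV : operator_space nV), vnorm nV u = 1%R ->
     n_cb nV u =
     n_cb (dual_norms (dual_norms nV)) (bidual_embed (proj1 hV) u)).
Proof.
split=> [V nV u hV u1|V nV u hV u1]; last exact: n_cb_bidual.
split; first exact: embedding_of_n_cb_gt0.
move=> [H [Psi [cPsi iPsi Psiu]]].
exact: (n_cb_gt0_of_embedding hV cPsi Psiu u1 iPsi).
Qed.
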